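(* A very general nonsingular Fano $4$-fold weighted hypersurface of index $1$, defined over $\mathbb{C}$, is not stably rational. That is, a very general member of each of the four families $X_5 \subset \mathbb{P}^5$, $X_6 \subset \mathbb{P}(1^5,2)$, $X_8 \subset \mathbb{P}(1^5,4)$ and $X_{10} \subset \mathbb{P}(1^4,2,5)$ is not stably rational.
   Context: $X_d\subset \mathbb{P}(a_0,\dots,a_5)$ denotes a weighted hypersurface of degree $d$ in the weighted projective space with the indicated weights, where $1^k$ means $k$ coordinates of weight $1$. Such a Fano hypersurface has index $1$ when $\omega_X\cong\mathcal{O}_X(-1)$. By a known classification (Brown–Kasprzyk), the nonsingular Fano $4$-fold weighted hypersurfaces of index $1$ form exactly the four families $X_5 \subset \mathbb{P}^5$, $X_6 \subset \mathbb{P}(1^5,2)$, $X_8 \subset \mathbb{P}(1^5,4)$, $X_{10} \subset \mathbb{P}(1^4,2,5)$. ''Very general'' means: outside a countable union of proper closed subvarieties of the parameter space of each family. A variety $X$ is stably rational if $X\times\mathbb{P}^k$ is rational for some $k\ge0$. *)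

(* Defs.v *)
From HB Require Import structures.
From mathcomp Require Import all_boot all_order all_algebra.
From mathcomp Require Import fraction mpoly complex reals.

Set Implicit Arguments.
Unset Strict Implicit.
Unset Printing Implicit Defensive.

Import GRing.Theory.
Local Open Scope ring_scope.

(* Classical (closed-point) algebraic geometry over an algebraically closed
   field K, inside products of weighted projective spaces.

   An ambient space is given by homogeneous coordinates grouped in blocks, one
   block per factor; coordinate i has weight wt i for the grading attached to
   its block.  A point is represented by a coordinate vector v : 'I_(nv P) -> K
   that is nonzero on each block, taken modulo samept, the action of one copy
   of K^* per block; sets of points are predicates on representatives. *)
Record space := Space {
  nv : nat;
  nb : nat;
  blk : 'I_nv -> 'I_nb;
  wt : 'I_nv -> nat }.

Definition wproj n (a : 'I_n -> nat) : space := @Space n 1 (fun=> ord0) a.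

Definition proj k : space := @wproj k.+1 (fun=> 1%N).

Definition prod_space (P Q : space) : space :=
  @Space (nv P + nv Q) (nb P + nb Q)
    (fun i => match split i with
              | inl p => lshift (nb Q) (blk p)
              | inr q => rshift (nb P) (blk q)
              end)
    (fun i => match split i with inl p => wt p | inr q => wt q end).

Section Geometry.
Variable K : closedFieldType.

Section Ambient.
Variable P : space.

Notation vec := ('I_(nv P) -> K).
Notation form := {mpoly K[nv P]}.

Definition ispt (v : vec) : Prop :=
  forall j, exists2 i, blk i = j & v i != 0.

Definition samept (v v' : vec) : Prop :=
  exists2 t : 'I_(nb P) -> K, (forall j, t j != 0)
    & forall i, v' i = t (blk i) ^+ wt i * v i.

Definition mhomog (D : 'I_(nb P) -> nat) (p : form) : Prop :=
  forall m, m \in msupp p ->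
  forall j, (\sum_(i | blk i == j) wt i * m i)%N = D j.

Definition zclosed (Z : vec -> Prop) : Prop :=
  exists2 S : form -> Prop,
      (forall p, S p -> exists D, mhomog D p)
    & forall v, Z v <-> ispt v /\ (forall p, S p -> p.@[v] = 0).

Definition zopen (X U : vec -> Prop) : Prop :=
  exists2 Z, zclosed Z & forall v, U v <-> X v /\ ~ Z v.

Definition regular_fun (X U : vec -> Prop) (f : vec -> K) : Prop :=
  forall x, U x ->
  exists W D G H,
    [/\ zopen X W, W x, mhomog D G, mhomog D H
      & forall y, W y -> U y -> H.@[y] != 0 /\ f y = G.@[y] / H.@[y]].

(* The local ring at x of the subscheme F = 0 is loc_ring x modulo
   loc_ideal F x.  Working with the scheme structure, and not just with the set
   of zeros of F, makes a non-reduced F = 0 singular. *)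
Definition loc_ring (x : vec) (f : {fraction form}) : Prop :=
  exists D G H, [/\ mhomog D G, mhomog D H, H.@[x] != 0
                  & f = tofrac G / tofrac H].

Definition loc_max (x : vec) (f : {fraction form}) : Prop :=
  exists D G H, [/\ mhomog D G, mhomog D H, H.@[x] != 0, G.@[x] = 0
                  & f = tofrac G / tofrac H].

Definition loc_ideal (F : form) (x : vec) (f : {fraction form}) : Prop :=
  exists D A H, [/\ mhomog D (F * A), mhomog D H, H.@[x] != 0
                  & f = tofrac (F * A) / tofrac H].

(* The maximal ideal of the local ring at x of F = 0 is generated by r
   elements; this says that the local ring is regular when its dimension
   is r. *)
Definition regular_local (r : nat) (F : form) (x : vec) : Prop :=
  exists2 g : 'I_r -> {fraction form}, (forall i, loc_max x (g i))
    & forall f, loc_max x f ->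
      exists2 u : 'I_r -> {fraction form}, (forall i, loc_ring x (u i))
        & loc_ideal F x (f - \sum_(i < r) u i * g i).

End Ambient.

Definition var_morphism (P Q : space)
    (X U : ('I_(nv P) -> K) -> Prop) (Y V : ('I_(nv Q) -> K) -> Prop)
    (phi : ('I_(nv P) -> K) -> ('I_(nv Q) -> K)) : Prop :=
  [/\ forall u, U u -> V (phi u),
      forall u u', U u -> samept u u' -> samept (phi u) (phi u'),
      forall V', zopen Y V' -> (forall v, V' v -> V v) ->
        zopen X (fun u => U u /\ V' (phi u))
    & forall V' f, zopen Y V' -> (forall v, V' v -> V v) ->
        regular_fun Y V' f ->
        regular_fun X (fun u => U u /\ V' (phi u)) (fun u => f (phi u))].

(* X and Y have isomorphic nonempty open subsets; this is birationality for
   irreducible X and Y. *)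
Definition birational (P Q : space)
    (X : ('I_(nv P) -> K) -> Prop) (Y : ('I_(nv Q) -> K) -> Prop) : Prop :=
  exists U V phi psi,
    [/\ zopen X U /\ (exists u, U u),
        zopen Y V /\ (exists v, V v),
        var_morphism X U Y V phi /\ var_morphism Y V X U psi,
        forall u, U u -> samept (psi (phi u)) u
      & forall v, V v -> samept (phi (psi v)) v].

Definition prod_set (P Q : space)
    (X : ('I_(nv P) -> K) -> Prop) (Y : ('I_(nv Q) -> K) -> Prop) :
    ('I_(nv (prod_space P Q)) -> K) -> Prop :=
  fun v => X (fun i => v (lshift (nv Q) i)) /\ Y (fun i => v (rshift (nv P) i)).

Definition is_rational (P : space) (X : ('I_(nv P) -> K) -> Prop) : Prop :=
  exists n, birational X (@ispt (proj n)).

Definition stably_rational (P : space) (X : ('I_(nv P) -> K) -> Prop) : Prop :=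
  exists k, is_rational (prod_set X (@ispt (proj k))).

(* Q holds outside a countable union of proper closed subsets of the
   (irreducible) parameter space U, a subset of P with the induced topology. *)
Definition very_general (P : space) (U Q : ('I_(nv P) -> K) -> Prop) : Prop :=
  exists2 Z : nat -> ('I_(nv P) -> K) -> Prop,
      (forall s, zclosed (Z s) /\ exists2 c, U c & ~ Z s c)
    & forall c, U c -> (forall s, ~ Z s c) -> Q c.

Section Hypersurface.
Variables (n : nat) (a : n.-tuple nat) (d : nat).

(* The monomials of weighted degree d; the bound on the plain degree loses
   none of them, because all weights are meant to be positive. *)
Definition wmonomials : seq 'X_{1..n} :=
  [seq bmnm m | m <- enum {: 'X_{1..n < d.+1}}
              & (\sum_(i < n) tnth a i * bmnm m i == d)%N].

(* The projective space of forms of weighted degree d up to scalars. *)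
Definition param_space : space :=
  @wproj (size wmonomials) (fun=> 1%N).

Definition wform (c : 'I_(nv param_space) -> K) :
    {mpoly K[nv (wproj (tnth a))]} :=
  \sum_(i < size wmonomials) c i *: 'X_[tnth (in_tuple wmonomials) i].

Definition hypersurface (c : 'I_(nv param_space) -> K) :
    ('I_(nv (wproj (tnth a))) -> K) -> Prop :=
  fun v => ispt v /\ (wform c).@[v] = 0.

(* A hypersurface in a weighted projective space with n coordinates has
   dimension n - 2 at each of its points. *)
Definition nonsingular (c : 'I_(nv param_space) -> K) : Prop :=
  forall v, hypersurface c v -> regular_local n.-2 (wform c) v.

Definition nonsingular_family (c : 'I_(nv param_space) -> K) : Prop :=
  ispt c /\ nonsingular c.

Definition very_general_not_stably_rational : Prop :=
  very_general nonsingular_family (fun c => ~ stably_rational (hypersurface c)).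

End Hypersurface.

End Geometry.

(* Main.v *)
(** Degenerate the hypersurface to the inseparable cover w^p = f(y) in characteristic p, where
    d = e p and f is a loop of monomials y_i^(d-1) y_(i+1).  Derivations D_1, D_2, D_3 of the
    function field that kill w turn a point y into the 4 x 5 matrix with columns
    (wt_j y_j, D_1 y_j, D_2 y_j, D_3 y_j); its maximal minors times y_0^kappa, where kappa is
    d minus the sum of the weights, are the values of a regular 3-form of the cover, which is
    not zero at the generic point.

    If X x P^k is rational, then X is a retract of a projective space: there are forms Y_i with
    F(Y) = 0 and polynomials A_l with Y(A(x)) proportional to x on X, and the curve
    theta -> Y(v + theta A(x)) joins a constant point to the generic point.  For very general
    coefficients, the integer polynomials which vanish modulo p at the degenerate equation
    generate a proper ideal of the ring of the coefficients, so that some valuation ring of C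
    reduces F to w^p - f.  The Newton polygon of the curve replaces the reduction of the curve
    by a chain of rational curves in the special fibre, one for each edge.  A rational curve
    carries no nonzero form without poles, and the local shape of f at its critical points
    excludes poles there; so the vanishing of the 3-form propagates along the chain from the
    constant point to the generic point, a contradiction.

    The special coefficients, read in characteristic zero, define a nonsingular hypersurface;
    hence the forbidden closed sets are proper. *)

Require Import Defs.
From HB Require Import structures.
From mathcomp Require Import all_boot all_order all_algebra.
From mathcomp Require Import fraction mpoly complex reals.
From mathcomp Require Import ring zify qfpoly.
From mathcomp Require boolp classical_sets.

Set Implicit Arguments.
Unset Strict Implicit.
Unset Printing Implicit Defensive.

Import GRing.Theory.
Local Open Scope ring_scope.

(** * Places *)

(** In characteristic [p] the cover is singular over the critical points of [f], and the 3-form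
    might acquire poles on a resolution. No resolution is made: [local_condition] bounds the poles
    only along the curves that occur. In the four families the weights add up to [d + 1], so
    [kappa = e - 1]; with this exponent the minors and the partial derivatives of [f] have the same
    weights [d - w j], and their ratio along a rational curve is a function without twist: if it has
    no pole it is constant, and one zero kills it.

    The curve cannot be reduced modulo the place in one go: under a single normalization its
    reduction may lose an end point. The slices of its coefficients are therefore normalized
    separately, and one change of parameter for each slope shows both ends of an edge at once. The
    value group is arbitrary, so sizes are compared by divisibility in the valuation ring, and
    slopes are roots taken in the algebraically closed field. The factor [P^k] disappears because
    only a retraction is used: a point of it is fixed. *)

Section Chevalley.
Variables (K : fieldType) (S0 : K * bool -> Prop).

(** A subring and a proper ideal of it, packed into one subset of [K * bool] (flag [true] for the
    ring, [false] for the ideal), so that Zorn's lemma for inclusion of sets compares both at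
    once. *)
Definition ring_ideal_pair (X : K * bool -> Prop) : Prop :=
  [/\ X (1, true) /\ X (0, false),
      (forall x y b, X (x, b) -> X (y, b) -> X (x - y, b)),
      (forall x y b, X (x, true) -> X (y, b) -> X (x * y, b)),
      (forall x, X (x, false) -> X (x, true))
    & ~ X (1, false)].

Hypothesis S0P : ring_ideal_pair S0.

Lemma maximal_pair : exists X : K * bool -> Prop,
  [/\ ring_ideal_pair X, (forall u, S0 u -> X u)
    & forall Y, ring_ideal_pair Y -> (forall u, X u -> Y u) ->
      forall u, Y u -> X u].
Proof.
(* The union with [S0] is part of the predicate: the empty union of the empty chain then stands for
   [S0] itself. *)
pose U (X : K * bool -> Prop) u := X u \/ S0 u.
have [|X [PX maxX]] := @classical_sets.Zorn_bigcup _
    (fun X : classical_sets.set (K * bool) => ring_ideal_pair (U X)).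
- move=> F PF totF.
  have [[X0 FX0]|noF] := boolp.pselect (exists X, F X); last first.
    have -> : U (classical_sets.bigcup F id) = S0; last exact: S0P.
    apply/boolp.funext => u; apply/boolp.propext; split; last by right.
    by case=> // -[X FX]; case: noF; exists X.
  have inU X u : F X -> U X u -> U (classical_sets.bigcup F id) u.
    by move=> FX [Xu|]; [left; exists X | right].
  have outU u : U (classical_sets.bigcup F id) u -> exists2 X, F X & U X u.
    by case=> [[X FX Xu]|Su]; [exists X => //; left | exists X0 => //; right].
  have out2 u v : U (classical_sets.bigcup F id) u ->
      U (classical_sets.bigcup F id) v -> exists X, [/\ F X, U X u & U X v].
    move=> /outU[X FX Xu] /outU[Y FY Yv].
    have [XY|YX] := totF X Y FX FY.
      by exists Y; split=> //; case: Xu => [/XY|]; [left|right].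
    by exists X; split=> //; case: Yv => [/YX|]; [left|right].
  split.
  + by split; apply: (inU X0) => //; case: (PF X0 FX0) => -[].
  + move=> x y b Hx Hy; have [X [FX Xx Xy]] := out2 _ _ Hx Hy.
    by apply: (inU X) => //; case: (PF X FX) => _ + _ _ _; apply.
  + move=> x y b Hx Hy; have [X [FX Xx Xy]] := out2 _ _ Hx Hy.
    by apply: (inU X) => //; case: (PF X FX) => _ _ + _ _; apply.
  + move=> x /outU[X FX Xx]; apply: (inU X) => //.
    by case: (PF X FX) => _ _ _ + _; apply.
  + by move=> /outU[X FX X1]; case: (PF X FX).
- exists (U X); split=> //; first by move=> u; right.
  move=> Y PY XY u Yu.
  have YE : U Y = Y.
    apply/boolp.funext => v; apply/boolp.propext; split; last by left.
    by case=> // Sv; apply: XY; right.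
  have [XYeq|nXY] := boolp.pselect (X = Y); first by left; rewrite XYeq.
  have nPY : classical_sets.proper X Y.
    split=> [v Xv|E]; first by apply: XY; left.
    apply: nXY; apply/boolp.funext => v; apply/boolp.propext.
    by split=> [Xv|]; [apply: XY; left | exact: E].
  by case: (maxX _ nPY); rewrite /= YE.
Qed.

Variable X : K * bool -> Prop.
Hypothesis XP : ring_ideal_pair X.
Hypothesis Xmax : forall Y, ring_ideal_pair Y -> (forall u, X u -> Y u) ->
  forall u, Y u -> X u.

Let A x := X (x, true).
Let I x := X (x, false).

Let X1 : A 1. Proof. by case: XP => -[]. Qed.
Let X0 : I 0. Proof. by case: XP => -[]. Qed.
Let XB x y b : X (x, b) -> X (y, b) -> X (x - y, b).
Proof. by case: XP => _ + _ _ _; apply. Qed.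
Let XM x y b : A x -> X (y, b) -> X (x * y, b).
Proof. by case: XP => _ _ + _ _; apply. Qed.
Let XIA x : I x -> A x. Proof. by case: XP => _ _ _ + _; apply. Qed.
Let nI1 : ~ I 1. Proof. by case: XP. Qed.

Let Xz b : X (0, b). Proof. by case: b; [exact: XIA | exact: X0]. Qed.
Let XN x b : X (x, b) -> X (- x, b).
Proof. by move=> Hx; rewrite -[- x]add0r; apply: XB. Qed.
Let XD x y b : X (x, b) -> X (y, b) -> X (x + y, b).
Proof. by move=> Hx Hy; rewrite -[y]opprK; apply/XB/XN. Qed.
Let Xsum b (J : Type) (r : seq J) (P : pred J) (F : J -> K) :
  (forall i, P i -> X (F i, b)) -> X (\sum_(i <- r | P i) F i, b).
Proof.
by move=> H; apply: (big_ind (fun x => X (x, b))) => //; move=> x y; exact: XD.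
Qed.

Let coefs b (p : {poly K}) := forall i, X (p`_i, b).

Let coefsM b p q : coefs true p -> coefs b q -> coefs b (p * q).
Proof. by move=> Hp Hq i; rewrite coefM; apply: Xsum => j _; apply: XM. Qed.

Let coefsC b c : X (c, b) -> coefs b c%:P.
Proof. by move=> Hc i; rewrite coefC; case: eqP. Qed.

(** Under this hypothesis the values at [x] of the polynomials over the ring and over the ideal form
    a larger pair, so maximality applies. *)
Lemma maximal_pair_adjoin x :
  (forall p, coefs false p -> p.[x] <> 1) -> A x.
Proof.
move=> nx; pose Y (u : K * bool) := exists2 p, coefs u.2 p & p.[x] = u.1.
have XY u : X u -> Y u.
  by case: u => c b Hc; exists c%:P; [exact: coefsC | rewrite hornerC].
apply: (Xmax (Y := Y)) => //.
  split.
  - by split; apply: XY; [exact: X1 | exact: X0].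
  - move=> y z b [p Hp /= <-] [q Hq /= <-]; exists (p - q) => /=; last by rewrite !hornerE.
    by move=> i; rewrite coefB; apply: XB.
  - move=> y z b [p Hp /= <-] [q Hq /= <-]; exists (p * q) => /=; last by rewrite !hornerE.
    exact: coefsM.
  - by move=> y [p Hp /= <-]; exists p => // i; apply/XIA/Hp.
  - by move=> [p Hp /= px1]; apply: (nx p).
exists 'X; last by rewrite hornerX.
by move=> i; rewrite coefX; case: eqP => _; [exact: X1 | exact: Xz].
Qed.

(** A relation [p.[(1 - i)^-1] = 1] over the ideal, cleared of denominators, puts a power of [1 - i]
    in the ideal, although this power is 1 modulo the ideal. *)
Lemma maximal_pair_unit i : I i -> A (1 - i)^-1.
Proof.
move=> Ii; apply: maximal_pair_adjoin => p Hp p1.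
have ni : 1 - i != 0.
  by apply/eqP => /eqP; rewrite subr_eq0 => /eqP E; apply: nI1; rewrite E.
have A1i : A (1 - i) by apply/XB/XIA.
have AX n : A ((1 - i) ^+ n).
  by elim: n => [|n IHn]; [rewrite expr0; exact: X1 | rewrite exprS; exact: XM].
have IX n : I (1 - (1 - i) ^+ n).
  elim: n => [|n IHn]; first by rewrite expr0 subrr.
  have -> : 1 - (1 - i) ^+ n.+1 = (1 - (1 - i) ^+ n) + (1 - i) ^+ n * i.
    by rewrite exprSr; ring.
  by apply: XD => //; apply: XM.
apply: nI1; rewrite -(subrK ((1 - i) ^+ (size p)) 1); apply: XD; first exact: IX.
have -> : (1 - i) ^+ size p = (1 - i) ^+ size p * p.[(1 - i)^-1].
  by rewrite p1 mulr1.
rewrite horner_coef big_distrr /=.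
apply: Xsum => k _.
have -> : (1 - i) ^+ size p * (p`_k * (1 - i)^-1 ^+ k)
    = (1 - i) ^+ (size p - k) * p`_k.
  by rewrite (expfB _ (ltn_ord k)) exprVn mulrCA mulrC.
exact: XM.
Qed.

(** Descent on the total size of two relations that forbid adjoining [x] and its inverse: the longer
    one is shortened with the help of the other. *)
Let no_relation_le n (p q : {poly K}) (x : K) : x != 0 ->
  (size p + size q <= n)%N -> coefs false p -> coefs false q ->
  p.[x] = 1 -> q.[x^-1] = 1 -> False.
Proof.
elim: n p q x => [|n IHn] p q x nx.
  rewrite leqn0 addn_eq0 size_poly_eq0 => /andP[/eqP -> _] _ _.
  by rewrite hornerC => /eqP; rewrite eq_sym oner_eq0.
wlog: p q x nx / (size q <= size p)%N.
  move=> H Hs Hp Hq p1 q1; case/orP: (leq_total (size q) (size p)) => Hsz.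
    exact: (H p q x).
  by apply: (H q p x^-1) => //; rewrite ?invr_eq0 ?invrK // addnC.
move=> sqp Hs Hp Hq p1 q1.
have sp1 : (1 < size p)%N.
  rewrite ltnNge; apply/negP => /size1_polyC pC; apply: nI1.
  by rewrite -p1 pC hornerC; apply: Hp.
pose m := (size p).-1.
have spm : size p = m.+1 by rewrite prednK // ltnW.
pose p0 := \poly_(i < m) p`_i.
pose q0 := \poly_(k < m) q`_(m - k).
have p0x : p0.[x] = 1 - p`_m * x ^+ m.
  by rewrite -p1 horner_poly horner_coef spm big_ord_recr /= addrK.
have q0x : q0.[x] = (1 - q`_0) * x ^+ m.
  have : q.[x^-1] * x ^+ m = x ^+ m by rewrite q1 mul1r.
  rewrite spm in sqp; rewrite (horner_coef_wide _ sqp).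
  rewrite big_ord_recl expr0 mulr1 mulrDl mulrBl mul1r => {1}<-.
  rewrite addrAC subrr add0r horner_poly big_distrl /=.
  rewrite (reindex_inj rev_ord_inj) /=; apply: eq_bigr => k _.
  have km : (k < m)%N by [].
  have -> : (m - (m - k.+1) = k.+1)%N by lia.
  rewrite /bump /= add1n -mulrA; congr (_ * _).
  rewrite exprVn mulrC; apply: (mulIf (expf_neq0 k.+1 nx)).
  by rewrite -exprD subnK // -mulrA mulVf ?mulr1 ?expf_neq0.
(* The top term of [p] is eliminated between the two relations. Multiplying the first by [1 - q_0],
   instead of dividing the second by it, keeps all coefficients in the ideal. *)
pose p' := (1 - q`_0)%:P * p0 + (p`_m)%:P * q0 + (q`_0)%:P.
apply: (IHn p' q x) => //.
- have sp0 : (size p0 <= m)%N by apply: size_poly.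
  have sq0 : (size q0 <= m)%N by apply: size_poly.
  suff : (size p' <= m)%N.
    move=> H.
    by rewrite (leq_trans (leq_add H (leqnn _))) // -ltnS -addSn -spm.
  have sC c (r : {poly K}) : (size r <= m -> size (c%:P * r)%R <= m)%N.
    by move=> sr; rewrite mul_polyC (leq_trans (size_scale_leq _ _)).
  have m1 : (0 < m)%N by rewrite -ltnS -spm.
  apply: (leq_trans (size_polyD _ _)); rewrite geq_max.
  rewrite (leq_trans (size_polyC_leq1 _) m1) andbT.
  by apply: (leq_trans (size_polyD _ _)); rewrite geq_max !sC.
- have A1q : A (1 - q`_0) by apply/XB/XIA/Hq.
  move=> i; rewrite !coefD !coefCM !coef_poly coefC.
  apply: XD; last by case: eqP.
  apply: XD; first by apply: XM => //; case: ifP.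
  by apply: XM; [apply/XIA/Hp | case: ifP].
- by rewrite !hornerE p0x q0x; ring.
Qed.

Lemma maximal_pair_valuation x : x != 0 -> A x \/ A x^-1.
Proof.
move=> nx; apply: boolp.contrapT => H.
have /boolp.existsNP[p Hp] : ~ forall p, coefs false p -> p.[x] <> 1.
  by move=> /maximal_pair_adjoin Ax; apply: H; left.
have /boolp.existsNP[q Hq] : ~ forall p, coefs false p -> p.[x^-1] <> 1.
  by move=> /maximal_pair_adjoin Ax; apply: H; right.
have [cp p1] : coefs false p /\ p.[x] = 1 by apply: boolp.contrapT; tauto.
have [cq q1] : coefs false q /\ q.[x^-1] = 1 by apply: boolp.contrapT; tauto.
exact: (no_relation_le nx (leqnn _) cp cq).
Qed.

(** [I + A x] is an ideal of [A]. If it is proper, maximality puts [x] in [I]; otherwise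
    [a x = 1 - i], and [1 - i] is invertible in [A]. *)
Lemma maximal_pair_local x : A x -> ~ I x -> A x^-1.
Proof.
move=> Ax nIx; pose Y (u : K * bool) :=
  if u.2 then A u.1 else exists i a, [/\ I i, A a & u.1 = i + a * x].
have [Y1|nY1] := boolp.pselect (Y (1, false)).
  case: Y1 => i [a [Ii Aa /= E]].
  have ax : a * x = 1 - i by rewrite E addrAC subrr add0r.
  have ni : 1 - i != 0.
    by apply/eqP => /eqP; rewrite subr_eq0 => /eqP E'; apply: nI1; rewrite E'.
  have nx : x != 0 by move: ni; rewrite -ax mulf_eq0 negb_or => /andP[].
  have -> : x^-1 = (1 - i)^-1 * a.
    by rewrite -ax invfM mulrAC mulVf ?mul1r //; move: ni; rewrite -ax mulf_eq0 negb_or => /andP[].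
  by apply: XM => //; apply: maximal_pair_unit.
case: nIx; apply: (Xmax (Y := Y)).
- split=> //.
  + by split=> //; exists 0, 0; split; rewrite ?mul0r ?addr0 //; apply: Xz.
  + move=> y z [|]; first exact: XB.
    move=> [i [a [Ii Aa /= ->]]] [j [b [Ij Ab /= ->]]].
    by exists (i - j), (a - b); split; [exact: XB | exact: XB | rewrite /=; ring].
  + move=> y z [|]; first exact: XM.
    move=> Ay [j [b [Ij Ab /= ->]]].
    by exists (y * j), (y * b); split; [exact: XM | exact: XM | rewrite /= mulrDr mulrA].
  + by move=> y [j [b [Ij Ab /= ->]]]; apply: XD; [exact: XIA | exact: XM].
- move=> [y []] //= Iy; exists y, 0.
  by split; [exact: Iy | exact: Xz | rewrite mul0r addr0].
- by exists 0, 1; split; [exact: X0 | exact: X1 | rewrite add0r mul1r].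
Qed.

End Chevalley.

Section ResidueField.
Variables (K : fieldType) (X : K * bool -> Prop).
Hypothesis XP : ring_ideal_pair X.
Hypothesis Xmax : forall Y, ring_ideal_pair Y -> (forall u, X u -> Y u) ->
  forall u, Y u -> X u.

Definition vring_pred : {pred K} := fun x => boolp.asbool (X (x, true)).

Lemma vring_closed : subring_closed vring_pred.
Proof.
case: XP => -[X1 X0] XB XM XIA nI; split; first exact/boolp.asboolP.
- by move=> x y /boolp.asboolP Hx /boolp.asboolP Hy; apply/boolp.asboolP/XB.
- by move=> x y /boolp.asboolP Hx /boolp.asboolP Hy; apply/boolp.asboolP/XM.
Qed.

HB.instance Definition _ := GRing.isSubringClosed.Build K vring_pred vring_closed.

Record vring := VRing { vval : K; _ : vval \in vring_pred }.
HB.instance Definition _ := [isSub for vval].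
HB.instance Definition _ := [Choice of vring by <:].
HB.instance Definition _ := [SubChoice_isSubComNzRing of vring by <:].

Definition vmax : {pred vring} := fun x => boolp.asbool (X (vval x, false)).

Lemma vmax_ideal : idealr_closed vmax.
Proof.
case: XP => -[X1 X0] XB XM XIA nI; split.
- exact/boolp.asboolP.
- by apply/negP => /boolp.asboolP.
- move=> a x y /boolp.asboolP Hx /boolp.asboolP Hy; apply/boolp.asboolP.
  rewrite /= -[vval y]opprK; apply: (XB).
    by apply: XM => //; case: a => a /= /boolp.asboolP.
  by rewrite -[- vval y]add0r; apply: XB.
Qed.

HB.instance Definition _ := isIdealr.Build vring vmax vmax_ideal.

Definition residue := {ideal_quot vmax}.
HB.instance Definition _ := GRing.ComNzRing.on residue.

Definition residue_map : {rmorphism vring -> residue} := (\pi_residue)%qT.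

Lemma residue_map_eq0 (x : vring) : (residue_map x == 0) = (x \in vmax).
Proof. by rewrite -(rmorph0 residue_map) -Quotient.idealrBE subr0. Qed.

Lemma residue_inv_ex (x : residue) : x != 0 -> exists y, y * x = 1.
Proof.
elim/quotW: x => x; rewrite (residue_map_eq0 x) => nx.
have [Ax nIx] : X (vval x, true) /\ ~ X (vval x, false).
  case: x nx => x /= Ax /boolp.asboolP nIx; split=> //.
  exact/boolp.asboolP.
have x0 : vval x != 0.
  by apply/eqP => E; apply: nIx; rewrite E; case: XP => -[].
have Ai := maximal_pair_local XP Xmax Ax nIx.
have Ai' : (vval x)^-1 \in vring_pred by apply/boolp.asboolP.
exists (residue_map (VRing Ai')).
rewrite -[(\pi x)%qT]/(residue_map x) -rmorphM -(rmorph1 residue_map).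
by congr (residue_map _); apply: val_inj; rewrite /= mulVf.
Qed.

Definition residue_inv (x : residue) : residue :=
  match boolp.pselect (exists y, y * x = 1) with
  | left H => projT1 (boolp.cid H) | right _ => 0 end.

Lemma residue_mulVf (x : residue) : x != 0 -> residue_inv x * x = 1.
Proof.
move=> /residue_inv_ex H; rewrite /residue_inv; case: boolp.pselect => // H'.
exact: (projT2 (boolp.cid H')).
Qed.

Lemma residue_inv0 : residue_inv 0 = 0.
Proof.
rewrite /residue_inv; case: boolp.pselect => // H; exfalso.
by case: H => y; rewrite mulr0 => /eqP; rewrite eq_sym oner_eq0.
Qed.

HB.instance Definition _ :=
  GRing.ComNzRing_isField.Build residue residue_mulVf residue_inv0.

Lemma maximal_pair_place :
  exists (O : comNzRingType) (k : fieldType)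
         (inc : {rmorphism O -> K}) (res : {rmorphism O -> k}),
  [/\ injective inc,
      (forall x, (exists a, inc a = x) \/ exists2 a, res a = 0 & x * inc a = 1)
    & forall x, X (x, true) -> exists2 a, inc a = x
      & X (x, false) -> res a = 0].
Proof.
pose O : comNzRingType := vring.
pose k : fieldType := residue.
exists O, k, (\val : {rmorphism vring -> K}), (residue_map).
have res0 a : (residue_map a = 0) <-> X (vval a, false).
  split; first by move/eqP; rewrite residue_map_eq0 => /boolp.asboolP.
  by move=> H; apply/eqP; rewrite residue_map_eq0; apply/boolp.asboolP.
split.
- exact: val_inj.
- move=> x; have [->|x0] := eqVneq x 0; first by left; exists 0; rewrite rmorph0.
  have [Ax|nAx] := boolp.pselect (X (x, true)).
    have Ax' : x \in vring_pred by apply/boolp.asboolP.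
    by left; exists (VRing Ax').
  have [//|Ai] := maximal_pair_valuation XP Xmax x0.
  have Ai' : x^-1 \in vring_pred by apply/boolp.asboolP.
  right; exists (VRing Ai'); last by rewrite /= mulfV.
  apply/res0 => /=; apply: boolp.contrapT => nI; apply: nAx.
  by rewrite -[x]invrK; apply: (maximal_pair_local XP Xmax).
- move=> x Ax; have Ax' : x \in vring_pred by apply/boolp.asboolP.
  by exists (VRing Ax') => // Ix; exact/res0.
Qed.

End ResidueField.

(** Chevalley's extension theorem. The place is given by the inclusion of its valuation ring and by
    its residue map; in the second clause either [x] lies in the ring or its inverse lies in the
    maximal ideal. *)
Theorem exists_place (K : fieldType) (S0 : K * bool -> Prop) :
  ring_ideal_pair S0 ->
  exists (O : comNzRingType) (k : fieldType)
         (inc : {rmorphism O -> K}) (res : {rmorphism O -> k}),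
  [/\ injective inc,
      (forall x, (exists a, inc a = x) \/ exists2 a, res a = 0 & x * inc a = 1)
    & forall x, S0 (x, true) -> exists2 a, inc a = x
      & S0 (x, false) -> res a = 0].
Proof.
move=> /maximal_pair[X [XP S0X Xmax]].
have [O [k [inc [res [inj val ext]]]]] := maximal_pair_place XP Xmax.
exists O, k, inc, res; split=> // x /S0X Ax.
by have [a ax ra] := ext x Ax; exists a => // /S0X.
Qed.

(** * Minors and their zeros along rational curves *)

Section Ordinals5.
Definition o0 : 'I_5 := @Ordinal 5 0 isT.
Definition o1 : 'I_5 := @Ordinal 5 1 isT.
Definition o2 : 'I_5 := @Ordinal 5 2 isT.
Definition o3 : 'I_5 := @Ordinal 5 3 isT.
Definition o4 : 'I_5 := @Ordinal 5 4 isT.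

Lemma ord5_ind (P : 'I_5 -> Prop) : P o0 -> P o1 -> P o2 -> P o3 -> P o4 ->
  forall j, P j.
Proof.
move=> P0 P1 P2 P3 P4 [[|[|[|[|[|j]]]]] lj] //.
- by rewrite (_ : Ordinal lj = o0) //; apply: val_inj.
- by rewrite (_ : Ordinal lj = o1) //; apply: val_inj.
- by rewrite (_ : Ordinal lj = o2) //; apply: val_inj.
- by rewrite (_ : Ordinal lj = o3) //; apply: val_inj.
- by rewrite (_ : Ordinal lj = o4) //; apply: val_inj.
Qed.

Lemma sum_ord5 (V : nmodType) (F : 'I_5 -> V) :
  \sum_j F j = F o0 + F o1 + F o2 + F o3 + F o4.
Proof.
rewrite !big_ord_recl big_ord0 addr0 !addrA.
by congr (_ + _ + _ + _ + _); congr F; apply: val_inj.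
Qed.

End Ordinals5.

Definition derivation (R : nzRingType) (D : R -> R) : Prop :=
  (forall x y, D (x + y) = D x + D y) /\
  (forall x y, D (x * y) = D x * y + x * D y).

Section Derivation.
Variables (R : comNzRingType) (D : R -> R).
Hypothesis derD : derivation D.

Lemma derivationD x y : D (x + y) = D x + D y. Proof. by case: derD. Qed.
Lemma derivationM x y : D (x * y) = D x * y + x * D y. Proof. by case: derD. Qed.
Lemma derivation0 : D 0 = 0.
Proof. by apply: (addrI (D 0)); rewrite -derivationD !addr0. Qed.
Lemma derivation1 : D 1 = 0.
Proof.
by apply: (addrI (D 1)); rewrite addr0 -{3}[1]mul1r derivationM mulr1 mul1r.
Qed.
Lemma derivationN x : D (- x) = - D x.
Proof. by apply/eqP; rewrite -addr_eq0 -derivationD addNr derivation0. Qed.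
Lemma derivationB x y : D (x - y) = D x - D y. Proof. by rewrite derivationD derivationN. Qed.
Lemma derivation_sum (J : Type) (r : seq J) (P : pred J) (F : J -> R) :
  D (\sum_(i <- r | P i) F i) = \sum_(i <- r | P i) D (F i).
Proof. exact: (big_morph D derivationD derivation0). Qed.
Lemma derivationMn x n : D (x *+ n) = D x *+ n.
Proof. by elim: n => [|n IHn]; rewrite ?mulr0n ?derivation0 // !mulrS derivationD IHn. Qed.
Lemma derivation_int (z : int) : D z%:~R = 0.
Proof.
case: z => n; first by rewrite -[RHS](mul0rn _ n) -derivation1 -derivationMn.
by rewrite NegzE mulrNz derivationN -[_%:~R]/(1 *+ n.+1) derivationMn derivation1 mul0rn oppr0.
Qed.
Lemma derivationX x n : D (x ^+ n) = x ^+ n.-1 * D x *+ n.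
Proof.
elim: n => [|n IHn]; first by rewrite expr0 derivation1 mulr0n.
rewrite exprS derivationM IHn mulrS /= mulrC; congr (_ + _).
by case: n {IHn} => [|n]; rewrite ?mulr0n ?mulr0 // mulrnAr mulrA -exprS.
Qed.
End Derivation.

Section Minors.
Variables (R : comNzRingType) (D : nat -> R -> R).
Hypothesis derD : forall i, derivation (D i).

Implicit Types (a b c : nat -> R) (x y : R).

Definition det4 (a b c e : nat -> R) : R :=
  (a 0%N * b 1%N - a 1%N * b 0%N) * (c 2%N * e 3%N - c 3%N * e 2%N)
  - (a 0%N * b 2%N - a 2%N * b 0%N) * (c 1%N * e 3%N - c 3%N * e 1%N)
  + (a 0%N * b 3%N - a 3%N * b 0%N) * (c 1%N * e 2%N - c 2%N * e 1%N)
  + (a 1%N * b 2%N - a 2%N * b 1%N) * (c 0%N * e 3%N - c 3%N * e 0%N)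
  - (a 1%N * b 3%N - a 3%N * b 1%N) * (c 0%N * e 2%N - c 2%N * e 0%N)
  + (a 2%N * b 3%N - a 3%N * b 2%N) * (c 0%N * e 1%N - c 1%N * e 0%N).

(* The column of an element [x] of weight [n]: the first entry is the derivative
   of [x] along the Euler vector field. *)
Definition gcol (n : nat) x : nat -> R :=
  fun i => if i is i'.+1 then D i' x else x *+ n.

Lemma gcolD n x y i : gcol n (x + y) i = gcol n x i + gcol n y i.
Proof. by case: i => [|i] /=; rewrite ?mulrnDl ?(derivationD (derD _)). Qed.

Lemma gcolM m n x y i : gcol (m + n) (x * y) i = gcol m x i * y + x * gcol n y i.
Proof.
case: i => [|i] /=; last exact: (derivationM (derD _)).
by rewrite mulrnDr mulrnAl mulrnAr.
Qed.

Lemma gcolX m x n i : gcol (n * m) (x ^+ n) i = x ^+ n.-1 * gcol m x i *+ n.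
Proof.
case: i => [|i] /=; last exact: (derivationX (derD _)).
case: n => [|n]; first by rewrite mul0n !mulr0n.
by rewrite mulnC mulrnA mulrnAr -exprSr.
Qed.

Variable w : 'I_5 -> nat.

(** The columns left after deleting [j] are taken in the cyclic order [j+1, ..., j+4]. This
    permutation has sign [(-1)^j], the sign of Cramer's rule, so no signs are written. *)
Definition minor (y : 'I_5 -> R) (j : 'I_5) : R :=
  let c k := gcol (w k) (y k) in
  match val j with
  | 0 => det4 (c o1) (c o2) (c o3) (c o4)
  | 1 => det4 (c o2) (c o3) (c o4) (c o0)
  | 2 => det4 (c o3) (c o4) (c o0) (c o1)
  | 3 => det4 (c o4) (c o0) (c o1) (c o2)
  | _ => det4 (c o0) (c o1) (c o2) (c o3)
  end.

(* Cramer's rule: the kernel of a 4 x 5 matrix is spanned by its signed minors. *)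
Lemma minor_parallel (y g : 'I_5 -> R) :
  (forall i, \sum_j g j * gcol (w j) (y j) i = 0) ->
  forall i j, minor y i * g j = minor y j * g i.
Proof.
move=> H.
suff main (c : 'I_5 -> nat -> R) (M := fun j : 'I_5 => match val j with
    | 0 => det4 (c o1) (c o2) (c o3) (c o4)
    | 1 => det4 (c o2) (c o3) (c o4) (c o0)
    | 2 => det4 (c o3) (c o4) (c o0) (c o1)
    | 3 => det4 (c o4) (c o0) (c o1) (c o2)
    | _ => det4 (c o0) (c o1) (c o2) (c o3)
    end) : (forall i, \sum_j g j * c j i = 0) ->
    forall i j : 'I_5, (i < j)%N -> M i * g j = M j * g i.
  move=> i j; case: (ltngtP i j) => [ij|ji|/val_inj->//].
    exact: (main (fun k => gcol (w k) (y k)) H i j ij).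
  exact/esym/(main (fun k => gcol (w k) (y k)) H j i ji).
move=> E; pose S := fun k => \sum_j g j * c j k.
have Z (s : R) a b e : s = det4 S a b e \/ s = - det4 S a b e -> s = 0.
  by case=> ->; rewrite /det4 /S !E; ring.
clear H; move: Z; rewrite /S {S E} => Z i j ij; apply: subr0_eq.
(* The three columns other than [i] and [j]: in the determinant of the vanishing combination with
   these three, only the terms in [g i] and [g j] survive. *)
pose t := match val i, val j with
  | 0, 1 => (o2, o3, o4) | 0, 2 => (o1, o3, o4) | 0, 3 => (o1, o2, o4)
  | 0, 4 => (o1, o2, o3) | 1, 2 => (o0, o3, o4) | 1, 3 => (o0, o2, o4)
  | 1, 4 => (o0, o2, o3) | 2, 3 => (o0, o1, o4) | 2, 4 => (o0, o1, o3)
  | _, _ => (o0, o1, o2) end.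
apply: (Z _ (c t.1.1) (c t.1.2) (c t.2)); rewrite /t /M /det4 !sum_ord5 {t M Z}.
move: i j ij; do 2!elim/ord5_ind; move=> //= _.
all: move: (c o0) (c o1) (c o2) (c o3) (c o4) (g o0) (g o1) (g o2) (g o3) (g o4)
  => c0 c1 c2 c3 c4 g0 g1 g2 g3 g4.
all: first [left; ring | right; ring].
Qed.
End Minors.

Section MinorScaling.
Variables (R : comNzRingType).

Lemma det4_scale (a b c e A B C E : nat -> R) (sa sb sc se : R) :
    (forall i, a i = sa * A i) -> (forall i, b i = sb * B i) ->
    (forall i, c i = sc * C i) -> (forall i, e i = se * E i) ->
  det4 a b c e = (sa * sb * sc * se) * det4 A B C E.
Proof. by move=> aE bE cE' eE; rewrite /det4 !aE !bE !cE' !eE; ring. Qed.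

(** Multiplication by [mu] combined with adding multiples of row 0 to the other rows. Up to a factor
    for each column, this is how a change of representative of a weighted point acts. *)
Lemma det4_shear (a b c e : nat -> R) (mu : R) (dl : nat -> R)
    (T := fun (c : nat -> R) i => mu * c i + c 0%N * dl i) : dl 0%N = 0 ->
  det4 (T a) (T b) (T c) (T e) = mu ^+ 4 * det4 a b c e.
Proof.
rewrite /det4 /T /= => ->.
move: (a 0%N) (a 1%N) (a 2%N) (a 3%N) (b 0%N) (b 1%N) (b 2%N) (b 3%N) => a0 a1 a2 a3 b0 b1 b2 b3.
move: (c 0%N) (c 1%N) (c 2%N) (c 3%N) (e 0%N) (e 1%N) (e 2%N) (e 3%N) => c0 c1 c2 c3 e0 e1 e2 e3.
move: (dl 1%N) (dl 2%N) (dl 3%N) => d1 d2 d3; ring.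
Qed.

Lemma det4_linear (a b u v u' v' dl : nat -> R) (q P s s' : R) :
  det4 a b (fun i => q * P * u i + s * q * dl i) (fun i => P * v i + s' * dl i)
  = q * P * (P * det4 a b u v + s' * det4 a b u dl + s * det4 a b dl v).
Proof.
rewrite /det4.
move: (a 0%N) (a 1%N) (a 2%N) (a 3%N) (b 0%N) (b 1%N) (b 2%N) (b 3%N) => a0 a1 a2 a3 b0 b1 b2 b3.
move: (u 0%N) (u 1%N) (u 2%N) (u 3%N) (v 0%N) (v 1%N) (v 2%N) (v 3%N) => u0 u1 u2 u3 v0 v1 v2 v3.
move: (dl 0%N) (dl 1%N) (dl 2%N) (dl 3%N) => d0 d1 d2 d3; ring.
Qed.

Lemma eq_det4 (a b c e A B C E : nat -> R) :
  a =1 A -> b =1 B -> c =1 C -> e =1 E -> det4 a b c e = det4 A B C E.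
Proof. by move=> aE bE cE eE; rewrite /det4 !aE !bE !cE !eE. Qed.

Variable D : nat -> R -> R.
Hypothesis derD : forall i, derivation (D i).

Definition dcol (P : R) i := if i is i'.+1 then D i' P else 0.

Lemma gcol_scale n (P v : R) k i :
  gcol D n (P ^+ k * v) i = P ^+ k * gcol D n v i + (P ^+ k.-1 * v *+ k) * dcol P i.
Proof.
case: i => [|i] /=; first by rewrite mulr0 addr0 mulrnAr.
by rewrite (derivationM (derD _)) (derivationX (derD _)); ring.
Qed.

(** A term of order [P^(m-1)] would contain the column of derivatives of [P] twice, so it cancels.
    The part [Y] contains that column once and disappears when every [D i] kills [P]. *)
Lemma det4_dvd a b n n' (P v v' : R) m : (0 < m)%N ->
  exists X Y, det4 a b (gcol D n (P ^+ m * v)) (gcol D n' (P * v'))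
     = P ^+ m * (P * X + Y) /\ ((forall i, D i P = 0) -> Y = 0).
Proof.
case: m => // m _; pose u := gcol D n v; pose u' := gcol D n' v'.
exists (det4 a b u u').
exists (v' * det4 a b u (dcol P) + (v *+ m.+1) * det4 a b (dcol P) u').
have -> : det4 a b (gcol D n (P ^+ m.+1 * v)) (gcol D n' (P * v')) =
  det4 a b (fun i => P ^+ m * P * u i + (v *+ m.+1) * P ^+ m * dcol P i)
    (fun i => P * u' i + v' * dcol P i).
  apply: eq_det4 => // i.
    by rewrite gcol_scale /= exprSr -mulrnAr [_ * (v *+ _)]mulrC.
  by rewrite -{1}[P]expr1 gcol_scale /= expr1 expr0 mul1r mulr1n.
rewrite det4_linear // exprSr; split; first by rewrite -addrA.
move=> H; have d0 i : dcol P i = 0 by case: i => //= i; rewrite H.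
by rewrite /det4 !d0; ring.
Qed.

Variable w : 'I_5 -> nat.
Hypothesis w_gt0 : forall j, (0 < w j)%N.

Lemma minor_scale (mu : R) (y : 'I_5 -> R) n j : (n + w j = \sum_k w k)%N ->
  minor D w (fun k => mu ^+ w k * y k) j = mu ^+ n * minor D w y j.
Proof.
pose T (c : nat -> R) i := mu * c i + c 0%N * dcol mu i.
have cE k i : gcol D (w k) (mu ^+ w k * y k) i
    = mu ^+ (w k).-1 * T (gcol D (w k) (y k)) i.
  have wE : mu ^+ w k = mu ^+ (w k).-1 * mu by rewrite -exprSr prednK.
  by rewrite gcol_scale /T wE /=; ring.
have pE k : mu ^+ (w k).-1 * mu = mu ^+ w k by rewrite -exprSr prednK.
have main p q r s : det4 (gcol D (w p) (mu ^+ w p * y p)) (gcol D (w q) (mu ^+ w q * y q))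
    (gcol D (w r) (mu ^+ w r * y r)) (gcol D (w s) (mu ^+ w s * y s))
  = mu ^+ (w p + w q + w r + w s) * det4 (gcol D (w p) (y p)) (gcol D (w q) (y q))
     (gcol D (w r) (y r)) (gcol D (w s) (y s)).
  rewrite (det4_scale (cE p) (cE q) (cE r) (cE s)) det4_shear // !exprD -!pE.
  ring.
rewrite sum_ord5; move: j; elim/ord5_ind => En; rewrite /minor /= main;
  congr (_ ^+ _ * _); lia.
Qed.
End MinorScaling.

(** * Weighted forms, evaluation and Euler's relation *)

Definition whomog (R : nzRingType) n (w : 'I_n -> nat) d (P : {mpoly R[n]}) :=
  forall m, m \in msupp P -> (\sum_i w i * m i)%N = d.

Lemma whomog_deriv (R : nzRingType) n (w : 'I_n -> nat) d (P : {mpoly R[n]}) j :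
  whomog w d P -> whomog w (d - w j) P^`M(j).
Proof.
move=> hP m; rewrite mcoeff_msupp mcoeff_deriv => nz.
have /hP <- : (m + U_(j))%MM \in msupp P.
  by rewrite mcoeff_msupp; apply: contraNneq nz => ->; rewrite mul0rn.
have -> : (\sum_i w i * (m + U_(j))%MM i = \sum_i w i * m i + w j)%N.
  under eq_bigr => i _ do rewrite mnmDE mulnDr.
  rewrite big_split /=; congr (_ + _)%N; rewrite (bigD1 j) //= mnm1E eqxx muln1.
  rewrite big1 ?addn0 // => i ij.
  by rewrite mnm1E eq_sym (negPf ij) muln0.
by rewrite addnK.
Qed.

Section Evaluation.
Variable (R : comNzRingType).

Definition ev (y : 'I_5 -> R) (P : {mpoly int[5]}) : R := mmap (intmul 1) y P.
HB.instance Definition _ y := GRing.RMorphism.copy (ev y) (mmap (intmul 1) y).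

Lemma evC y c : ev y c%:MP = c%:~R. Proof. exact: mmapC. Qed.
Lemma evXU y i : ev y 'X_i = y i. Proof. by rewrite /ev mmapX mmap1U. Qed.
Lemma evE y P : ev y P = \sum_(m <- msupp P) (P@_m)%:~R * \prod_i y i ^+ m i.
Proof. by []. Qed.

Lemma ev_scale w d P (mu : R) y : whomog w d P ->
  ev (fun i => mu ^+ w i * y i) P = mu ^+ d * ev y P.
Proof.
move=> hP; rewrite !evE big_distrr /=; apply: eq_big_seq => m mP.
rewrite mulrCA; congr (_ * _); rewrite -(hP m mP).
rewrite (eq_bigr (fun i => mu ^+ (w i * m i) * y i ^+ m i)); last first.
  by move=> i _; rewrite exprMn exprM.
rewrite big_split /=; congr (_ * _).
by elim/big_rec2: _ => [|k a b _ ->]; rewrite ?expr0 // exprD.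
Qed.

Section EvalDerivation.
Variable D : R -> R.
Hypothesis derD : derivation D.

Lemma derivation_ev y P : D (ev y P) = \sum_j ev y P^`M(j) * D (y j).
Proof.
pose Q P := D (ev y P) = \sum_j ev y P^`M(j) * D (y j).
have QC c : Q c%:MP.
  by rewrite /Q evC (derivation_int derD) big1 // => j _; rewrite mderivC raddf0 mul0r.
have QM p q : Q p -> Q q -> Q (p * q).
  rewrite /Q rmorphM (derivationM derD) => -> ->; rewrite big_distrl big_distrr /=.
  rewrite -big_split; apply: eq_bigr => j _ /=.
  by rewrite mderivM rmorphD !rmorphM /=; ring.
have QX i : Q 'X_i.
  rewrite /Q evXU (bigD1 i) //= big1 ?addr0 => [|j ji].
    by rewrite mderivX mnm1E eqxx scale1r -{1}[U_(i)%MM]add0m addmK mpolyX0 rmorph1 mul1r.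
  by rewrite mderivX mnm1E eq_sym (negPf ji) scale0r raddf0 mul0r.
have QXm m : Q 'X_[m].
  rewrite mpolyXE_id; apply: (big_ind Q) => //; first by have := QC 1.
  move=> i _; elim: (m i) => [|k IHk]; first by rewrite expr0; have := QC 1.
  by rewrite exprS; apply: QM.
rewrite -/(Q P); elim/mpolyind: P => [|c m p _ _ Qp]; first by have := QC 0.
move: (QM _ _ (QC c) (QXm m)); rewrite mul_mpolyC => Qm.
rewrite /Q raddfD (derivationD derD) Qp Qm -big_split; apply: eq_bigr => j _ /=.
by rewrite raddfD rmorphD mulrDl.
Qed.
End EvalDerivation.

Lemma euler_ev w d y P : whomog w d P ->
  \sum_j ev y P^`M(j) * (y j *+ w j) = ev y P *+ d.
Proof.
move=> hP.
have XE m : \sum_j 'X_[m]^`M(j) * ('X_j *+ w j) = 'X_[m] *+ (\sum_i w i * m i) :> {mpoly int[5]}.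
  rewrite -sumrMnr; apply: eq_bigr => j _; rewrite mderivX mulrnAr mulnC mulrnA.
  congr (_ *+ _); have [->|mj] := eqVneq (m j) 0%N; first by rewrite scale0r mul0r mulr0n.
  by rewrite -scalerAl -mpolyXD submK ?lep1mP // scaler_nat.
have -> : \sum_j ev y P^`M(j) * (y j *+ w j) = ev y (\sum_j P^`M(j) * ('X_j *+ w j)).
  by rewrite rmorph_sum; apply: eq_bigr => j _; rewrite /= rmorphM rmorphMn /= evXU.
rewrite -rmorphMn; congr (ev y _).
transitivity (\sum_(m <- msupp P) P@_m *: ('X_[m] *+ d)); last first.
  by rewrite [in RHS](mpolyE P) -sumrMnl; apply: eq_bigr => m _; rewrite scalerMnr.
have dE j : P^`M(j) = \sum_(m <- msupp P) P@_m *: 'X_[m]^`M(j).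
  by rewrite {1}[P]mpolyE raddf_sum; apply: eq_bigr => m _; rewrite /= mderivZ.
under eq_bigr => j _ do rewrite dE big_distrl /=.
rewrite exchange_big /=; apply: eq_big_seq => m /hP md.
under eq_bigr => j _ do rewrite -scalerAl.
by rewrite -scaler_sumr XE md.
Qed.

(** Row 0 is Euler's relation and the other rows are the chain rule. *)
Lemma gcol_ev (D : nat -> R -> R) (derD : forall i, derivation (D i)) w d y P i :
  whomog w d P ->
  gcol D d (ev y P) i = \sum_j ev y P^`M(j) * gcol D (w j) (y j) i.
Proof.
move=> hP; case: i => [|i] /=; first by rewrite -(euler_ev y hP).
exact: derivation_ev.
Qed.
End Evaluation.

Section TopCoefficient.
Variable R : comNzRingType.

(** [c] is the value at infinity of [P] as a section of degree [n] on the projective line; it may be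
    zero. *)
Definition top n (P : {poly R}) c := (size P <= n.+1)%N /\ P`_n = c.

Lemma topD n P Q a b : top n P a -> top n Q b -> top n (P + Q) (a + b).
Proof.
move=> [sP <-] [sQ <-]; split; last by rewrite coefD.
by rewrite (leq_trans (size_polyD _ _)) // geq_max sP.
Qed.

Lemma topN n P a : top n P a -> top n (- P) (- a).
Proof. by move=> [sP <-]; split; rewrite ?size_polyN ?coefN. Qed.

Lemma topB n P Q a b : top n P a -> top n Q b -> top n (P - Q) (a - b).
Proof. by move=> tP tQ; apply: topD => //; apply: topN. Qed.

Lemma top0 n : top n 0 0.
Proof. by split; rewrite ?size_poly0 ?coef0. Qed.

Lemma topMn n P a k : top n P a -> top n (P *+ k) (a *+ k).
Proof.
by move=> tP; elim: k => [|k IHk]; [exact: top0 | rewrite !mulrS; exact: topD].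
Qed.

Lemma topM m n P Q a b : top m P a -> top n Q b -> top (m + n) (P * Q) (a * b).
Proof.
move=> [sP <-] [sQ <-]; split.
  by apply: leq_trans (size_polyMleq _ _) _; lia.
rewrite coefM (bigD1 (Ordinal (leq_addr n m : (m < (m + n).+1)%N))) //=.
rewrite addKn big1 ?addr0 // => k; rewrite -val_eqE /= => km.
have [lt_km|le_mk] := ltnP k m.
  by rewrite [Q`__]nth_default ?mulr0 // (leq_trans sQ) //; lia.
by rewrite [P`__]nth_default ?mul0r // (leq_trans sP) //; lia.
Qed.

Lemma top1 : top 0 1 1.
Proof. by split; rewrite ?size_poly1 ?coef1. Qed.

Lemma topX n P a k : top n P a -> top (k * n) (P ^+ k) (a ^+ k).
Proof.
by move=> tP; elim: k => [|k IHk]; [exact: top1 | rewrite mulSn !exprS; exact: topM].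
Qed.

Lemma top_sum n (J : eqType) (r : seq J) (F : J -> {poly R}) (f : J -> R) :
  (forall i, i \in r -> top n (F i) (f i)) ->
  top n (\sum_(i <- r) F i) (\sum_(i <- r) f i).
Proof.
elim: r => [|i r IHr] H; first by rewrite !big_nil; exact: top0.
rewrite !big_cons; apply: topD; first by apply: H; rewrite mem_head.
by apply: IHr => j jr; apply: H; rewrite inE jr orbT.
Qed.

Lemma top_prod (J : Type) (r : seq J) (n : J -> nat) (F : J -> {poly R}) (f : J -> R) :
  (forall i, top (n i) (F i) (f i)) ->
  top (\sum_(i <- r) n i) (\prod_(i <- r) F i) (\prod_(i <- r) f i).
Proof.
move=> H; elim: r => [|i r IHr]; first by rewrite !big_nil; exact: top1.
by rewrite !big_cons; apply: topM.
Qed.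

Lemma topC (c : R) : top 0 c%:P c.
Proof. by split; rewrite ?coefC ?size_polyC_leq1. Qed.

Lemma top_ev N w d P (y : 'I_5 -> {poly R}) (b : 'I_5 -> R) : whomog w d P ->
  (forall i, top (N * w i) (y i) (b i)) -> top (N * d) (ev y P) (ev b P).
Proof.
move=> hP Hy; rewrite !evE; apply: top_sum => m mP.
rewrite -[X in top X]add0n; apply: topM.
  by rewrite -[(P@_m)%:~R in X in top _ X](rmorph_int polyC); exact: topC.
rewrite -(hP m mP) big_distrr /=; apply: top_prod => i.
by rewrite mulnA mulnC; exact: topX.
Qed.

Section TopDerivation.
Variable D : nat -> R -> R.
Hypothesis derD : forall i, derivation (D i).

(** Only the coefficients are differentiated: the parameter of the curve counts as a constant. *)
Definition polyD i (P : {poly R}) := \poly_(k < size P) D i P`_k.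

Lemma coef_polyD i P k : (polyD i P)`_k = D i P`_k.
Proof.
rewrite coef_poly; case: ltnP => // sk.
by rewrite nth_default // (derivation0 (derD i)).
Qed.

Lemma polyD_derivation i : derivation (polyD i).
Proof.
split=> P Q; apply/polyP => k.
  by rewrite coefD !coef_polyD coefD (derivationD (derD i)).
rewrite coefD !coefM coef_polyD coefM (derivation_sum (derD i)) -big_split.
by apply: eq_bigr => j _ /=; rewrite (derivationM (derD i)) !coef_polyD.
Qed.

Lemma polyD_X i : polyD i 'X = 0.
Proof.
apply/polyP => k; rewrite coef_polyD coefX coef0.
by case: eqP => _; rewrite ?(derivation1 (derD i)) ?(derivation0 (derD i)).
Qed.

Lemma polyD_C i c : polyD i c%:P = (D i c)%:P.
Proof.
apply/polyP => k; rewrite coef_polyD !coefC.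
by case: eqP => // _; rewrite (derivation0 (derD i)).
Qed.

Lemma top_minor N w (y : 'I_5 -> {poly R}) (b : 'I_5 -> R) n j :
  (n + w j = \sum_k w k)%N ->
  (forall i, top (N * w i) (y i) (b i)) ->
  top (N * n) (minor polyD w y j) (minor D w b j).
Proof.
move=> nE Hy.
have Hc k i : top (N * w k) (gcol polyD (w k) (y k) i) (gcol D (w k) (b k) i).
  case: i => [|i] /=; first exact: topMn.
  have [sy <-] := Hy k; split; last by rewrite coef_polyD.
  exact: leq_trans (size_poly _ _) sy.
have H2 p q i k : top (N * (w p + w q)) (gcol polyD (w p) (y p) i * gcol polyD (w q) (y q) k
      - gcol polyD (w p) (y p) k * gcol polyD (w q) (y q) i)
    (gcol D (w p) (b p) i * gcol D (w q) (b q) k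
      - gcol D (w p) (b p) k * gcol D (w q) (b q) i).
  by rewrite mulnDr; apply: topB; apply: topM.
have H4 p q r s : (n = w p + w q + (w r + w s))%N ->
  top (N * n) (det4 (gcol polyD (w p) (y p)) (gcol polyD (w q) (y q))
      (gcol polyD (w r) (y r)) (gcol polyD (w s) (y s)))
    (det4 (gcol D (w p) (b p)) (gcol D (w q) (b q)) (gcol D (w r) (b r)) (gcol D (w s) (b s))).
  move=> ->; rewrite mulnDr /det4.
  by do !apply: topD; try apply: topN; apply: topM; apply: H2.
move: nE; rewrite sum_ord5; move: j; elim/ord5_ind => nE; apply: H4 => /=; lia.
Qed.

Lemma horner0_minor w (y : 'I_5 -> {poly R}) j :
  (minor polyD w y j).[0] = minor D w (fun i => (y i).[0]) j.
Proof.
have Hc k i : (gcol polyD (w k) (y k) i).[0] = gcol D (w k) (y k).[0] i.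
  by case: i => [|i] /=; rewrite !horner_coef0 ?coefMn // coef_polyD.
have H4 (a b c e : nat -> {poly R}) : (det4 a b c e).[0]
    = det4 (fun i => (a i).[0]) (fun i => (b i).[0]) (fun i => (c i).[0]) (fun i => (e i).[0]).
  by rewrite /det4 !hornerE.
by move: j; elim/ord5_ind; rewrite /minor H4; apply: eq_det4 => i; rewrite Hc.
Qed.

Lemma horner0_ev (y : 'I_5 -> {poly R}) P : (ev y P).[0] = ev (fun i => (y i).[0]) P.
Proof.
rewrite !evE horner_sum; apply: eq_bigr => m _ /=.
rewrite hornerM horner_prod -[(P@_m)%:~R in LHS](rmorph_int polyC) hornerC.
by congr (_ * _); apply: eq_bigr => i _; rewrite horner_exp.
Qed.
End TopDerivation.
End TopCoefficient.

Section PolyDivisibility.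
Variable L : fieldType.

Lemma exists_irreducible_dvdp (Q : {poly L}) : (1 < size Q)%N ->
  exists2 q, irreducible_poly q & q %| Q.
Proof.
have [n] := ubnP (size Q); elim: n Q => // n IHn Q sQn sQ.
have [iQ|nQ] := boolp.pselect (irreducible_poly Q); first by exists Q.
have [q [sq qQ nqQ]] : exists q : {poly L}, [/\ size q != 1%N, q %| Q & ~~ (q %= Q)].
  apply: boolp.contrapT => H; apply: nQ; split=> // q sq qQ.
  by apply/negP => /negP nqQ; apply: H; exists q.
have Q0 : Q != 0 by rewrite -size_poly_gt0 ltnW.
have ltq : (size q < size Q)%N.
  by rewrite ltn_neqAle dvdp_leq // andbT (dvdp_size_eqp qQ).
have q0 : q != 0 by apply: contraNneq Q0 => q0; rewrite -dvd0p -q0.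
have sq1 : (1 < size q)%N by rewrite ltn_neqAle eq_sym sq size_poly_gt0.
have [r ir rq] := IHn q (leq_trans ltq sQn) sq1.
by exists r => //; apply: dvdp_trans rq qQ.
Qed.

(** With the weights [w] this measures the common factor of a weighted point, with all weights 1 the
    order of vanishing of a gradient. *)
Lemma exists_max_exponent (q : {poly L}) (w : 'I_5 -> nat) (g : 'I_5 -> {poly L}) j0 :
  (forall i, (0 < w i)%N) -> (1 < size q)%N -> g j0 != 0 ->
  exists m, (forall j, q ^+ (m * w j) %| g j)
    /\ ~ (forall j, q ^+ (m.+1 * w j) %| g j).
Proof.
move=> wpos sq g0; pose P m := [forall j, q ^+ (m * w j) %| g j].
have P0 : exists m, P m.
  by exists 0%N; apply/forallP => j; rewrite mul0n expr0 dvd1p.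
have Pb m : P m -> (m <= size (g j0))%N.
  move=> /forallP/(_ j0)/dvdp_leq-/(_ g0); apply: leq_trans.
  apply: leq_trans (leq_pred _); rewrite size_exp.
  rewrite (leq_trans (leq_pmulr m (wpos j0))) //.
  by rewrite leq_pmull // -subn1 subn_gt0.
case: (ex_maxnP P0 Pb) => m /forallP Pm maxm; exists m; split=> //.
by move=> /forallP /maxm; rewrite ltnn.
Qed.

End PolyDivisibility.

(** * The 3-form along one rational curve *)

Section Edge.
Variables (w : 'I_5 -> nat) (d kappa p : nat) (f : {mpoly int[5]}).
Hypothesis w_gt0 : forall i, (0 < w i)%N.
Hypothesis w_o0 : w o0 = 1%N.
Hypothesis dE : (kappa + \sum_i w i = d)%N.
Hypothesis f_homog : whomog w d f.
Hypothesis p_prime : prime p.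
Hypothesis p_dvd_d : (p %| d)%N.

Definition grad (R : comNzRingType) (y : 'I_5 -> R) j := ev y f^`M(j).

Definition tminor (R : comNzRingType) (D : nat -> R -> R) (y : 'I_5 -> R) j :=
  y o0 ^+ kappa * minor D w y j.

(** [q] is a closed point of the parameter line where the curve [y] meets the critical locus, and
    [m] is the order of the gradient there. Some index [j] must attain this order and give a ratio
    [tminor D y j / grad y j] without pole at [q]. If the derivations kill [q], as for the end point
    [q = 'X], and [y] is not zero at [q], the ratio must even vanish there. *)
Definition local_condition : Prop :=
  forall (L : fieldType) (D : nat -> {poly L} -> {poly L}),
  p%:R = 0 :> L -> (forall i, derivation (D i)) ->
  forall (q : {poly L}) (y : 'I_5 -> {poly L}) m,
  irreducible_poly q -> (0 < m)%N -> ~ (forall i, q ^+ w i %| y i) ->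
  (forall j, q ^+ m %| grad y j) -> (exists j, ~~ (q ^+ m.+1 %| grad y j)) ->
  exists j, [/\ ~~ (q ^+ m.+1 %| grad y j), q ^+ m %| tminor D y j
    & (forall i, D i q = 0) -> (exists i, ~~ (q %| y i)) ->
      q ^+ m.+1 %| tminor D y j].

Hypothesis Hloc : local_condition.

(* The value at [a] of the regular 3-form on the p-cyclic cover w^p = f attached
   to [a_0 ^ kappa] vanishes, or [a] is a critical point of [f]. *)
Definition null_form (L : comNzRingType) (D : nat -> L -> L) (a : 'I_5 -> L) : Prop :=
  (exists j, grad a j != 0) -> forall j, tminor D a j = 0.

Lemma grad_scale (R : comNzRingType) (mu : R) y j :
  grad (fun i => mu ^+ w i * y i) j = mu ^+ (d - w j) * grad y j.
Proof. exact/ev_scale/whomog_deriv. Qed.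

Lemma w_le_sum j : (w j <= \sum_i w i)%N.
Proof. by rewrite (bigD1 j) //= leq_addr. Qed.

Lemma tminor_scale (R : comNzRingType) (D : nat -> R -> R) (mu : R) y j :
  (forall i, derivation (D i)) ->
  tminor D (fun i => mu ^+ w i * y i) j = mu ^+ (d - w j) * tminor D y j.
Proof.
move=> derD; have wj := w_le_sum j.
rewrite /tminor (@minor_scale _ D derD w w_gt0 mu y (\sum_i w i - w j)); last by rewrite subnK.
rewrite w_o0 expr1 exprMn (_ : (d - w j = kappa + (\sum_i w i - w j))%N) ?exprD; last by lia.
by ring.
Qed.

Section OneEdge.
Variables (L : fieldType) (D : nat -> L -> L).
Hypothesis charL : p%:R = 0 :> L.
Hypothesis derD : forall i, derivation (D i).

Lemma null_form_scale (mu : L) a : mu != 0 ->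
  null_form D (fun i => mu ^+ w i * a i) -> null_form D a.
Proof.
move=> mu0 H [j0 gj0] j; have : tminor D (fun i => mu ^+ w i * a i) j = 0.
  by apply: H; exists j0; rewrite grad_scale mulf_neq0 // expf_neq0.
by rewrite tminor_scale // => /eqP; rewrite mulf_eq0 expf_eq0 (negPf mu0) andbF => /eqP.
Qed.

Variables (N : nat) (y : 'I_5 -> {poly L}) (b : 'I_5 -> L) (omega : {poly L}).
Hypothesis y_top : forall i, top (N * w i) (y i) (b i).
Hypothesis y_cover : ev y f = omega ^+ p.

Let Dp := polyD D.
Let derDp i : derivation (Dp i) := polyD_derivation derD i.

Let charP : p%:R = 0 :> {poly L}.
Proof. by rewrite -polyC1 -polyCMn charL. Qed.

(** The sum is the column of [ev y f], that is of a p-th power; characteristic [p] and [p %| d]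
    annihilate it. So the gradient lies in the kernel of the matrix and is parallel to the
    minors. *)
Lemma edge_relation i : \sum_j grad y j * gcol Dp (w j) (y j) i = 0.
Proof.
rewrite -(gcol_ev derDp _ _ f_homog) y_cover; have /dvdnP[k ->] := p_dvd_d.
by rewrite mulnC (gcolX derDp) -[_ *+ p]mulr_natr charP mulr0.
Qed.

Let g := grad y.
Let M := tminor Dp y.

Let par i j : M i * g j = M j * g i.
Proof.
by rewrite /M /tminor -!mulrA (minor_parallel edge_relation i j).
Qed.

(* The only possible poles of the 3-form along the curve [y] are at points where
   the curve meets the critical locus. *)
Lemma edge_ratio i0 j0 : y i0 != 0 -> g j0 != 0 -> exists P, forall j, M j = P * g j.
Proof.
move=> y0 g0; pose G := gcdp (M j0) (g j0).
have G0 : G != 0 by rewrite gcdp_eq0 negb_and g0 orbT.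
pose P := M j0 %/ G; pose Q := g j0 %/ G.
have PE : M j0 = P * G by rewrite divpK // dvdp_gcdl.
have QE : g j0 = Q * G by rewrite divpK // dvdp_gcdr.
have cPQ : coprimep Q P by rewrite coprimep_sym coprimep_div_gcd // g0 orbT.
have Q0 : Q != 0 by apply: contraNneq g0; rewrite QE => ->; rewrite mul0r.
have MQ j : M j * Q = P * g j.
  by apply: (mulIf G0); rewrite -mulrA -QE par PE; ring.
have [sQ|sQ] := leqP (size Q) 1.
  have [c QC] : exists c, Q = c%:P by exists Q`_0; apply: size1_polyC.
  have c0 : c != 0 by move: Q0; rewrite QC polyC_eq0.
  exists (c^-1 *: P) => j; rewrite -scalerAl -MQ QC mulrC mul_polyC scalerA.
  by rewrite mulVf // scale1r.
(* [q] is the place of a pole of the ratio in lowest terms. *)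
have [q iq qQ] := exists_irreducible_dvdp sQ.
have sq1 : (1 < size q)%N by case: iq.
have q0 : q != 0 by rewrite -size_poly_gt0 ltnW.
(* The largest weighted power of [q] is removed from [y], as [local_condition] requires. Minors and
   gradient change by the same factor, so the ratio is kept. *)
have [e [ye nye]] := exists_max_exponent w_gt0 sq1 y0.
pose y' i := y i %/ q ^+ (e * w i).
have yE : y =1 fun i => (q ^+ e) ^+ w i * y' i.
  by move=> i; rewrite -exprM mulrC divpK.
have qe0 n : q ^+ n != 0 by rewrite expf_neq0.
have gE j : g j = (q ^+ e) ^+ (d - w j) * grad y' j.
  by rewrite -grad_scale /g /grad; apply: mmap_eqr || congr mmap; apply: boolp.funext.
have ME j : M j = (q ^+ e) ^+ (d - w j) * tminor Dp y' j.
  rewrite -tminor_scale // /M; congr tminor; exact: boolp.funext.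
have g'0 : grad y' j0 != 0.
  by apply: contraNneq g0 => gz; rewrite gE gz mulr0.
have M'Q j : tminor Dp y' j * Q = P * grad y' j.
  apply: (mulfI (expf_neq0 (d - w j) (qe0 e))); rewrite mulrA -ME MQ gE; ring.
have qg j : q %| grad y' j.
  apply: (dvdp_trans qQ); rewrite -(Gauss_dvdpr _ cPQ) -M'Q.
  exact: dvdp_mulIr.
have [m [gm ngm]] := @exists_max_exponent L q (fun=> 1%N) _ j0 (fun=> isT) sq1 g'0.
have {}gm i : q ^+ m %| grad y' i by have := gm i; rewrite muln1.
have {}ngm : exists i, ~~ (q ^+ m.+1 %| grad y' i).
  apply: boolp.contrapT => H; apply: ngm => i; rewrite muln1.
  by apply/negPn/negP => Hi; apply: H; exists i.
have m0 : (0 < m)%N.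
  rewrite lt0n; apply: contraTneq isT => mz; case: ngm => k.
  by rewrite mz expr1 qg.
have ny' : ~ forall i, q ^+ w i %| y' i.
  move=> H; apply: nye => i.
  by rewrite mulSn exprD yE -exprM mulrC dvdp_mul2l.
(* At the index [j] the minor vanishes at least to the order of the gradient, so [q] divides [P] as
   well as [Q], although these are coprime. *)
have [j [ngj qM _]] := Hloc charL derDp iq m0 ny' gm ngm.
have qP : q %| P.
  have : q ^+ m.+1 %| P * grad y' j.
    by rewrite -M'Q exprSr dvdp_mul.
  have [r rE] := dvdpP _ _ (gm j).
  rewrite rE exprS mulrA dvdp_mul2r // => qPr.
  have [//|nqP] := boolP (q %| P).
  have cqP : coprimep q P by rewrite irreducible_poly_coprime.
  move: qPr; rewrite Gauss_dvdpr // => qr.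
  by case/negP: ngj; rewrite rE exprS dvdp_mul2r.
have : q %| gcdp Q P by rewrite dvdp_gcd qQ.
move/dvdp_leq; rewrite gcdp_eq0 (negPf Q0) => /(_ isT) sqG.
by move: cPQ; rewrite /coprimep => /eqP sG; move: sqG; rewrite sG leqNgt sq1.
Qed.

Lemma edge_null_form (i0 : 'I_5) : (y i0).[0] != 0 ->
  null_form D (fun i => (y i).[0]) -> null_form D b.
Proof.
move=> yi0 null_a [j0 gb0] j.
have wd i : (w i <= d)%N by rewrite -dE (leq_trans (w_le_sum i)) // leq_addl.
have gtop i : top (N * (d - w i)) (g i) (grad b i).
  exact: (top_ev (whomog_deriv f_homog) y_top).
have Mtop i : top (N * (d - w i)) (M i) (tminor D b i).
  have wi := w_le_sum i.
  rewrite (_ : N * (d - w i) = kappa * (N * w o0) + N * (\sum_i w i - w i))%N.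
    by apply: topM; [exact: topX | apply: (top_minor derD) => //; rewrite subnK].
  by rewrite w_o0 muln1 mulnC [(kappa * N)%N]mulnC -mulnDr mulnC; congr (_ * _)%N; lia.
have g0 : g j0 != 0.
  by apply: contraNneq gb0 => gz; have [_ <-] := gtop j0; rewrite gz coef0.
have yi00 : y i0 != 0 by apply: contraNneq yi0 => ->; rewrite horner0.
have [P MP] := edge_ratio yi00 g0.
(* Both sides of [M j0 = P * g j0] have degree at most [N * (d - w j0)], and [g j0] attains it,
   since its value at infinity is not zero. *)
have sP : (size P <= 1)%N.
  have [->|P0] := eqVneq P 0; first by rewrite size_poly0.
  have [sM _] := Mtop j0; have [sg gE] := gtop j0.
  move: sM; rewrite MP size_mul // => sM.
  have : (N * (d - w j0) < size (g j0))%N.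
    by rewrite ltnNge; apply: contra gb0 => H; rewrite -gE nth_default.
  rewrite -size_poly_gt0 in P0; move: sM P0.
  by move: (size P) (size (g j0)) (N * (d - w j0))%N => a1 a2 a3; lia.
have PC := size1_polyC sP; set c := P`_0 in PC.
suff c0 : c = 0.
  by have [_ <-] := Mtop j; rewrite MP PC c0 mul0r coef0.
have M0 i : (M i).[0] = tminor D (fun i => (y i).[0]) i.
  by rewrite hornerM horner_exp (horner0_minor derD).
have [[j1 ga1]|ga] := boolp.pselect (exists i, grad (fun i => (y i).[0]) i != 0).
  have := null_a (ex_intro _ j1 ga1) j1.
  rewrite -M0 MP PC hornerM hornerC horner0_ev => /eqP.
  by rewrite mulf_eq0 (negPf ga1) orbF => /eqP.
(* The curve starts at a critical point, where evaluation at 0 says nothing; the sharper clause of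
   [local_condition] at [q = 'X] takes over. *)
have Xg i : 'X %| g i.
  rewrite -['X]subr0 -polyC0 dvdp_XsubCl rootE horner0_ev.
  by apply/negPn/negP => gi; apply: ga; exists i.
have sX : (1 < size ('X : {poly L}))%N by rewrite size_polyX.
have [m [gm ngm]] := @exists_max_exponent L 'X (fun=> 1%N) g j0 (fun=> isT) sX g0.
case: m => [|m] in gm ngm.
  by case: ngm => i; rewrite muln1 expr1.
have iX : irreducible_poly ('X : {poly L}).
  rewrite -['X]subr0 -polyC0; exact: irredp_XsubC.
have nXy : ~~ ('X %| y i0).
  by rewrite -['X]subr0 -polyC0 dvdp_XsubCl rootE.
have ny : ~ forall i, 'X ^+ w i %| y i.
  move=> /(_ i0) Xy; case/negP: nXy; apply: dvdp_trans Xy.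
  by rewrite -{1}['X]expr1 dvdp_exp2l.
have {}gm i : 'X ^+ m.+1 %| g i by have := gm i; rewrite muln1.
have {}ngm : exists i, ~~ ('X ^+ m.+2 %| g i).
  apply: boolp.contrapT => H; apply: ngm => i; rewrite muln1.
  by apply/negPn/negP => Hi; apply: H; exists i.
have [j2 [ngj _ XM]] := Hloc charL derDp iX (ltn0Sn m) ny gm ngm.
have {XM} : 'X ^+ m.+2 %| M j2.
  by apply: XM => [i|]; [exact: (polyD_X derD) | exists i0].
rewrite MP PC; apply: contraTeq => c0.
by rewrite mul_polyC dvdpZr.
Qed.

End OneEdge.
End Edge.

(** * Loop polynomials *)

Section LocalTools.
Variable L : fieldType.
Implicit Types q a b : {poly L}.

Lemma irreducible_dvdpM q a b : irreducible_poly q ->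
  (q %| a * b) = (q %| a) || (q %| b).
Proof.
move=> iq; apply/idP/orP => [qab|[]]; last 2 first.
- exact: dvdp_mulr.
- exact: dvdp_mull.
have [qa|nqa] := boolP (q %| a); [by left | right].
by rewrite -(Gauss_dvdpr b (d := q) (q := a)) // irreducible_poly_coprime.
Qed.

Lemma irreducible_dvdpX q a n : irreducible_poly q -> (q %| a ^+ n) = (0 < n)%N && (q %| a).
Proof.
move=> iq; elim: n => [|n IHn].
  by rewrite expr0 dvdp1; case: iq => sq _; rewrite gtn_eqF.
by rewrite exprS irreducible_dvdpM // IHn; case: n {IHn} => [|n] /=; rewrite ?orbF ?orbb.
Qed.

Lemma irreducible_dvdpMn q a n : n%:R != 0 :> L -> (q %| a *+ n) = (q %| a).
Proof. by move=> n0; rewrite -scaler_nat dvdpZr. Qed.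

Variable D : nat -> {poly L} -> {poly L}.
Hypothesis derD : forall i, derivation (D i).

(** Near [q] two columns of the minor are traded for those of [phi] and [psi], which vanish at [q],
    at the price of a factor [u] invertible there; [det4_dvd] then gives the order. *)
Lemma minor_dvd q (u M : {poly L}) (c c' : nat -> {poly L}) n n' (phi psi : {poly L}) m :
  irreducible_poly q -> (0 < m)%N -> ~~ (q %| u) ->
  u * M = det4 c c' (gcol D n phi) (gcol D n' psi) ->
  q ^+ m %| phi -> q %| psi ->
  (q ^+ m %| M) /\ ((forall i, D i q = 0) -> q ^+ m.+1 %| M).
Proof.
move=> iq m0 nqu uM /dvdpP[v phiE] /dvdpP[v' psiE].
have [X [Y [E Y0]]] := det4_dvd derD c c' n n' q v v' m0.
have {}uM : u * M = q ^+ m * (q * X + Y) by rewrite uM phiE psiE mulrC [v' * _]mulrC.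
have cqu k : coprimep (q ^+ k) u.
  by apply: coprimep_expl; rewrite irreducible_poly_coprime.
split=> [|Dq]; rewrite -(Gauss_dvdpr _ (cqu _)) uM; first by rewrite dvdp_mulr.
by rewrite Y0 // addr0 mulrA -exprSr dvdp_mulr.
Qed.

End LocalTools.

(** The last two columns have the shape of those of two successive partial derivatives of a loop
    polynomial, each a combination of three consecutive coordinates. *)
Lemma det4_chain (R : comNzRingType) (a b c e : nat -> R) (al be ga al' be' ga' : R) :
  det4 a b (fun i => al * b i + be * c i + ga * a i)
      (fun i => al' * c i + be' * e i + ga' * b i)
  = be * be' * det4 a b c e.
Proof.
rewrite /det4.
move: (a 0%N) (a 1%N) (a 2%N) (a 3%N) (b 0%N) (b 1%N) (b 2%N) (b 3%N) => a0 a1 a2 a3 b0 b1 b2 b3.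
move: (c 0%N) (c 1%N) (c 2%N) (c 3%N) (e 0%N) (e 1%N) (e 2%N) (e 3%N) => c0 c1 c2 c3 e0 e1 e2 e3.
ring.
Qed.

Lemma mderiv_derivation (R : comNzRingType) n (j : 'I_n) : derivation (@mderiv n R j).
Proof. by split=> x y; [exact: mderivD | exact: mderivM]. Qed.

Lemma mderivXU (R : nzRingType) n (i j : 'I_n) : ('X_i : {mpoly R[n]})^`M(j) = (i == j)%:R.
Proof.
rewrite mderivX mnm1E; case: eqP => [->|_]; last by rewrite scale0r.
by rewrite scale1r -{1}[U_(j)%MM]add0m addmK mpolyX0.
Qed.

Section Loop5.
Variable r : nat.

Definition loop5 : {mpoly int[5]} :=
  'X_o0 ^+ r * 'X_o1 + 'X_o1 ^+ r * 'X_o2 + 'X_o2 ^+ r * 'X_o3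
  + 'X_o3 ^+ r * 'X_o4 + 'X_o4 ^+ r * 'X_o0.

Definition succ5 (j : 'I_5) : 'I_5 :=
  match val j with 0 => o1 | 1 => o2 | 2 => o3 | 3 => o4 | _ => o0 end.
Definition pred5 (j : 'I_5) : 'I_5 :=
  match val j with 0 => o4 | 1 => o0 | 2 => o1 | 3 => o2 | _ => o3 end.

Lemma grad_loop5 (R : comNzRingType) (y : 'I_5 -> R) j :
  grad loop5 y j = y j ^+ r.-1 * y (succ5 j) *+ r + y (pred5 j) ^+ r.
Proof.
rewrite /grad /loop5 !mderivD !mderivM !(derivationX (mderiv_derivation _ j)) !mderivXU.
rewrite !rmorphD !rmorphM !rmorphMn !rmorphM !rmorphXn /= !evXU.
by move: j; elim/ord5_ind => /=; rewrite ?(rmorph1, rmorph0) ?(mulr0, mul0r, mulr1, mul0rn, mulrnAl, addr0, add0r) //= addrC.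
Qed.

Lemma gcol_grad_loop5 (R : comNzRingType) (D : nat -> R -> R) (y : 'I_5 -> R) j i :
  (forall i, derivation (D i)) ->
  gcol D r (grad loop5 y j) i =
    (y j ^+ r.-2 * y (succ5 j) *+ (r.-1 * r)) * gcol D 1 (y j) i
    + (y j ^+ r.-1 *+ r) * gcol D 1 (y (succ5 j)) i
    + (y (pred5 j) ^+ r.-1 *+ r) * gcol D 1 (y (pred5 j)) i.
Proof.
move=> derD; rewrite grad_loop5 (gcolD derD).
have XE n x : gcol D n (x ^+ n) i = x ^+ n.-1 * gcol D 1 x i *+ n.
  by rewrite -{1}[n]muln1 (gcolX derD).
rewrite XE -[_ * gcol D 1 (y (pred5 j)) i *+ r]mulrnAl; congr (_ + _).
case: r => [|n] /=.
  by rewrite !mulr0n /=; case: i {XE} => [|i] /=; rewrite ?(derivation0 (derD _)) ?mulr0n; ring.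
have -> x : gcol D n.+1 (x *+ n.+1) i = gcol D n.+1 x i *+ n.+1.
  by case: i {XE} => [|i] //=; rewrite (derivationMn (derD _)).
have := gcolM derD n 1 (y j ^+ n) (y (succ5 j)) i; rewrite addn1 XE => ->.
rewrite mulrnDl -!mulrnAl -mulrnA; congr (_ + _).
by rewrite mulrAC.
Qed.

(** If a coordinate vanished at a critical point, its predecessor would vanish too, and so all round
    the loop; hence none does. Two successive partial derivatives can then replace two columns of
    the minor. This needs [r] invertible in [L], and indeed [r = d - 1] is -1 there. *)
Lemma local_condition_loop5 p d kappa : prime p -> (p %| d)%N -> d = r.+1 ->
  (1 < r)%N -> local_condition (fun=> 1%N) kappa p loop5.
Proof.
move=> pp pd dE r1 L D chL derD q y m iq m0 nq qg [j ngj].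
have rL : r%:R != 0 :> L.
  have : d%:R = 0 :> L.
    by have /dvdnP[k ->] := pd; rewrite natrM chL mulr0.
  by rewrite dE -natr1 => /eqP; rewrite addr_eq0 => /eqP ->; rewrite oppr_eq0 oner_eq0.
have qm1 n : (0 < n)%N -> q %| q ^+ n.
  by move=> n0; rewrite -{1}[q]expr1 dvdp_exp2l.
have qg1 k : q %| grad loop5 y k := dvdp_trans (qm1 m m0) (qg k).
have prev k : q %| y k -> q %| y (pred5 k).
  move=> qk; have := qg1 k; rewrite grad_loop5 dvdp_addr.
    by rewrite irreducible_dvdpX // => /andP[].
  rewrite irreducible_dvdpMn // irreducible_dvdpM // irreducible_dvdpX // qk.
  by rewrite -subn1 subn_gt0 r1.
have ny k : ~~ (q %| y k).
  apply/negP => qk; apply: nq => i; rewrite expr1.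
  have q1 := prev _ qk; have q2 := prev _ q1; have q3 := prev _ q2; have q4 := prev _ q3.
  move: k i qk q1 q2 q3 q4; do 2!elim/ord5_ind => //=.
pose be k := y k ^+ r.-1 *+ r.
have nbe k : ~~ (q %| be k).
  by rewrite /be irreducible_dvdpMn // irreducible_dvdpX // negb_and ny orbT.
pose s1 := succ5 j; pose s2 := succ5 s1; pose s3 := succ5 s2.
have E : be s2 * be s3 * minor D (fun=> 1%N) y j =
    det4 (gcol D 1 (y s1)) (gcol D 1 (y s2)) (gcol D r (grad loop5 y s2))
      (gcol D r (grad loop5 y s3)).
  rewrite (eq_det4 (frefl _) (frefl _) (fun i => gcol_grad_loop5 y s2 i derD)
    (fun i => gcol_grad_loop5 y s3 i derD)).
  rewrite /s3 /s2 /s1 {s1 s2 s3 ngj}.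
  by move: j; elim/ord5_ind; rewrite det4_chain.
have nbb : ~~ (q %| be s2 * be s3).
  by rewrite irreducible_dvdpM // negb_or !nbe.
have [H1 H2] := minor_dvd derD iq m0 nbb E (qg s2) (qg1 s3).
exists j; split=> // [|Dq _]; rewrite /tminor dvdp_mull //.
exact: H2.
Qed.
End Loop5.

Section Det4Permutations.
Variable R : comNzRingType.
Implicit Types a b c e : nat -> R.

Lemma det4_perm0 a b c e : det4 b c a e = det4 a b c e.
Proof. by rewrite /det4; ring. Qed.
Lemma det4_perm1 a b c e : det4 b c a e = - det4 a b e c.
Proof. by rewrite /det4; ring. Qed.
Lemma det4_perm2 a b c e : det4 b c a e = det4 a e b c.
Proof. by rewrite /det4; ring. Qed.
Lemma det4_perm3 a b c e : det4 b c a e = - det4 e a b c.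
Proof. by rewrite /det4; ring. Qed.
Lemma det4_cycle a b c e : det4 a b c e = - det4 e a b c.
Proof. by rewrite /det4; ring. Qed.
Lemma det4_combine a b c e (s t : R) :
  det4 a b (fun i => s * c i + t * b i) e = s * det4 a b c e.
Proof. by rewrite /det4; ring. Qed.
End Det4Permutations.

Section Loop4.

Definition loop4 : {mpoly int[5]} :=
  'X_o0 ^+ 9 * 'X_o1 + 'X_o1 ^+ 9 * 'X_o2 + 'X_o2 ^+ 9 * 'X_o3
  + 'X_o3 ^+ 9 * 'X_o0 + 'X_o4 ^+ 5.

Definition wt4 (j : 'I_5) : nat := if val j is 4 then 2 else 1.

Definition succ4 (j : 'I_5) : 'I_5 :=
  match val j with 0 => o1 | 1 => o2 | 2 => o3 | _ => o0 end.
Definition pred4 (j : 'I_5) : 'I_5 :=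
  match val j with 0 => o3 | 1 => o0 | 2 => o1 | _ => o2 end.

Lemma grad_loop4 (R : comNzRingType) (y : 'I_5 -> R) j :
  grad loop4 y j = if val j is 4 then y o4 ^+ 4 *+ 5
    else y j ^+ 8 * y (succ4 j) *+ 9 + y (pred4 j) ^+ 9.
Proof.
have dX n (P : {mpoly int[5]}) : ev y (P ^+ n)^`M(j) = ev y P ^+ n.-1 * ev y P^`M(j) *+ n.
  by rewrite (derivationX (mderiv_derivation _ j)) rmorphMn rmorphM rmorphXn.
have dXM n (P Q : {mpoly int[5]}) : ev y (P ^+ n * Q)^`M(j)
    = ev y P ^+ n.-1 * ev y P^`M(j) *+ n * ev y Q + ev y P ^+ n * ev y Q^`M(j).
  rewrite mderivM rmorphD !rmorphM.
  by congr (_ * _ + _ * _); [exact: dX | exact: rmorphXn].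
have evD (P Q : {mpoly int[5]}) : ev y (P + Q) = ev y P + ev y Q by exact: rmorphD.
rewrite /grad /loop4 !mderivD !evD !dXM dX !mderivXU !evXU /=.
move: j {dX dXM evD}; elim/ord5_ind => /=; rewrite ?(rmorph1, rmorph0) ?(mulr0, mul0r, mulr1, mul0rn, mulrnAl, addr0, add0r) //=.
all: by rewrite addrC.
Qed.

(** The term in the column of [y j] itself carries the even factor [9 * 8], so in characteristic 2
    only the two neighbours remain. *)
Lemma gcol_grad_loop4 (R : comNzRingType) (D : nat -> R -> R) (y : 'I_5 -> R) j i :
  (forall i, derivation (D i)) -> 2%:R = 0 :> R -> (val j < 4)%N ->
  gcol D 9 (grad loop4 y j) i =
    y j ^+ 8 * gcol D 1 (y (succ4 j)) i + y (pred4 j) ^+ 8 * gcol D 1 (y (pred4 j)) i.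
Proof.
move=> derD ch2 j4; rewrite grad_loop4.
have -> : forall A B : R, match val j with 4 => A | _ => B end = B.
  by case: (val j) j4 => [|[|[|[|[|n]]]]].
have E2 (x : R) : x *+ 9 = x.
  by rewrite -[x *+ 9]/(x *+ (1 + 2 * 4)) mulrnDr mulrnA -[x *+ 2]mulr_natr ch2 mulr0 mul0rn addr0.
have E8 (x : R) : x *+ 8 = 0.
  by rewrite -[x *+ 8]/(x *+ (2 * 4)) mulrnA -[x *+ 2]mulr_natr ch2 mulr0 mul0rn.
have XE n x : gcol D n (x ^+ n) i = x ^+ n.-1 * gcol D 1 x i *+ n.
  by rewrite -{1}[n]muln1 (gcolX derD).
rewrite E2 (gcolD derD) XE E2; congr (_ + _).
by rewrite -[9%N]/(8 + 1)%N (gcolM derD) XE E8 mul0r add0r.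
Qed.

(** At a critical point [y o4] vanishes. Either no other coordinate does, and columns are exchanged
    as for [loop5]; or all do, and the curve passes through the singular point of P(1,1,1,1,2),
    where the factor [y o0 ^+ 4] of [tminor] compensates the pole. *)
Lemma local_condition_loop4 : local_condition wt4 4 2 loop4.
Proof.
move=> L D chL derD q y m iq m0 nq qg [j ngj].
have ch2 : 2%:R = 0 :> {poly L} by rewrite -polyC1 -polyCMn chL.
have five (x : {poly L}) : x *+ 5 = x.
  by rewrite -[x *+ 5]/(x *+ (1 + 2 * 2)) mulrnDr mulrnA -[x *+ 2]mulr_natr ch2 mulr0 mul0rn addr0.
have nine (x : {poly L}) : x *+ 9 = x.
  by rewrite -[x *+ 9]/(x *+ (1 + 2 * 4)) mulrnDr mulrnA -[x *+ 2]mulr_natr ch2 mulr0 mul0rn addr0.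
have qm1 n : (0 < n)%N -> q %| q ^+ n.
  by move=> n0; rewrite -{1}[q]expr1 dvdp_exp2l.
have qg1 k : q %| grad loop4 y k := dvdp_trans (qm1 m m0) (qg k).
have g4 : grad loop4 y o4 = y o4 ^+ 4 by rewrite grad_loop4 /= five.
have q4 : q %| y o4 by have := qg1 o4; rewrite g4 irreducible_dvdpX.
have gk k : (val k < 4)%N -> grad loop4 y k = y k ^+ 8 * y (succ4 k) + y (pred4 k) ^+ 9.
  by rewrite grad_loop4; case: (val k) => [|[|[|[|[|n]]]]] // _; rewrite nine.
have sq1 : (1 < size q)%N by case: iq.
have q0 : q != 0 by rewrite -size_poly_gt0 ltnW.
have prev k : (val k < 4)%N -> q %| y k -> q %| y (pred4 k).
  move=> k4 qk; have := qg1 k; rewrite gk // dvdp_addr.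
    by rewrite irreducible_dvdpX.
  by rewrite irreducible_dvdpM // irreducible_dvdpX // qk.
have [[k [k4 qk]]|nex] := boolp.pselect (exists k : 'I_5, (val k < 4)%N /\ q %| y k).
  have qa i : (val i < 4)%N -> q %| y i.
    have q1 := prev _ k4 qk; have k14 : (val (pred4 k) < 4)%N by move: k {k4 qk q1}; elim/ord5_ind.
    have q2 := prev _ k14 q1.
    have k24 : (val (pred4 (pred4 k)) < 4)%N by move: k {k4 qk q1 k14 q2}; elim/ord5_ind.
    have q3 := prev _ k24 q2.
    by move: k i qk q1 q2 q3 k4 {k14 k24}; do 2!elim/ord5_ind => //=.
  (* All coordinates are divisible by [q], but [y o4], of weight 2, only once: otherwise a weighted
     power of [q] could be removed from the point. *)
  have nq4 : ~~ (q ^+ 2 %| y o4).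
    apply/negP => q42; apply: nq => i; move: (qa i); rewrite /wt4.
    by move: i; elim/ord5_ind => //= ->.
  have [z zE] := dvdpP _ _ q4.
  have nqz : ~~ (q %| z).
    by apply: contra nq4 => qz; rewrite zE dvdp_mul2r.
  have g4E k0 : (q ^+ k0 %| grad loop4 y o4) = (k0 <= 4)%N.
    rewrite g4 zE exprMn; have [le4|lt4] := leqP k0 4.
      by rewrite dvdp_mull // dvdp_exp2l.
    apply/negP => H; have : q ^+ 5 %| z ^+ 4 * q ^+ 4 by apply: dvdp_trans H; rewrite dvdp_exp2l.
    by rewrite exprS dvdp_mul2r ?expf_neq0 // irreducible_dvdpX // (negPf nqz).
  have m4 : (m <= 4)%N by rewrite -g4E.
  have q9 i : (val i < 4)%N -> q ^+ 9 %| grad loop4 y i.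
    move=> i4; rewrite gk // dvdp_add //.
      rewrite exprSr dvdp_mul // ?dvdp_exp2r ?qa //.
      by move: i i4; elim/ord5_ind.
    by rewrite dvdp_exp2r // qa //; move: i i4; elim/ord5_ind.
  (* The gradient has order 4 along [o4] and at least 9 along the others, so [o4] attains the order
     [m <= 4], which [y o0 ^+ 4] matches. The last clause is empty, as every coordinate vanishes at
     [q]. *)
  exists o4; split.
  - have [j4|] := ltnP (val j) 4.
      case/negP: ngj; apply: dvdp_trans (q9 _ j4).
      by rewrite dvdp_exp2l // ltnS (leq_trans m4).
    by move: j ngj; elim/ord5_ind.
  - rewrite /tminor dvdp_mulr //; apply: (@dvdp_trans _ (q ^+ 4)).
      by rewrite dvdp_exp2l.
    by rewrite dvdp_exp2r // qa.
  - move=> _; case=> i; have [i4|] := ltnP (val i) 4; first by rewrite qa.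
    by move: i; elim/ord5_ind => //= _; rewrite q4.
have ny k : (val k < 4)%N -> ~~ (q %| y k).
  by move=> k4; apply/negP => qk; apply: nex; exists k.
have nq8 k : (val k < 4)%N -> ~~ (q %| y k ^+ 8) by move=> k4; rewrite irreducible_dvdpX // ny.
have colE k i := @gcol_grad_loop4 _ D y k i derD ch2.
suff [u [c [c' [n [n' [phi [psi [nqu E qphi qpsi]]]]]]]] : exists (u : {poly L}) c c' n n' phi psi,
    [/\ ~~ (q %| u), u * minor D wt4 y j = det4 c c' (gcol D n phi) (gcol D n' psi),
        q ^+ m %| phi & q %| psi].
  have [H1 H2] := minor_dvd derD iq m0 nqu E qphi qpsi.
  exists j; split=> // [|Dq _]; rewrite /tminor dvdp_mull //.
  exact: H2.
pose c k := gcol D (wt4 k) (y k).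
have [j4|j4] := ltnP (val j) 4.
  pose s2 := succ4 (succ4 j).
  (* The vanishing columns are that of [y o4], already in the minor, and that of the partial
     derivative along [j], which replaces the successor of [j]. The sign comes from the cyclic order
     in [minor]. *)
  exists ((-1) ^+ val j * y j ^+ 8), (c s2), (c (succ4 s2)), 9%N, 2%N, (grad loop4 y j), (y o4).
  split=> //.
    by rewrite irreducible_dvdpM // negb_or nq8 // andbT -signr_odd; case: odd;
      rewrite ?expr1 ?expr0 ?dvdpNr dvdp1 gtn_eqF.
  rewrite (eq_det4 (frefl _) (frefl _) (fun i => colE j i j4) (frefl _)).
  have -> : gcol D 2 (y o4) = c o4 by [].
  have -> : gcol D 1 (y (succ4 j)) = c (succ4 j).
    by rewrite /c; congr gcol; move: {+}j j4; elim/ord5_ind.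
  have -> : gcol D 1 (y (pred4 j)) = c (succ4 s2).
    by rewrite /c /s2; move: {+}j j4; elim/ord5_ind.
  rewrite det4_combine mulrAC mulrC; congr (_ * _); rewrite /minor -/(c _) /s2.
  move: j4; elim/ord5_ind: {+}j => // _; rewrite [val _]/= /succ4 /=.
  - by rewrite expr0 mul1r; exact/esym/det4_perm0.
  - by rewrite expr1 mulN1r; exact/esym/det4_perm1.
  - by rewrite -signr_odd expr0 mul1r; exact/esym/det4_perm2.
  - by rewrite -signr_odd expr1 mulN1r; exact/esym/det4_perm3.
have -> : j = o4 by move: {+}j j4; elim/ord5_ind.
(* For [j = o4] the minor consists of the four loop columns; the partial derivatives along [o0] and
   [o1] replace the columns of [o1] and [o2]. *)
exists (- (y o0 ^+ 8 * y o1 ^+ 8)), (c o3), (c o0), 9%N, 9%N, (grad loop4 y o0), (grad loop4 y o1).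
split=> //; first by rewrite dvdpNr irreducible_dvdpM // negb_or !nq8.
have n0E i : gcol D 9 (grad loop4 y o0) i = 0 * c o0 i + y o0 ^+ 8 * c o1 i + y o3 ^+ 8 * c o3 i.
  by rewrite colE // mul0r add0r.
have n1E i : gcol D 9 (grad loop4 y o1) i = 0 * c o1 i + y o1 ^+ 8 * c o2 i + y o0 ^+ 8 * c o0 i.
  by rewrite colE // mul0r add0r.
rewrite (eq_det4 (frefl _) (frefl _) n0E n1E) det4_chain.
rewrite mulNr -mulrN; congr (_ * _); rewrite /minor [val _]/=.
by apply/eqP; rewrite eqr_oppLR; apply/eqP; exact: det4_cycle.
Qed.
End Loop4.

(** * The inseparable cover *)

Section FractionDerivation.
Variables (R : idomainType).
Local Notation K := {fraction R}.
Local Notation "x %:F" := (@tofrac R x).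

Lemma fractionP (z : K) : exists n d : R, d != 0 /\ z * d%:F = n%:F.
Proof.
elim/quotW: z => z; exists \n_z, \d_z; split; first exact: denom_ratioP.
unlock FracField.tofrac; rewrite -[LHS]FracField.pi_mul; apply/eqmodP.
rewrite /= FracField.equivfE /FracField.mulf.
rewrite !numden_Ratio ?oner_neq0 ?mulf_neq0 ?denom_ratioP ?oner_neq0 //.
by apply/eqP; ring.
Qed.

Variable delta : R -> R.
Hypothesis derd : derivation delta.

(** The quotient rule as a relation between [z = n / d] and its derivative; independence of the
    fraction is proved before a function is chosen. *)
Let dval (z v : K) := exists n d : R,
  [/\ d != 0, z * d%:F = n%:F & v * d%:F = (delta n)%:F - z * (delta d)%:F].

Let dval_ex z : exists v, dval z v.
Proof.
have [n [d [d0 zE]]] := fractionP z.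
exists (((delta n)%:F - z * (delta d)%:F) / d%:F), n, d; split=> //.
by rewrite mulfVK // tofrac_eq0.
Qed.

Let dval_fun z v v' : dval z v -> dval z v' -> v = v'.
Proof.
move=> [n [d [d0 zE vE]]] [n' [d' [d'0 zE' vE']]].
have dF : d%:F != 0 by rewrite tofrac_eq0.
have dF' : d'%:F != 0 by rewrite tofrac_eq0.
have E : n * d' = n' * d.
  by apply/eqP; rewrite -tofrac_eq !tofracM -zE -zE' mulrAC.
have {E} : (delta n)%:F * d'%:F + n%:F * (delta d')%:F
    = (delta n')%:F * d%:F + n'%:F * (delta d)%:F.
  by rewrite -!tofracM -!tofracD -!(derivationM derd) E.
rewrite -zE -zE' => E.
apply: (mulIf (mulf_neq0 dF dF')); rewrite mulrA vE [d%:F * _]mulrC mulrA vE'.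
by apply/eqP; rewrite -subr_eq0; apply/eqP; move/eqP: E; rewrite -subr_eq0 => /eqP <-; ring.
Qed.

Lemma fraction_derivation : exists2 D : K -> K, derivation D
  & forall x, D x%:F = (delta x)%:F.
Proof.
pose D z := projT1 (boolp.cid (dval_ex z)).
have DP z : dval z (D z) by rewrite /D; case: boolp.cid.
exists D; last first.
  move=> x; apply: dval_fun (DP _) _; exists x, 1; split; rewrite ?oner_neq0 //.
    by rewrite tofrac1 mulr1.
  by rewrite (derivation1 derd) tofrac1 tofrac0 mulr1 mulr0 subr0.
split=> x y; apply: dval_fun (DP _) _.
  have [n [d [d0 zE vE]]] := DP x; have [n' [d' [d'0 zE' vE']]] := DP y.
  exists (n * d' + n' * d), (d * d'); split; first by rewrite mulf_neq0.
    by rewrite tofracD !tofracM -zE -zE'; ring.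
  rewrite (derivationD derd) !(derivationM derd) !tofracD !tofracM -zE -zE'.
  rewrite mulrDl mulrA vE [d%:F * _]mulrC mulrA vE'; ring.
have [n [d [d0 zE vE]]] := DP x; have [n' [d' [d'0 zE' vE']]] := DP y.
exists (n * n'), (d * d'); split; first by rewrite mulf_neq0.
  by rewrite !tofracM -zE -zE'; ring.
rewrite !(derivationM derd) !tofracD !tofracM -zE -zE' mulrDl.
have -> : D x * y * (d%:F * d'%:F) = (D x * d%:F) * (y * d'%:F) by ring.
have -> : x * D y * (d%:F * d'%:F) = (D y * d'%:F) * (x * d%:F) by ring.
by rewrite vE vE'; ring.
Qed.
End FractionDerivation.

Section SimpleExtension.
Variables (K : fieldType) (h : {poly K}).
Hypothesis hI : monic_irreducible_poly h.

Definition simple_ext : fieldType := {poly %/ h with hI}.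
Definition simple_ext_map : {rmorphism {poly K} -> simple_ext} := in_qpoly h.

Lemma simple_ext_map_eq0 P : (simple_ext_map P == 0) = (h %| P).
Proof.
have hm : h \is monic by case: hI.
rewrite -val_eqE /= /in_qpoly /= (mk_monicE hI) -[Pdiv.Ring.rmodp _ _]/(Pdiv.Ring.rmodp P h).
by rewrite -Pdiv.IdomainMonic.modpE // modp_eq0.
Qed.

Lemma simple_ext_map_surj (z : simple_ext) : exists P, simple_ext_map P = z.
Proof.
exists (\val (z : {poly %/ h})); apply: val_inj.
exact: in_qpoly_small (size_mk_monic z).
Qed.

Variable delta : K -> K.
Hypothesis derd : derivation delta.
Hypothesis delta_h : forall i, delta h`_i = 0.

Let pd := polyD (fun=> delta) 0.
Let derpd : derivation pd := polyD_derivation (fun=> derd) 0.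

Let pd_h : pd h = 0.
Proof. by apply/polyP => i; rewrite (coef_polyD (fun=> derd)) coef0. Qed.

Let pd_ker P : simple_ext_map P = 0 -> simple_ext_map (pd P) = 0.
Proof.
move=> /eqP; rewrite simple_ext_map_eq0 => /dvdpP[Q ->]; apply/eqP.
by rewrite simple_ext_map_eq0 (derivationM derpd) pd_h mulr0 addr0 dvdp_mull.
Qed.

(** Acting on coefficients, [delta] kills [h], hence preserves the ideal of [h] and descends to the
    quotient, with the class of ['X] as a constant. *)
Lemma simple_ext_derivation : exists2 D : simple_ext -> simple_ext, derivation D
  & forall P, D (simple_ext_map P) = simple_ext_map (pd P).
Proof.
pose r z := projT1 (boolp.cid (simple_ext_map_surj z)).
have rK z : simple_ext_map (r z) = z by rewrite /r; case: boolp.cid.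
pose D z := simple_ext_map (pd (r z)).
have DE P : D (simple_ext_map P) = simple_ext_map (pd P).
  apply/eqP; rewrite -subr_eq0 -rmorphB -(derivationB derpd); apply/eqP/pd_ker.
  by rewrite rmorphB rK subrr.
exists D => //; split=> x y; rewrite -[x]rK -[y]rK.
  by rewrite -rmorphD !DE (derivationD derpd) rmorphD.
by rewrite -rmorphM !DE (derivationM derpd) rmorphD !rmorphM.
Qed.
End SimpleExtension.

(* If [h = q r], differentiating with [delta] shows that [q] and [r] are coprime
   while [h' = 0] gives [q | q'], so [q] is a p-th power. *)
Lemma purely_inseparable_irreducible (K : fieldType) (delta : K -> K) p (c : K) :
  derivation delta -> delta c != 0 -> prime p -> p%:R = 0 :> K ->
  irreducible_poly ('X^p - c%:P).
Proof.
move=> derd dc pp chK; set h := 'X^p - c%:P.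
have p0 := prime_gt0 pp.
have sh : size h = p.+1 by rewrite size_XnsubC.
pose pd := polyD (fun=> delta) 0.
have derpd : derivation pd := polyD_derivation (fun=> derd) 0.
have pdh : pd h = - (delta c)%:P.
  apply/polyP => i; rewrite (coef_polyD (fun=> derd)) coefB coefXn coefC coefN coefC.
  rewrite (derivationB derd); have -> : delta (i == p)%:R = 0.
    by case: eqP => _; rewrite ?(derivation1 derd) ?(derivation0 derd).
  by case: eqP; rewrite ?sub0r ?(derivation0 derd) ?oppr0.
split=> [|q sq /dvdpP[r hE]]; first by rewrite sh ltnS.
have h0 : h != 0 by rewrite -size_poly_gt0 sh.
have q0 : q != 0 by apply: contraNneq h0; rewrite hE => ->; rewrite mulr0.
have r0 : r != 0 by apply: contraNneq h0; rewrite hE => ->; rewrite mul0r.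
have cqr : coprimep q r.
  rewrite /coprimep; have : gcdp q r %| pd h.
    rewrite hE (derivationM derpd) dvdp_add //.
      by rewrite dvdp_mull // dvdp_gcdl.
    by rewrite dvdp_mulr // dvdp_gcdr.
  rewrite pdh dvdpNr => /dvdp_leq; rewrite polyC_eq0 dc => /(_ isT).
  rewrite size_polyC dc => le1; rewrite eqn_leq le1 size_poly_gt0 gcdp_eq0.
  by rewrite (negPf q0).
have dh : h^`() = 0.
  rewrite /h !derivE subr0 -[_ *+ p]mulr_natr.
  have -> : p%:R = 0 :> {poly K} by rewrite -polyC1 -polyCMn chK.
  by rewrite mulr0.
have qq' : q %| q^`().
  rewrite -(Gauss_dvdpr _ cqr); move: dh; rewrite hE derivM => /eqP.
  by rewrite addrC addr_eq0 => /eqP ->; rewrite dvdpNr dvdp_mull.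
have q'0 : q^`() = 0.
  apply/eqP; apply: contraLR qq' => nz; apply/negP => /(dvdp_leq nz).
  by rewrite leqNgt lt_size_deriv.
have lq : lead_coef q != 0 by rewrite lead_coef_eq0.
have pdvd : (p %| (size q).-1)%N.
  have pch : p \in [pchar K] by rewrite inE pp chK eqxx.
  rewrite (dvdn_pcharf pch); move: q'0; case E : (size q).-1 => [|n] // q'0.
  have : q^`()`_n = 0 by rewrite q'0 coef0.
  have {}lq : q`_n.+1 != 0 by rewrite -E.
  by rewrite coef_deriv -[_ *+ _ in LHS]mulr_natr => /eqP; rewrite mulf_eq0 (negPf lq).
have sqh : (size q <= p.+1)%N.
  by rewrite -sh; apply: dvdp_leq h0 _; rewrite hE dvdp_mull.
have sq1 : (size q).-1 = p.
  apply/eqP; rewrite eqn_leq -ltnS prednK ?size_poly_gt0 // sqh.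
  by apply: dvdn_leq => //; move: sq; have := size_poly_gt0 q; rewrite q0; lia.
have qh : q %| h by rewrite hE dvdp_mull.
by rewrite -(dvdp_size_eqp qh) sh -sq1 prednK // size_poly_gt0.
Qed.

Lemma det4_triangular (R : comNzRingType) (a b c e : nat -> R) :
  a 1%N = 0 -> a 2%N = 0 -> a 3%N = 0 -> b 2%N = 0 -> b 3%N = 0 -> c 3%N = 0 ->
  det4 a b c e = a 0%N * b 1%N * c 2%N * e 3%N.
Proof. by move=> a1 a2 a3 b2 b3 c3; rewrite /det4 a1 a2 a3 b2 b3 c3; ring. Qed.

Lemma ev_map (k R : comNzRingType) (phi : {rmorphism {mpoly k[5]} -> R}) P :
  ev (fun j => phi 'X_j) P = phi (map_mpoly (intmul 1) P).
Proof.
have -> : map_mpoly (intmul 1) P = \sum_(m <- msupp P) (P@_m)%:~R *: 'X_[m] :> {mpoly k[5]}.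
  rewrite {1}[P]mpolyE raddf_sum; apply: eq_bigr => m _ /=.
  by rewrite map_mpolyZ map_mpolyX.
rewrite evE rmorph_sum; apply: eq_bigr => m _ /=.
rewrite -mul_mpolyC rmorphM /= rmorph_int rmorph_int.
congr (_ * _); rewrite mpolyXE_id rmorph_prod.
by apply: eq_bigr => i _; rewrite rmorphXn.
Qed.

Lemma map_mpoly_deriv (k : comNzRingType) (P : {mpoly int[5]}) j :
  map_mpoly (intmul 1 : int -> k) P^`M(j) = (map_mpoly (intmul 1) P)^`M(j).
Proof.
apply/mpolyP => m; rewrite mcoeff_map_mpoly !mcoeff_deriv mcoeff_map_mpoly.
exact: rmorphMn.
Qed.

Section InseparableCover.
Variables (w : 'I_5 -> nat) (kappa p : nat) (f : {mpoly int[5]}).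
Variable k : fieldType.
Hypothesis w_o0 : w o0 = 1%N.
Hypothesis p_prime : prime p.
Hypothesis chk : p%:R = 0 :> k.
Local Notation M := {mpoly k[5]}.
Let fk : M := map_mpoly (intmul 1) f.
Hypothesis f4_neq0 : fk^`M(o4) != 0.

Let a i : 'I_5 := match i with 0%N => o1 | 1%N => o2 | _ => o3 end.
(** Fields tangent to the level sets of [f]: they kill [f], so they extend to the cover with
    [D w = 0]. Of the five directions, [o4] is solved for and [o0] is left to the Euler row. *)
Let delta i (x : M) := fk^`M(o4) * x^`M(a i) - fk^`M(a i) * x^`M(o4).

Let derd i : derivation (delta i).
Proof. by split=> x y; rewrite /delta ?mderivD ?mderivM; ring. Qed.

Let df i : delta i fk = 0.
Proof. by rewrite /delta mulrC subrr. Qed.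

(** [L] is the fraction field of [M] with a p-th root of [f] adjoined, and [E] sends ['X] to this
    root. The kernel clause says that the powers of the root below [p] are independent over [M]. *)
Let cover_field :
  exists (L : fieldType) (E : {rmorphism {poly M} -> L}) (D : nat -> L -> L),
  [/\ p%:R = 0 :> L /\ (forall i, derivation (D i)),
      E ('X^p - fk%:P) = 0,
      forall P : {poly M}, (size P <= p)%N -> E P = 0 -> P = 0
    & forall i x, D i (E x%:P) = E (delta i x)%:P].
Proof.
pose K := {fraction M}.
(* The derivation along [o4] does not kill [f]; this makes the polynomial of the cover
   irreducible. *)
have [d4 derd4 d4E] := fraction_derivation (mderiv_derivation k o4).
pose c : K := (@tofrac M fk).
have chK : p%:R = 0 :> K.
  rewrite -(rmorph_nat (@tofrac M)) -(rmorph_nat (@mpolyC 5 k)) chk.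
  by rewrite !rmorph0.
have d4c : d4 c != 0 by rewrite d4E tofrac_eq0.
have ih : monic_irreducible_poly ('X^p - c%:P).
  split; first exact: purely_inseparable_irreducible derd4 d4c p_prime chK.
  by rewrite monicXnsubC // prime_gt0.
set h := 'X^p - c%:P in ih.
pose L := simple_ext ih.
pose E : {rmorphism {poly M} -> L} := simple_ext_map ih \o map_poly (@tofrac M).
have EC x : E x%:P = simple_ext_map ih (tofrac x)%:P.
  exact: (congr1 (simple_ext_map ih) (map_polyC (@tofrac M) x)).
have DD i : exists D : L -> L, derivation D
    /\ forall x, D (E x%:P) = E (delta i x)%:P.
  have [dK derdK dKE] := fraction_derivation (derd i).
  have dh j : dK h`_j = 0.
    rewrite coefB coefXn coefC (derivationB derdK).
    have -> : dK (j == p)%:R = 0.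
      by case: eqP; rewrite ?(derivation1 derdK) ?(derivation0 derdK).
    rewrite sub0r; case: eqP => _; last by rewrite (derivation0 derdK) oppr0.
    by rewrite /c dKE df tofrac0 oppr0.
  have [D derD DE] := simple_ext_derivation ih derdK dh.
  exists D; split=> // x; rewrite !EC DE; congr (simple_ext_map ih _).
  by rewrite (polyD_C (fun=> derdK)) dKE.
pose D i := projT1 (boolp.cid (DD i)).
have derD i : derivation (D i) by rewrite /D; case: boolp.cid => D' [].
have DE i x : D i (E x%:P) = E (delta i x)%:P.
  by rewrite /D; case: boolp.cid => D' [] /= _; apply.
have ker (P : {poly M}) : (size P <= p)%N -> E P = 0 -> P = 0.
  move=> sP; rewrite -[E P]/(simple_ext_map ih (map_poly (@tofrac M) P)) => /eqP.
  rewrite (simple_ext_map_eq0 ih) => hP.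
  have sm : size (map_poly (@tofrac M) P) = size P.
    by apply: size_map_inj_poly => [x y /eqP|]; [rewrite tofrac_eq => /eqP | exact: tofrac0].
  have [//|P0] := eqVneq P 0.
  have := dvdp_leq _ hP; rewrite -size_poly_gt0 sm size_poly_gt0 => /(_ P0).
  by rewrite size_XnsubC ?prime_gt0 // leqNgt ltnS sP.
exists L, E, D; split=> //.
- split=> //; rewrite -(rmorph_nat E) -polyC1 -polyCMn.
  by rewrite -(rmorph_nat (@mpolyC 5 k)) chk !rmorph0.
- apply/eqP; rewrite -[E _]/(simple_ext_map ih (map_poly (@tofrac M) _)).
  by rewrite (simple_ext_map_eq0 ih) rmorphB /= map_polyXn map_polyC dvdpp.
Qed.

Theorem exists_cover_field :
  exists (L : fieldType) (E : {rmorphism {poly M} -> L}) (D : nat -> L -> L),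
  [/\ p%:R = 0 :> L /\ (forall i, derivation (D i)),
      E ('X^p - fk%:P) = 0,
      forall P : {poly M}, (size P <= p)%N -> E P = 0 -> P = 0,
      forall i c, D i (E (c%:MP)%:P) = 0
    & ~ null_form w kappa f D (fun j => E ('X_j)%:P)].
Proof.
have [L [E [D [[chL derD] Eh ker DE]]]] := cover_field.
exists L, E, D; split=> //.
  by move=> i x; rewrite DE /delta !mderivC !mulr0 subrr polyC0 rmorph0.
have EC0 (x : M) : x != 0 -> E x%:P != 0.
  apply: contra_neq => Ex; apply/eqP; rewrite -polyC_eq0; apply/eqP; apply: ker => //.
  by rewrite (leq_trans (size_polyC_leq1 _)) // prime_gt0.
have gradE j : grad f (fun j => E ('X_j)%:P) j = E (fk^`M(j))%:P.
  by rewrite /grad -[in RHS]map_mpoly_deriv; exact: (ev_map (E \o polyC)).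
have c4 : grad f (fun j => E ('X_j)%:P) o4 != 0 by rewrite gradE EC0.
move=> /(_ (ex_intro _ o4 c4) o4); apply/eqP.
have DX i j : D i (E ('X_j)%:P) = E (fk^`M(o4) *+ (j == a i) - fk^`M(a i) *+ (j == o4))%:P.
  by rewrite DE /delta !mderivXU !mulr_natr.
have X0 : 'X_o0 != 0 :> M.
  apply/eqP => X0; have := mderivXU k o0 o0.
  by rewrite X0 mderiv0 eqxx => /eqP; rewrite eq_sym oner_eq0.
rewrite /tminor mulf_neq0 ?expf_neq0 ?EC0 //.
have c0 i : gcol D (w o0) (E ('X_o0)%:P) i = if i is 0%N then E ('X_o0)%:P else 0.
  case: i => [|i] /=; first by rewrite w_o0 mulr1n.
  by rewrite DX /a; case: i => [|[|i]]; rewrite !mulr0n subr0 polyC0 rmorph0.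
have cj (j : 'I_5) : j != o4 -> forall i, gcol D (w j) (E ('X_j)%:P) i.+1
    = if j == a i then E (fk^`M(o4))%:P else 0.
  move=> j4 i /=; rewrite DX (negPf j4) mulr0n subr0.
  by case: eqP => _; rewrite ?mulr1n // mulr0n polyC0 rmorph0.
have g0 : E (fk^`M(o4))%:P != 0 by apply: EC0.
have x0 : E ('X_o0)%:P != 0 by apply: EC0.
(* With column [o4] deleted the matrix is triangular with diagonal [x_0, f_4, f_4, f_4], where [f_4]
   is the derivative of [f] along [o4]. *)
rewrite /minor -[X in X != 0]/(det4 _ _ _ _) det4_triangular ?c0 ?cj //=.
exact: mulf_neq0 (mulf_neq0 (mulf_neq0 x0 g0) g0) g0.
Qed.
End InseparableCover.

(** * Gauss reduction and Newton polygons *)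

Section Place.
Variables (K : fieldType) (O : comNzRingType) (k : fieldType).
Variables (inc : {rmorphism O -> K}) (res : {rmorphism O -> k}).
Hypothesis inc_inj : injective inc.
Hypothesis place_val :
  forall x, (exists a, inc a = x) \/ exists2 a, res a = 0 & x * inc a = 1.

(** Values are compared through divisibility in the valuation ring; the value group is never
    formed. *)
Definition vle (x y : K) := exists o, x = inc o * y.
Definition vlt (x y : K) := exists2 o, res o = 0 & x = inc o * y.

Lemma vltW x y : vlt x y -> vle x y.
Proof. by move=> [o _ ->]; exists o. Qed.

Lemma vle_refl x : vle x x. Proof. by exists 1; rewrite rmorph1 mul1r. Qed.

Lemma vle_trans y x z : vle x y -> vle y z -> vle x z.
Proof. by move=> [o ->] [o' ->]; exists (o * o'); rewrite rmorphM mulrA. Qed.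

Lemma vle_total x y : vle x y \/ vlt y x.
Proof.
have [->|y0] := eqVneq y 0.
  by right; exists 0; rewrite ?rmorph0 ?mul0r.
have [[a aE]|[a ra aE]] := place_val (x / y).
  by left; exists a; rewrite aE mulfVK.
right; exists a => //.
have := congr1 ( *%R^~ y) aE; rewrite mulrAC mulfVK // mul1r => <-.
by rewrite mulrC.
Qed.

Lemma vle_gtF x y : y != 0 -> vle y x -> ~ vlt x y.
Proof.
move=> y0 [o yE] [o' ro' xE]; move: yE; rewrite xE mulrA -rmorphM.
rewrite -{1}[y]mul1r => /(mulIf y0); rewrite -(rmorph1 inc) => /inc_inj E.
have := congr1 res E; rewrite rmorphM ro' mulr0 rmorph1 => /eqP.
by rewrite oner_eq0.
Qed.

Lemma vleX x y n : vle x y -> vle (x ^+ n) (y ^+ n).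
Proof. by move=> [o ->]; exists (o ^+ n); rewrite rmorphXn exprMn. Qed.

Lemma vle_res (x y : K) o : y != 0 -> x = inc o * y -> vle y x -> res o != 0.
Proof.
move=> y0 xE yx; apply/eqP => ro; apply: (vle_gtF y0 yx); by exists o.
Qed.

Lemma vle_max (J : eqType) (r : seq J) (F : J -> K) : r != [::] ->
  exists2 j, j \in r & forall i, i \in r -> vle (F i) (F j).
Proof.
elim: r => // i0 r IHr _; have [r0|/IHr[j jr jmax]] := eqVneq r [::].
  exists i0; first by rewrite mem_head.
  by move=> i; rewrite r0 inE => /eqP ->; exact: vle_refl.
have [ji|/vltW ij] := vle_total (F j) (F i0).
  exists i0; first by rewrite mem_head.
  move=> i; rewrite inE => /orP[/eqP ->|/jmax ii]; first exact: vle_refl.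
  exact: vle_trans ji.
exists j; first by rewrite inE jr orbT.
by move=> i; rewrite inE => /orP[/eqP ->|/jmax].
Qed.

Lemma lift_mpoly n (P : {mpoly K[n]}) : (forall m, vle P@_m 1) ->
  exists Q, map_mpoly inc Q = P.
Proof.
move=> HP; have HP' m : exists o, inc o = P@_m.
  by have [o ->] := HP m; exists o; rewrite mulr1.
pose l m := projT1 (boolp.cid (HP' m)).
have lE m : inc (l m) = P@_m by rewrite /l; case: boolp.cid.
exists (\sum_(m <- msupp P) l m *: 'X_[m]); rewrite [RHS]mpolyE raddf_sum.
by apply: eq_bigr => m _ /=; rewrite map_mpolyZ map_mpolyX lE.
Qed.

Lemma map_mpoly_inj n : injective (map_mpoly inc : {mpoly O[n]} -> {mpoly K[n]}).
Proof.
move=> P Q E; apply/mpolyP => m; apply: inc_inj.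
by rewrite -!mcoeff_map_mpoly E.
Qed.

Local Notation T R := {poly {mpoly R[5]}}.
Definition mapT (R S : comNzRingType) (phi : {rmorphism R -> S}) : {rmorphism T R -> T S} :=
  map_poly (map_mpoly phi).

Lemma lift_polympoly (P : T K) : (forall i m, vle P`_i@_m 1) ->
  exists2 Q : T O, mapT inc Q = P & size Q = size P.
Proof.
move=> HP; pose l i := projT1 (boolp.cid (lift_mpoly (HP i))).
have lE i : map_mpoly inc (l i) = P`_i by rewrite /l; case: boolp.cid.
have QE : mapT inc (\poly_(i < size P) l i) = P.
  apply/polyP => i; rewrite coef_map /= coef_poly; case: ltnP => [_|si]; first exact: lE.
  by rewrite rmorph0 nth_default.
exists (\poly_(i < size P) l i) => //.
rewrite -[in RHS]QE; apply/esym/size_map_inj_poly; first exact: map_mpoly_inj.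
exact: rmorph0.
Qed.

End Place.

Lemma twisted_form_sum (S : comNzRingType) (phi : {rmorphism S -> S}) n
    (r : seq 'X_{1..n}) (cf : 'X_{1..n} -> S) (Z ka : 'I_n -> S) (ga : S) :
  (forall m, phi (cf m) = cf m) ->
  (forall m, m \in r -> \prod_i ka i ^+ m i = ga) ->
  \sum_(m <- r) cf m * \prod_i (ka i * phi (Z i)) ^+ m i
    = ga * phi (\sum_(m <- r) cf m * \prod_i Z i ^+ m i).
Proof.
move=> cfE kaE; rewrite rmorph_sum big_distrr /=; apply: eq_big_seq => m /kaE <-.
rewrite rmorphM cfE mulrCA rmorph_prod /=; congr (_ * _).
rewrite -big_split; apply: eq_bigr => i _ /=.
by rewrite exprMn rmorphXn.
Qed.

Lemma prod_hom_weighted (R S : comNzRingType) (h : {rmorphism R -> S}) c n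
    (w : 'I_n -> nat) (m : 'X_{1..n}) :
  \prod_i h (c ^+ w i) ^+ m i = h (c ^+ (\sum_i w i * m i)).
Proof.
elim/big_rec2: _ => [|i x z _ ->]; first by rewrite expr0 rmorph1.
by rewrite exprD rmorphM exprM !rmorphXn.
Qed.

(** * The Gauss valuation on the coordinate ring of the hypersurface *)

Section Gauss.
Variables (K : fieldType) (O : comNzRingType) (k : fieldType).
Variables (inc : {rmorphism O -> K}) (res : {rmorphism O -> k}).
Hypothesis inc_inj : injective inc.
Hypothesis place_val :
  forall x, (exists a, inc a = x) \/ exists2 a, res a = 0 & x * inc a = 1.

Local Notation T R := {poly {mpoly R[5]}}.
Local Notation vle := (vle inc).

Variables (p : nat) (F : T O) (L : fieldType) (E : {rmorphism T k -> L}).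
Hypothesis F_monic : F \is monic.
Hypothesis size_F : size F = p.+1.
Hypothesis EF : E (mapT res F) = 0.
Hypothesis E_ker : forall P : T k, (size P <= p)%N -> E P = 0 -> P = 0.

Let FK := mapT inc F.

Let RED : T O -> L := E \o mapT res.
HB.instance Definition _ := GRing.RMorphism.copy RED (E \o mapT res).

Lemma FK_monic : FK \is monic. Proof. exact: monic_map. Qed.

Lemma size_FK : size FK = p.+1.
Proof.
rewrite -size_F; apply: size_map_inj_poly; last exact: rmorph0.
exact: map_mpoly_inj.
Qed.

Definition inF (Q : T K) := exists S, Q = S * FK.

Lemma inF0 : inF 0. Proof. by exists 0; rewrite mul0r. Qed.
Lemma inFD P Q : inF P -> inF Q -> inF (P + Q).
Proof. by move=> [S ->] [S' ->]; exists (S + S'); rewrite mulrDl. Qed.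
Lemma inFM P Q : inF Q -> inF (P * Q).
Proof. by move=> [S ->]; exists (P * S); rewrite mulrA. Qed.
Lemma inFN Q : inF Q -> inF (- Q).
Proof. by move=> H; rewrite -mulN1r; exact: inFM. Qed.

Lemma inF_small Q : inF Q -> (size Q <= p)%N -> Q = 0.
Proof.
move=> [S ->]; have [->|S0] := eqVneq S 0; first by rewrite mul0r.
rewrite size_Mmonic ?FK_monic // size_FK addnS /= => le.
by move: S0; rewrite -size_poly_gt0; move: (size S) le => a; lia.
Qed.

(** The reduction from the coordinate ring over [K] to [L], as a relation: modulo the equation, [Q]
    has an integral representative with image [l]. It is partial, and single-valued by
    [redto_uniq]. *)
Definition redto (Q : T K) (l : L) := exists2 Q', inF (mapT inc Q' - Q) & RED Q' = l.

(** Division by the monic [F] takes place over [O]. Over [K] the remainder is a multiple of the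
    equation of too small degree, hence zero. *)
Lemma redto_ker Q' : inF (mapT inc Q') -> RED Q' = 0.
Proof.
move=> inQ; have Q'E := Pdiv.RingMonic.rdivp_eq F_monic Q'.
set q := Pdiv.Ring.rdivp Q' F in Q'E; set r := Pdiv.Ring.rmodp Q' F in Q'E.
have sr : (size r <= p)%N by rewrite -ltnS -size_F Pdiv.CommonRing.ltn_rmodp monic_neq0.
have r0 : r = 0.
  apply: (map_inj_poly (@map_mpoly_inj _ _ inc inc_inj 5) (rmorph0 _)).
  rewrite rmorph0; apply: inF_small.
    have -> : map_poly (map_mpoly inc) r = mapT inc Q' - mapT inc q * FK.
      by rewrite Q'E rmorphD rmorphM addrC addKr.
    by apply: inFD => //; apply: inFN; exists (mapT inc q).
  by rewrite (leq_trans (size_poly _ _)).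
by rewrite Q'E r0 addr0 rmorphM /= /RED /= EF mulr0.
Qed.

Lemma redto_uniq Q l l' : redto Q l -> redto Q l' -> l = l'.
Proof.
move=> [Q1 H1 <-] [Q2 H2 <-]; apply/eqP; rewrite -subr_eq0 -rmorphB.
apply/eqP/redto_ker; rewrite rmorphB.
have -> : mapT inc Q1 - mapT inc Q2 = (mapT inc Q1 - Q) - (mapT inc Q2 - Q) by ring.
by apply: inFD => //; apply: inFN.
Qed.

Lemma redtoD P Q l l' : redto P l -> redto Q l' -> redto (P + Q) (l + l').
Proof.
move=> [Q1 H1 <-] [Q2 H2 <-]; exists (Q1 + Q2); last by rewrite rmorphD.
rewrite rmorphD (_ : _ - _ = (mapT inc Q1 - P) + (mapT inc Q2 - Q)); first exact: inFD.
by ring.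
Qed.

Lemma redtoM P Q l l' : redto P l -> redto Q l' -> redto (P * Q) (l * l').
Proof.
move=> [Q1 H1 <-] [Q2 H2 <-]; exists (Q1 * Q2); last by rewrite rmorphM.
rewrite rmorphM (_ : _ - _ = mapT inc Q1 * (mapT inc Q2 - Q) + Q * (mapT inc Q1 - P)); last by ring.
by apply: inFD; apply: inFM.
Qed.

Lemma redto_mapT Q' : redto (mapT inc Q') (RED Q').
Proof. by exists Q' => //; rewrite subrr; exact: inF0. Qed.

Lemma redto0 : redto 0 0.
Proof. by have := redto_mapT 0; rewrite !rmorph0. Qed.

Lemma redto1 : redto 1 1.
Proof. by have := redto_mapT 1; rewrite !rmorph1. Qed.

Lemma redtoX P l n : redto P l -> redto (P ^+ n) (l ^+ n).
Proof.
move=> H; elim: n => [|n IHn]; first exact: redto1.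
by rewrite !exprS; exact: redtoM.
Qed.

Lemma redto_sum (J : Type) (r : seq J) (A : J -> T K) (B : J -> L) :
  (forall j, redto (A j) (B j)) ->
  redto (\sum_(j <- r) A j) (\sum_(j <- r) B j).
Proof.
move=> H; elim: r => [|j r IHr]; first by rewrite !big_nil; exact: redto0.
by rewrite !big_cons; exact: redtoD.
Qed.

Lemma redto_inF P Q l : inF (P - Q) -> redto P l -> redto Q l.
Proof.
move=> H [Q' HQ' <-]; exists Q' => //.
by rewrite (_ : _ - _ = (mapT inc Q' - P) + (P - Q)); [exact: inFD | ring].
Qed.

Lemma inF_redto Q : inF Q -> redto Q 0.
Proof. by move=> H; apply: redto_inF redto0; rewrite sub0r; exact: inFN. Qed.

Definition cst (R : comNzRingType) (c : R) : T R := c%:MP%:P.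

Definition bar (o : O) : L := E (cst (res o)).

Lemma redto_cst o : redto (cst (inc o)) (bar o).
Proof.
have := redto_mapT (cst o); rewrite /RED /= /cst !map_polyC /= !map_mpolyC //.
Qed.

Lemma bar_eq0 o : (0 < p)%N -> (bar o == 0) = (res o == 0).
Proof.
move=> p0; apply/eqP/eqP => [/E_ker H|ro]; last by rewrite /bar ro /cst mpolyC0 polyC0 rmorph0.
have : cst (res o) = 0.
  by apply: H; rewrite (leq_trans (size_polyC_leq1 _)).
by move=> /polyC_inj; move/eqP; rewrite mpolyC_eq0 => /eqP.
Qed.

Lemma cst_mul (R : comNzRingType) (c : R) (P : T R) i m : (cst c * P)`_i@_m = c * P`_i@_m.
Proof. by rewrite coefCM mcoeffCM. Qed.

(** Gauss's lemma: the remainder modulo the equation is divided by a coefficient of largest value.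
    One coefficient becomes 1, and the reduction is not zero by [E_ker]. *)
Lemma redto_ex Q : ~ inF Q -> exists a l, [/\ a != 0, l != 0 & redto (cst a * Q) l].
Proof.
move=> nQ; have QE := Pdiv.RingMonic.rdivp_eq FK_monic Q.
set q := Pdiv.Ring.rdivp Q FK in QE; set r := Pdiv.Ring.rmodp Q FK in QE.
have sr : (size r <= p)%N by rewrite -ltnS -size_FK Pdiv.CommonRing.ltn_rmodp monic_neq0 ?FK_monic.
have r0 : r != 0.
  by apply/eqP => r0; apply: nQ; exists q; rewrite QE r0 addr0.
pose cs := [seq (x.1, m) | x <- [seq (i, msupp r`_i) | i <- iota 0 (size r)], m <- x.2].
have csP i m : r`_i@_m != 0 -> (i, m) \in cs.
  move=> nz; apply/allpairsPdep; exists (i, msupp r`_i), m; split=> //.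
    apply: map_f; rewrite mem_iota /= add0n ltnNge; apply/negP => si.
    by move: nz; rewrite nth_default // mcoeff0 eqxx.
  by rewrite mcoeff_msupp.
have [i0 [m0 nz0]] : exists i m, r`_i@_m != 0.
  have : r`_(size r).-1 != 0 by rewrite -/(lead_coef r) lead_coef_eq0.
  move=> H; exists (size r).-1; apply: boolp.contrapT => H'.
  case/eqP: H; apply/mpolyP => m; rewrite mcoeff0.
  by apply/eqP/negPn/negP => Hm; apply: H'; exists m.
have cs0 : cs != [::] by apply: contraTneq (csP _ _ nz0) => ->.
have [[i m] _ max] := vle_max place_val (fun x => r`_x.1@_x.2) cs0.
rewrite /= in max; set c := r`_i@_m in max.
have max' j n : vle r`_j@_n c.
  have [->|nz] := eqVneq r`_j@_n 0; first by exists 0; rewrite rmorph0 mul0r.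
  exact: (max (j, n)) (csP _ _ nz).
have c0 : c != 0.
  apply: contraNneq nz0 => c0; have [o ->] := max' i0 m0.
  by rewrite c0 mulr0.
have [|Q' Q'E sQ'] := @lift_polympoly _ _ inc inc_inj (cst c^-1 * r).
  move=> j n; rewrite cst_mul; have [o ->] := max' j n.
  by exists o; rewrite mulr1 mulrC mulfK.
exists c^-1, (RED Q'); split; first by rewrite invr_eq0.
  apply/eqP => /E_ker H; have /H : (size (mapT res Q') <= p)%N.
    rewrite (leq_trans (size_poly _ _)) // sQ' (leq_trans _ sr) //.
    by rewrite /cst mul_polyC size_scale_leq.
  move=> /(congr1 (fun P : T k => P`_i@_m)); rewrite coef0 mcoeff0 coef_map /= mcoeff_map_mpoly.
  have := congr1 (fun P : T K => P`_i@_m) Q'E; rewrite cst_mul -/c mulVf // coef_map /= mcoeff_map_mpoly.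
  rewrite -(rmorph1 inc) => /inc_inj -> /eqP.
  by rewrite rmorph1 oner_eq0.
exists Q' => //; rewrite Q'E QE mulrDr opprD addrCA subrr addr0 -mulrN.
by apply: inFM; apply: inFN; exists q.
Qed.

Hypothesis p_gt0 : (0 < p)%N.
Hypothesis rootK : forall n (x : K), (0 < n)%N -> exists y, y ^+ n = x.

Lemma cstM (R : comNzRingType) (a b : R) : cst (a * b) = cst a * cst b.
Proof. by rewrite /cst mpolyCM polyCM. Qed.

Lemma cstX (R : comNzRingType) (a : R) n : cst (a ^+ n) = cst a ^+ n.
Proof. by rewrite /cst !rmorphXn. Qed.

Lemma cst1 (R : comNzRingType) : cst (1 : R) = 1.
Proof. by rewrite /cst mpolyC1 polyC1. Qed.

(** Each entry has its own best scalar [c j], obtained from a root of order [w j]; the smallest of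
    them serves for all. It gives a nonzero reduction at its own index and differs from the others
    by integral factors. *)
Lemma redto_normalize (J : eqType) (r : seq J) (Q : J -> T K) (w : J -> nat) :
  (forall j, (0 < w j)%N) -> (exists2 j, j \in r & ~ inF (Q j)) ->
  exists b l, [/\ b != 0, forall j, j \in r -> redto (cst (b ^+ w j) * Q j) (l j)
    & exists2 j, j \in r & l j != 0].
Proof.
move=> w0 [j1 j1r nj1].
have ex j : exists c l, c != 0 /\ (~ inF (Q j) ->
    l != 0 /\ redto (cst (c ^+ w j) * Q j) l).
  have [inj|/redto_ex[a [l [a0 l0 H]]]] := boolp.pselect (inF (Q j)).
    by exists 1, 0; rewrite oner_neq0.
  have [c cE] := rootK a (w0 j); exists c, l; rewrite cE; split=> //.
  by apply: contraNneq a0 => c0; rewrite -cE c0 expr0n eqn0Ngt w0.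
pose c j := projT1 (boolp.cid (ex j)).
have cP j : exists l, c j != 0 /\ (~ inF (Q j) -> l != 0 /\ redto (cst (c j ^+ w j) * Q j) l).
  by rewrite /c; case: boolp.cid.
pose l j := projT1 (boolp.cid (cP j)).
have lP j : c j != 0 /\ (~ inF (Q j) -> l j != 0 /\ redto (cst (c j ^+ w j) * Q j) (l j)).
  by rewrite /l; case: boolp.cid.
pose r' := [seq j <- r | boolp.asbool (~ inF (Q j))].
have r'0 : r' != [::].
  suff : j1 \in r' by case: r'.
  by rewrite mem_filter j1r andbT; apply/boolp.asboolP.
have [j0 + max] := vle_max place_val (fun j => (c j)^-1) r'0.
rewrite mem_filter => /andP[/boolp.asboolP nj0 j0r].
have oE j : ~ inF (Q j) -> j \in r -> exists o, c j0 = inc o * c j.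
  move=> nj jr; have [|o oE] := max j.
    by rewrite mem_filter jr andbT; apply/boolp.asboolP.
  have [cj _] := lP j; have [cj0 _] := lP j0.
  exists o; apply: (mulIf (invr_neq0 cj)); rewrite mulfK // oE mulrCA.
  by rewrite mulfV ?mulr1.
have red j : exists l', j \in r -> redto (cst (c j0 ^+ w j) * Q j) l'.
  have [inj|nj] := boolp.pselect (inF (Q j)).
    by exists 0 => _; apply/inF_redto/inFM.
  have [jr|njr] := boolP (j \in r); last by exists 0.
  have [o E0] := oE j nj jr; have [_ /(_ nj)[_ H]] := lP j.
  exists (bar (o ^+ w j) * l j) => _.
  rewrite E0 exprMn cstM -mulrA -rmorphXn; apply: redtoM => //.
  exact: redto_cst.
exists (c j0), (fun j => projT1 (boolp.cid (red j))); split.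
- by have [] := lP j0.
- by move=> j jr; case: boolp.cid => l' /= /(_ jr).
- exists j0 => //; case: boolp.cid => l' /= /(_ j0r) H.
  have [_ /(_ nj0)[lj0 H']] := lP j0.
  by rewrite (redto_uniq H H').
Qed.

Definition redpoly (Y : {poly T K}) (y : {poly L}) := forall n, redto Y`_n y`_n.

Lemma redpolyD P Q u v : redpoly P u -> redpoly Q v -> redpoly (P + Q) (u + v).
Proof. by move=> H H' n; rewrite !coefD; exact: redtoD. Qed.

Lemma redpolyM P Q u v : redpoly P u -> redpoly Q v -> redpoly (P * Q) (u * v).
Proof. by move=> H H' n; rewrite !coefM; apply: redto_sum => i; exact: redtoM. Qed.

Lemma redpolyC P u : redto P u -> redpoly P%:P u%:P.
Proof. by move=> H n; rewrite !coefC; case: eqP => // _; exact: redto0. Qed.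

Lemma redpolyX P u n : redpoly P u -> redpoly (P ^+ n) (u ^+ n).
Proof.
move=> H; elim: n => [|n IHn]; last by rewrite !exprS; exact: redpolyM.
by rewrite !expr0 -!polyC1; exact: redpolyC redto1.
Qed.

Lemma redpoly_prod (J : Type) (r : seq J) (A : J -> {poly T K}) (B : J -> {poly L}) :
  (forall j, redpoly (A j) (B j)) ->
  redpoly (\prod_(j <- r) A j) (\prod_(j <- r) B j).
Proof.
move=> H; elim: r => [|j r IHr]; last by rewrite !big_cons; exact: redpolyM.
by rewrite !big_nil -!polyC1; exact: redpolyC redto1.
Qed.

Lemma redpoly_sum (J : Type) (r : seq J) (A : J -> {poly T K}) (B : J -> {poly L}) :
  (forall j, redpoly (A j) (B j)) ->
  redpoly (\sum_(j <- r) A j) (\sum_(j <- r) B j).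
Proof.
move=> H; elim: r => [|j r IHr]; last by rewrite !big_cons; exact: redpolyD.
by rewrite !big_nil => n; rewrite !coef0; exact: redto0.
Qed.

Lemma redpoly_uniq P u v : redpoly P u -> redpoly P v -> u = v.
Proof. by move=> H H'; apply/polyP => n; apply: redto_uniq (H n) (H' n). Qed.

Lemma redpoly0 : redpoly 0 0.
Proof. by move=> n; rewrite !coef0; exact: redto0. Qed.

Definition low (j : 'I_5) : 'I_6 := widen_ord (leqnSn 5) j.
Definition hi6 : 'I_6 := ord_max.

Variables (G : {mpoly O[6]}).
Hypothesis G_lead : G@_(U_(hi6) *+ p)%MM = 1.
Hypothesis G_low : forall m, m \in msupp G -> m != (U_(hi6) *+ p)%MM -> (m hi6 < p)%N.

Definition formK (Y : 'I_6 -> {poly T K}) : {poly T K} :=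
  \sum_(m <- msupp G) (cst (inc G@_m))%:P * \prod_i Y i ^+ m i.

Definition formL (y : 'I_5 -> {poly L}) (om : {poly L}) : {poly L} :=
  \sum_(m <- msupp G) (bar G@_m)%:P * ((\prod_j y j ^+ m (low j)) * om ^+ m hi6).

Lemma redpoly_form Y y om : (forall j, redpoly (Y (low j)) (y j)) ->
  redpoly (Y hi6) om -> redpoly (formK Y) (formL y om).
Proof.
move=> Hy Hom; apply: redpoly_sum => m; apply: redpolyM.
  exact/redpolyC/redto_cst.
rewrite big_ord_recr /=; apply: redpolyM; last exact: redpolyX.
by apply: redpoly_prod => j; apply: redpolyX.
Qed.

(* The last coordinate is integral over the other ones. *)
Lemma redpoly_integral Y y : (forall j, redpoly (Y (low j)) (y j)) -> formK Y = 0 ->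
  exists2 om, redpoly (Y hi6) om & formL y om = 0.
Proof.
move=> Hy HY; suff [om Hom] : exists om, redpoly (Y hi6) om.
  exists om => //; apply: redpoly_uniq redpoly0.
  by rewrite -HY; exact: redpoly_form.
set W := Y hi6 in HY *.
have [all0|/boolp.existsNP[n0 nn0]] := boolp.pselect (forall n, inF W`_n).
  by exists 0 => n; rewrite coef0; exact: inF_redto.
have n0s : (n0 < size W)%N.
  by rewrite ltnNge; apply/negP => s; apply: nn0; rewrite nth_default //; exact: inF0.
have [||b [l [b0 Hl [n1 n1s ln1]]]] := @redto_normalize _ (iota 0 (size W)) (fun n => W`_n) (fun=> 1%N) => //.
  by exists n0 => //; rewrite mem_iota.
pose u := \poly_(n < size W) l n.
have Hu : redpoly ((cst b)%:P * W) u.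
  move=> n; rewrite coefCM coef_poly; case: ltnP => sn.
    by have := Hl n; rewrite expr1; apply; rewrite mem_iota.
  by rewrite nth_default // mulr0; exact: redto0.
have u0 : u != 0.
  apply: contraNneq ln1 => u0; have := congr1 (fun q : {poly L} => q`_n1) u0.
  by move: n1s; rewrite mem_iota coef0 coef_poly /= => -> ->.
have [[o oE]|[o ro oE]] := place_val b^-1.
  exists ((bar o)%:P * u) => n; rewrite coefCM.
  have := redtoM (redto_cst o) (Hu n); rewrite coefCM mulrA -cstM oE mulVf //.
  by rewrite cst1 mul1r.
(* Here [b] is in the maximal ideal. In the equation times [b ^+ p] every monomial but the leading
   one keeps a positive power of [b], so only [u ^+ p] survives the reduction. *)
have bE : b = inc o by rewrite -[LHS]mulr1 -oE mulrA mulfV // mul1r.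
exfalso; move/eqP: u0; apply.
suff up : u ^+ p = 0 by apply/eqP; move/eqP: up; rewrite expf_eq0 => /andP[].
pose z := fun m : 'X_{1..6} => if m == (U_(hi6) *+ p)%MM then u ^+ p else 0.
have E1 : formK Y * (cst b)%:P ^+ p = 0 by rewrite HY mul0r.
have zE : \sum_(m <- msupp G) z m = u ^+ p.
  rewrite (bigD1_seq (U_(hi6) *+ p)%MM) ?msupp_uniq //=; last first.
    by rewrite mcoeff_msupp G_lead oner_neq0.
  by rewrite /z eqxx big1 ?addr0 // => m /negPf ->.
rewrite -zE; apply: redpoly_uniq redpoly0.
rewrite -E1 /formK big_distrl /=; rewrite [X in redpoly X _]big_seq [X in redpoly _ X]big_seq.
elim/big_ind2: _ => [|P1 u1 P2 u2|m mG]; first exact: redpoly0; first exact: redpolyD.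
rewrite big_ord_recr /= -/hi6 -/W /z.
have Hlow : redpoly (\prod_(j < 5) Y (low j) ^+ m (low j)) (\prod_(j < 5) y j ^+ m (low j)).
  by apply: redpoly_prod => j; apply: redpolyX.
have [mE|nm] := eqVneq m (U_(hi6) *+ p)%MM.
  have m0 j : m (low j) = 0%N.
    rewrite mE mulmnE mnm1E; case: eqP => // /(congr1 val) /=.
    by have := ltn_ord j => + jE; rewrite -jE.
  have PY : \prod_(j < 5) Y (low j) ^+ m (low j) = 1.
    by apply: big1 => j _; rewrite m0; exact: expr0.
  have mp : m hi6 = p by rewrite mE mulmnE mnm1E eqxx mul1n.
  have Gm : G@_m = 1 by rewrite mE.
  rewrite PY mp Gm rmorph1 cst1 polyC1 !mul1r -exprMn mulrC.
  exact: redpolyX.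
have mp := G_low mG nm.
have -> : (cst (inc G@_m))%:P * ((\prod_(j < 5) Y (low j) ^+ m (low j)) * W ^+ m hi6) * (cst b)%:P ^+ p
    = (cst (inc (G@_m * o ^+ (p - m hi6))))%:P * ((\prod_(j < 5) Y (low j) ^+ m (low j)) * ((cst b)%:P * W) ^+ m hi6).
  rewrite rmorphM rmorphXn -bE cstM cstX polyCM rmorphXn /= exprMn.
  by rewrite -{1}(subnK (ltnW mp)) exprD; ring.
have -> : 0 = (bar (G@_m * o ^+ (p - m hi6)))%:P * ((\prod_(j < 5) y j ^+ m (low j)) * u ^+ m hi6).
  rewrite /bar rmorphM rmorphXn ro expr0n subn_eq0 leqNgt mp mulr0.
  by rewrite /cst mpolyC0 polyC0 rmorph0 polyC0 mul0r.
apply: redpolyM; first exact/redpolyC/redto_cst.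
by apply: redpolyM => //; apply: redpolyX.
Qed.

Variables (w : 'I_5 -> nat) (w6 : 'I_6 -> nat) (e d : nat) (f : {mpoly int[5]}).
Hypothesis w_gt0 : forall j, (0 < w j)%N.
Hypothesis w6_low : forall j, w6 (low j) = w j.
Hypothesis dE : d = (e * p)%N.
Hypothesis f_homog : whomog w d f.
Hypothesis G_homog : whomog w6 d G.
Hypothesis G_bar : forall y om, formL y om = om ^+ p - ev y f.

Variable null : ('I_5 -> L) -> Prop.
Hypothesis null_scale : forall (mu : L) a, mu != 0 ->
  null (fun j => mu ^+ w j * a j) -> null a.
Hypothesis null_edge : forall M (y : 'I_5 -> {poly L}) b om,
  (forall j, top (M * w j) (y j) (b j)) -> ev y f = om ^+ p ->
  forall j0, (y j0).[0] != 0 -> null (fun j => (y j).[0]) -> null b.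

Definition rescale (rho : K) (Y : {poly T K}) := Y \Po (cst rho *: 'X).
HB.instance Definition _ rho := GRing.RMorphism.copy (rescale rho) (comp_poly (cst rho *: 'X)).

Lemma rescaleC rho P : rescale rho P%:P = P%:P.
Proof. exact: comp_polyC. Qed.

Lemma coef_rescale rho Y n : (rescale rho Y)`_n = cst (rho ^+ n) * Y`_n.
Proof.
rewrite /rescale comp_polyE coef_sum.
under eq_bigr => i _ do rewrite coefZ exprZn coefZ coefXn.
have [sn|sn] := ltnP n (size Y); last first.
  rewrite [Y`_n]nth_default // mulr0 big1 // => i _.
  by rewrite (_ : n == i = false) ?mulr0 // gtn_eqF // (leq_trans (ltn_ord i)).
rewrite (bigD1 (Ordinal sn)) //= eqxx mulr1 cstX mulrC big1 ?addr0 // => i.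
by rewrite -val_eqE /= eq_sym => /negPf ->; rewrite !mulr0.
Qed.

Lemma formK_scale c rho Y : formK Y = 0 ->
  formK (fun i => (cst (c ^+ w6 i))%:P * rescale rho (Y i)) = 0.
Proof.
move=> HY.
have cfE m : rescale rho (cst (inc G@_m))%:P = (cst (inc G@_m))%:P by exact: rescaleC.
have kaE m : m \in msupp G -> \prod_i (cst (c ^+ w6 i))%:P ^+ m i = (cst (c ^+ d))%:P.
  move=> mG; rewrite -(G_homog mG).
  exact: (prod_hom_weighted (polyC \o (polyC \o @mpolyC 5 K)) c w6 m).
have E1 := @twisted_form_sum _ (rescale rho) _ (msupp G) _ Y _ _ cfE kaE.
by apply: (etrans E1); rewrite -/(formK Y) HY rmorph0 mulr0.
Qed.

Variables (N : nat) (Y : 'I_6 -> {poly T K}).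
Hypothesis Y_form : formK Y = 0.
Hypothesis Y_supp : forall j n, (Y (low j))`_n != 0 -> (w j %| n)%N /\ (n <= N * w j)%N.

(** With this indexing each slice is a weighted vector, and the substitution [theta -> rho theta]
    acts on slice [l] by the weighted action of [rho ^ l]. *)
Definition slice l j := (Y (low j))`_(l * w j).
Definition active l := exists j, ~ inF (slice l j).

Lemma active_le l : active l -> (l <= N)%N.
Proof.
move=> [j nj]; have [z|nz] := eqVneq (slice l j) 0; first by case: nj; rewrite z; exact: inF0.
by have [_] := Y_supp nz; rewrite leq_pmul2r.
Qed.

(** [al] is the inverse of a weighted norm of the slice, and [a] the reduction of the normalized
    slice. Inactive slices get the values 1 and 0. *)
Let norm_ex l : exists al a, [/\ al != 0,
  forall j, redto (cst (al ^+ w j) * slice l j) (a j)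
  & active l -> exists j, a j != 0].
Proof.
have [[j nj]|nact] := boolp.pselect (active l).
  have [|b [a [b0 Ha [j' _ aj']]]] := @redto_normalize _ (enum 'I_5) (slice l) w w_gt0.
    by exists j => //; rewrite mem_enum.
  exists b, a; split=> // [i|_]; last by exists j'.
  by apply: Ha; rewrite mem_enum.
exists 1, (fun=> 0); split=> //; first by rewrite oner_neq0.
move=> j; apply/inF_redto/inFM; apply: boolp.contrapT => nj.
by apply: nact; exists j.
Qed.

Let al l := projT1 (boolp.cid (norm_ex l)).
Let a_ex l : exists a, [/\ al l != 0,
  forall j, redto (cst (al l ^+ w j) * slice l j) (a j)
  & active l -> exists j, a j != 0].
Proof. by rewrite /al; case: boolp.cid. Qed.
Let a l := projT1 (boolp.cid (a_ex l)).
Let aP l : [/\ al l != 0,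
  forall j, redto (cst (al l ^+ w j) * slice l j) (a l j)
  & active l -> exists j, a l j != 0].
Proof. by rewrite /a; case: boolp.cid. Qed.

Let al0 l : al l != 0. Proof. by case: (aP l). Qed.

(* [n] and [n'] are the end points of the edge of slope [rho] of the Newton polygon. *)
Let edge_step n n' rho : rho != 0 -> (n <= n')%N -> active n ->
  (forall l, active l -> vle (al n * rho ^+ l) (al l * rho ^+ n)) ->
  (forall l, active l -> (l < n)%N || (n' < l)%N -> vlt inc res (al n * rho ^+ l) (al l * rho ^+ n)) ->
  vle (al n' * rho ^+ n) (al n * rho ^+ n') -> active n' ->
  null (a n) -> null (a n').
Proof.
move=> rho0 nn' actn Hle Hlt Hn' actn' nulln.
have rn : rho ^+ n != 0 by rewrite expf_neq0.
(* Scaling the curve [theta -> Y (rho theta)] by [c] normalizes slice [n]. By the slope conditions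
   the other slices stay integral, and those outside [n..n'] reduce to 0. *)
pose c := al n / rho ^+ n.
have u_ex l : exists o, active l -> al n * rho ^+ l = inc o * (al l * rho ^+ n)
    /\ ((l < n)%N || (n' < l)%N -> res o = 0).
  have [act|nact] := boolp.pselect (active l); last by exists 0.
  have [far|nfar] := boolP ((l < n)%N || (n' < l)%N).
    by have [o ro oE] := Hlt l act far; exists o.
  by have [o oE] := Hle l act; exists o.
pose u l := projT1 (boolp.cid (u_ex l)).
have uP l : active l -> al n * rho ^+ l = inc (u l) * (al l * rho ^+ n)
    /\ ((l < n)%N || (n' < l)%N -> res (u l) = 0).
  by rewrite /u; case: boolp.cid => o /= H /H.
pose v l j := if boolp.asbool (active l) then bar (u l) ^+ w j * a l j else 0.
have red_v l j : redto (cst (c ^+ w j) * (cst (rho ^+ (l * w j)) * slice l j)) (v l j).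
  rewrite /v; case: boolp.asboolP => act; last first.
    apply/inF_redto/inFM/inFM; apply: boolp.contrapT => nj; apply: act; by exists j.
  have [uE _] := uP l act; have [_ Ha _] := aP l.
  have -> : cst (c ^+ w j) * (cst (rho ^+ (l * w j)) * slice l j) =
      cst (inc (u l)) ^+ w j * (cst (al l ^+ w j) * slice l j).
    rewrite !mulrA -!cstX -!cstM; congr (cst _ * _).
    rewrite exprM -!exprMn; congr (_ ^+ _).
    by apply: (mulIf rn); rewrite /c mulrAC mulfVK // uE mulrA.
  by apply: redtoM => //; apply/redtoX/redto_cst.
have v_far l j : (l < n)%N || (n' < l)%N -> v l j = 0.
  rewrite /v => far; case: boolp.asboolP => // act; have [_ /(_ far) ru] := uP l act.
  by rewrite /bar ru /cst mpolyC0 polyC0 rmorph0 expr0n eqn0Ngt w_gt0 mul0r.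
(* The reduced curve without its factor [theta ^ (n * w j)]: it joins [a n] to a weighted multiple
   of [a n']. *)
pose y j := \poly_(t < ((n' - n) * w j).+1) (if (w j %| t)%N then v (n + t %/ w j)%N j else 0).
pose yh j := ('X^n) ^+ w j * y j.
have red_y j : redpoly ((cst (c ^+ w j))%:P * rescale rho (Y (low j))) (yh j).
  move=> t; rewrite coefCM coef_rescale /yh -exprM coefXnM.
  have valE : redto (cst (c ^+ w j) * (cst (rho ^+ t) * (Y (low j))`_t))
      (if (w j %| t)%N then v (t %/ w j)%N j else 0).
    case: ifP => [/divnK tE|ndvd]; first by rewrite -{1 2}tE; exact: red_v.
    have [->|nz] := eqVneq (Y (low j))`_t 0; first by rewrite !mulr0; exact: redto0.
    by have [] := Y_supp nz; rewrite ndvd.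
  have wj := w_gt0 j.
  suff <- : (if (w j %| t)%N then v (t %/ w j)%N j else 0) =
    (if (t < n * w j)%N then 0 else (y j)`_(t - n * w j)) by [].
  case: ltnP => tn.
    case: ifP => // dvd; apply: v_far; rewrite ltn_divLR // tn //.
  rewrite /y coef_poly dvdn_subl ?dvdn_mull //.
  have -> : (n + (t - n * w j) %/ w j = t %/ w j)%N.
    by rewrite -{2}(subnKC tn) divnMDl.
  case: ltnP => // far; case: ifP => // dvd; apply: v_far; apply/orP; right.
  rewrite -(ltn_pmul2r wj) divnK //.
  by move: far; rewrite mulnBl; have := leq_mul nn' (leqnn (w j)); lia.
have Hform := formK_scale c rho Y_form.
have [|om Hom] := redpoly_integral _ Hform (y := yh).
  by move=> j; rewrite w6_low.
rewrite G_bar => /eqP; rewrite subr_eq0 => /eqP omE.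
have evE : ev yh f = 'X^(e * n) ^+ p * ev y f.
  rewrite /yh (ev_scale _ _ f_homog) -!exprM; congr ('X^_ * _); rewrite dE; lia.
have [om' om'E] : exists om', om = om' * 'X^(e * n).
  have : 'X^(e * n) ^+ p %| om ^+ p by rewrite omE evE dvdp_mulr.
  by rewrite dvdp_pexp2r // => /dvdpP.
have ycov : ev y f = om' ^+ p.
  have Xp0 : 'X^(e * n) ^+ p != 0 :> {poly L} by rewrite expf_neq0 // -size_poly_gt0 size_polyXn.
  apply: (mulfI Xp0); rewrite -evE -omE om'E exprMn mulrC //.
have ytop j : top ((n' - n) * w j) (y j) (v n' j).
  split; first exact: size_poly.
  by rewrite /y coef_poly ltnSn dvdn_mull // mulnK // subnKC.
have y0 j : (y j).[0] = a n j.
  rewrite horner_coef0 /y coef_poly /= dvdn0 div0n addn0 /v.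
  case: boolp.asboolP => // _; have [uE _] := uP n actn.
  have u1 : u n = 1.
    apply: inc_inj; rewrite rmorph1; apply: (mulIf (mulf_neq0 (al0 n) rn)).
    by rewrite -uE mul1r.
  by rewrite u1 /bar rmorph1 /cst mpolyC1 polyC1 rmorph1 expr1n mul1r.
have [_ _ /(_ actn)[j0 aj0]] := aP n.
have : null (v n').
  apply: (null_edge ytop ycov (j0 := j0)); first by rewrite y0.
  by rewrite (_ : (fun j => (y j).[0]) = a n) //; apply: boolp.funext.
have [uE _] := uP n' actn'.
have un' : bar (u n') != 0.
  by rewrite bar_eq0 //; exact: (vle_res res inc_inj (mulf_neq0 (al0 n') rn) uE Hn').
rewrite (_ : v n' = fun j => bar (u n') ^+ w j * a n' j); first exact: null_scale.
by apply: boolp.funext => j; rewrite /v; case: boolp.asboolP.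
Qed.

(* [A_0] is constant, hence null; walk along the Newton polygon from [0] to [N]. *)
Lemma newton_null : active 0 -> active N ->
  (forall b al', al' != 0 -> (forall j, redto (cst (al' ^+ w j) * slice 0 j) (b j)) -> null b) ->
  exists b al', [/\ al' != 0, forall j, redto (cst (al' ^+ w j) * slice N j) (b j),
    exists j, b j != 0 & null b].
Proof.
move=> act0 actN null0.
(* [n] is a vertex already reached, where the form vanishes: for some slope [s] it is the last index
   at which [s ^ l / al l] is largest. The starting index 0 has no slope. *)
pose P n := [/\ active n, null (a n) & n = 0%N \/ exists2 s, s != 0 &
  (forall l, active l -> (l < n)%N -> vle (al n * s ^+ l) (al l * s ^+ n)) /\
  (forall l, active l -> (n < l)%N -> vlt inc res (al n * s ^+ l) (al l * s ^+ n))].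
have P0 : P 0%N.
  split; [by [] | | by left].
  by have [al00 Ha _] := aP 0%N; apply: null0 Ha.
have exP : exists n, boolp.asbool (P n) by exists 0%N; apply/boolp.asboolP.
have leP n : boolp.asbool (P n) -> (n <= N)%N by move=> /boolp.asboolP[/active_le].
case: (ex_maxnP exP leP) => n /boolp.asboolP[actn nulln Hn] maxn.
have [nN|nN] := eqVneq n N.
  have [al0N Ha /(_ actN) nz] := aP N.
  by exists (a N), (al N); split=> //; rewrite -nN.
have ltnN : (n < N)%N by rewrite ltn_neqAle nN active_le.
(* The slopes from [n] to the later active indices; the smallest one belongs to the next edge. *)
have rho_ex l : exists x : K, (n < l)%N -> x ^+ (l - n) * al n = al l.
  have [nl|ln] := ltnP n l; last by exists 0.
  have nl0 : (0 < l - n)%N by rewrite subn_gt0.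
  have [x xE] := rootK (al l / al n) nl0.
  by exists x => _; rewrite xE mulfVK.
pose r l := projT1 (boolp.cid (rho_ex l)).
have rP l : (n < l)%N -> r l ^+ (l - n) * al n = al l.
  by rewrite /r; case: boolp.cid.
have r0 l : (n < l)%N -> r l != 0.
  move=> nl; have := al0 l; rewrite -(rP _ nl); apply: contraNneq => ->.
  by rewrite expr0n subn_eq0 leqNgt nl mul0r.
pose ls := [seq l <- iota 0 N.+1 | boolp.asbool (active l) && (n < l)%N].
have lsP l : (l \in ls) <-> active l /\ (n < l)%N.
  rewrite mem_filter mem_iota /=; split=> [/andP[/andP[/boolp.asboolP ? ?] _] //|[act nl]].
  by rewrite nl andbT ltnS active_le // andbT; apply/boolp.asboolP.
have ls0 : ls != [::].
  by have /lsP : active N /\ (n < N)%N by []; case: (ls).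
have [m0 /lsP[actm nm] min] := vle_max place_val (fun l => (r l)^-1) ls0.
set rho := r m0 in min.
have rho0 : rho != 0 by apply: r0.
have rho_le l : active l -> (n < l)%N -> vle rho (r l).
  move=> act nl; have [|o oE] := min l; first exact/lsP.
  exists o; apply: (mulIf (invr_neq0 (r0 _ nl))); rewrite mulfK ?r0 //.
  by rewrite oE mulrCA mulfV // mulr1.
have powE (x : K) i j : (i < j)%N -> x ^+ j = x ^+ (j - i) * x ^+ i.
  by move=> ij; rewrite -exprD subnK // ltnW.
have dom_up l : active l -> (n < l)%N -> vle (al n * rho ^+ l) (al l * rho ^+ n).
  move=> act nl; rewrite (powE rho _ _ nl) -(rP _ nl).
  have [o oE] := vleX (l - n) (rho_le _ act nl); exists o.
  by rewrite oE; ring.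
have m0_eq : vle (al m0 * rho ^+ n) (al n * rho ^+ m0).
  rewrite (powE rho _ _ nm) -(rP _ nm) -/rho.
  by exists 1; rewrite rmorph1; ring.
(* The slope increases strictly at [n], because [n] is the last maximum for the previous slope
   [s]. *)
have dom_down l : active l -> (l < n)%N -> vlt inc res (al n * rho ^+ l) (al l * rho ^+ n).
  move=> act ln; case: Hn => [n0|[s s0 [Hs1 Hs2]]]; first by rewrite n0 in ln.
  have [o ro oE] := Hs2 _ actm nm; have [o' o'E] := Hs1 _ act ln.
  have srho : vlt inc res s rho.
    have [rs|//] := vle_total place_val rho s; exfalso.
    have sn0 : s ^+ n != 0 by rewrite expf_neq0.
    apply: (vle_gtF (res := res) inc_inj (expf_neq0 (m0 - n) rho0) (vleX (m0 - n) rs)).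
    exists o => //; apply: (mulIf (mulf_neq0 (al0 n) sn0)).
    rewrite -/rho mulrA -mulrA (_ : inc o * rho ^+ (m0 - n) * (al n * s ^+ n)
      = inc o * (rho ^+ (m0 - n) * al n * s ^+ n)); last by ring.
    by rewrite (rP _ nm) -oE (powE s _ _ nm); ring.
  have [t rt sE] := srho.
  have t0 : inc t != 0 by apply: contraNneq s0 => t0; rewrite sE t0 mul0r.
  exists (o' * t ^+ (n - l)).
    by rewrite rmorphM rmorphXn rt expr0n subn_eq0 leqNgt ln mulr0.
  apply: (mulIf (expf_neq0 l t0)); rewrite -mulrA -exprMn [rho * _]mulrC -sE o'E.
  rewrite sE !exprMn rmorphM rmorphXn (powE (inc t) _ _ ln); ring.
(* The far end of the edge is the last index that still attains the maximum for [rho]. *)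
pose Q n' := [/\ active n', (n < n')%N & vle (al n' * rho ^+ n) (al n * rho ^+ n')].
have exQ : exists n', boolp.asbool (Q n') by exists m0; apply/boolp.asboolP.
have leQ n' : boolp.asbool (Q n') -> (n' <= N)%N by move=> /boolp.asboolP[/active_le].
case: (ex_maxnP exQ leQ) => n' /boolp.asboolP[actn' nn' Hn'] maxn'.
have dom_far l : active l -> (n' < l)%N -> vlt inc res (al n * rho ^+ l) (al l * rho ^+ n).
  move=> act nl; have [H|//] := vle_total place_val (al l * rho ^+ n) (al n * rho ^+ l).
  have /boolp.asboolP/maxn' : Q l by split=> //; apply: ltn_trans nl.
  by rewrite leqNgt nl.
have dom l : active l -> vle (al n * rho ^+ l) (al l * rho ^+ n).
  move=> act; have [ln|nl|->] := ltngtP l n; last exact: vle_refl.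
  - exact/vltW/dom_down.
  - exact: dom_up.
have nulln' : null (a n').
  apply: (edge_step rho0 (ltnW nn') actn dom _ Hn' actn' nulln).
  by move=> l act /orP[|]; [exact: dom_down | exact: dom_far].
have Pn' : P n'.
  split=> //; right; exists rho => //.
  have rn0 : rho ^+ n != 0 by rewrite expf_neq0.
  have [q qE] := Hn'.
  have trans l (y : O) : al n * rho ^+ l = inc y * (al l * rho ^+ n) ->
      al n' * rho ^+ l = inc (q * y) * (al l * rho ^+ n').
    move=> E1; apply: (mulIf (mulf_neq0 (al0 n) rn0)).
    have -> : al n' * rho ^+ l * (al n * rho ^+ n) = (al n' * rho ^+ n) * (al n * rho ^+ l) by ring.
    by rewrite qE E1 rmorphM; ring.
  split=> l act ll.
    by have [y yE] := dom _ act; exists (q * y); exact: trans.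
  have [y ry yE] := dom_far _ act ll; exists (q * y); first by rewrite rmorphM ry mulr0.
  exact: trans.
have /boolp.asboolP/maxn := Pn'.
by rewrite leqNgt nn'.
Qed.

End Gauss.

(** * Birational maps to projective space *)

HB.instance Definition _ (R : comNzRingType) :=
  GRing.RMorphism.copy (@cst R) (polyC \o @mpolyC 5 R).

Section Coordinates.
Variable R : comNzRingType.

Definition split6 (S : Type) (y : 'I_5 -> S) (z : S) (i : 'I_6) : S :=
  if insub (val i) is Some j then y j else z.

Lemma split6_low S (y : 'I_5 -> S) z j : split6 y z (low j) = y j.
Proof.
rewrite /split6 insubT //= => lj; congr y; exact: val_inj.
Qed.

Lemma split6_hi S (y : 'I_5 -> S) z : split6 y z hi6 = z.
Proof. by rewrite /split6 insubF. Qed.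

Lemma split6_ind (P : 'I_6 -> Prop) : (forall j, P (low j)) -> P hi6 -> forall i, P i.
Proof.
move=> Pl Ph i; have [i5|i5] := ltnP i 5.
  by rewrite (_ : i = low (Ordinal i5)) //; apply: val_inj.
rewrite (_ : i = hi6) //; apply: val_inj => /=.
by apply/eqP; rewrite eqn_leq -ltnS ltn_ord.
Qed.

(* The generic point of the affine cone over a hypersurface which is monic in the
   last coordinate. *)
Definition xw : 'I_6 -> {poly {mpoly R[5]}} := split6 (fun j => ('X_j)%:P) 'X.
Definition toT (P : {mpoly R[6]}) : {poly {mpoly R[5]}} := mmap (@cst R) xw P.
HB.instance Definition _ := GRing.RMorphism.copy toT (mmap (@cst R) xw).
End Coordinates.

Lemma mmap_map_mpoly (R S A : comNzRingType) (psi : {rmorphism R -> S})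
    (phi : {rmorphism S -> A}) n (v : 'I_n -> A) (P : {mpoly R[n]}) :
  mmap phi v (map_mpoly psi P) = \sum_(m <- msupp P) phi (psi P@_m) * \prod_i v i ^+ m i.
Proof.
have -> : map_mpoly psi P = \sum_(m <- msupp P) psi P@_m *: 'X_[m].
  rewrite {1}[P]mpolyE raddf_sum; apply: eq_bigr => m _ /=.
  by rewrite map_mpolyZ map_mpolyX.
rewrite raddf_sum; apply: eq_bigr => m _ /=.
by rewrite mmapZ mmapX.
Qed.

Lemma mmap_comp_rmorph (R A B : comNzRingType) (phi : {rmorphism R -> A})
    (h : {rmorphism A -> B}) n (v : 'I_n -> A) (P : {mpoly R[n]}) :
  h (mmap phi v P) = mmap (h \o phi) (h \o v) P.
Proof.
rewrite [LHS]rmorph_sum; apply: eq_bigr => m _ /=; rewrite rmorphM /=; congr (_ * _).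
by rewrite rmorph_prod; apply: eq_bigr => i _; rewrite rmorphXn.
Qed.

Lemma rmorph_mmap_int (A B : comNzRingType) (h : {rmorphism A -> B}) n (v : 'I_n -> A)
    (P : {mpoly int[n]}) :
  h (mmap (intmul 1) v P) = mmap (intmul 1) (h \o v) P.
Proof.
rewrite [LHS]rmorph_sum; apply: eq_bigr => m _ /=; rewrite rmorphM rmorph_int /=.
congr (_ * _); rewrite rmorph_prod; apply: eq_bigr => i _; rewrite rmorphXn //.
Qed.

Lemma top_mmap (R S : comNzRingType) (phi : {rmorphism R -> S}) n d
    (P : {mpoly R[n]}) (y : 'I_n -> {poly S}) (b : 'I_n -> S) :
  whomog (fun=> 1%N) d P -> (forall i, top 1 (y i) (b i)) ->
  top d (mmap (polyC \o phi) y P) (mmap phi b P).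
Proof.
move=> hP Hy; apply: top_sum => m mP; rewrite -[X in top X]add0n; apply: topM.
  exact: topC.
rewrite -(hP m mP); apply: top_prod => i; rewrite mulnC; exact: topX.
Qed.

Lemma eq_mmap (R S : nzRingType) n (h h' : R -> S) (v v' : 'I_n -> S) (P : {mpoly R[n]}) :
  h =1 h' -> v =1 v' -> mmap h v P = mmap h' v' P.
Proof.
move=> hE vE; apply: eq_bigr => m _; rewrite hE; congr (_ * _).
by apply: eq_bigr => i _; rewrite vE.
Qed.

Lemma coef_muni (R : nzRingType) n (P : {mpoly R[n.+1]}) (m : 'X_{1..n.+1}) :
  (muni P)`_(m ord_max)@_[multinom m (widen_ord (leqnSn n) i) | i < n] = P@_m.
Proof.
rewrite muniE coef_sum raddf_sum /=.
pose c m' : R := if m' == m then P@_m' else 0.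
rewrite (eq_bigr c) => [|m' _].
  have [mP|mP] := boolP (m \in msupp P).
    rewrite (bigD1_seq m) ?msupp_uniq //= /c eqxx big1 ?addr0 // => m' /negPf -> //.
  rewrite (memN_msupp_eq0 mP) big_seq big1 // => m' m'P; rewrite /c.
  by case: eqP => // m'E; rewrite -m'E m'P in mP.
rewrite coefZ coefXn /c; have [->|mm'] := eqVneq m' m.
  by rewrite eqxx mulr1 mcoeffZ mcoeffX eqxx mulr1.
case: eqP => [ml|_]; last by rewrite mulr0 mcoeff0.
rewrite mulr1 mcoeffZ mcoeffX; case: eqP => [E|_]; last by rewrite mulr0.
case/eqP: mm'; apply/mnmP => i; case: (unliftP ord_max i) => [j ->|->] //.
have /mnmP/(_ j) := E; rewrite !mnmE.
by rewrite (_ : widen_ord _ j = lift ord_max j) //; apply/val_inj; rewrite /= /bump leqNgt ltn_ord.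
Qed.

Lemma mpoly_nonroot (K : closedFieldType) n (P : {mpoly K[n]}) :
  P != 0 -> exists v, P.@[v] != 0.
Proof.
elim: n P => [|n IHn] P P0.
  exists (fun=> 0); apply: contraNneq P0 => P0; apply/eqP/mpolyP => m.
  have mE (m' : 'X_{1..0}) : m' = 0%MM by apply/mnmP => -[].
  rewrite mcoeff0 (mE m) -[RHS]P0 mevalE.
  rewrite (eq_bigr (fun m' => P@_m')) => [|m' _]; last by rewrite big_ord0 mulr1.
  have [Pm|Pm] := boolP (0%MM \in msupp P).
    rewrite (bigD1_seq 0%MM) ?msupp_uniq //= big1 ?addr0 // => m'.
    by rewrite (mE m') eqxx.
  rewrite (memN_msupp_eq0 Pm) big_seq big1 // => m'.
  by rewrite (mE m') (negPf Pm).
have uP0 : muni P != 0.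
  apply: contraNneq P0 => uP0; apply/eqP/mpolyP => m.
  by rewrite -coef_muni uP0 coef0 !mcoeff0.
have [|v' Pv'] := IHn (lead_coef (muni P)); first by rewrite lead_coef_eq0.
have : map_poly (meval v') (muni P) != 0.
  apply: contraNneq Pv' => /(congr1 (fun q : {poly K} => q`_(size (muni P)).-1)).
  by rewrite coef_map coef0 => ->.
case/closed_nonrootP => t; rewrite /root => Pt.
exists (fun i => if unlift ord_max i is Some j then v' j else t).
apply: contraNneq Pt => E; apply/eqP; rewrite -[RHS]E muniE raddf_sum horner_sum mevalE.
apply: eq_bigr => m _ /=; rewrite map_polyZ hornerZ /= mevalZ mevalX map_polyXn hornerXn.
rewrite -mulrA; congr (_ * _); rewrite [RHS]big_ord_recr /= unlift_none; congr (_ * _).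
apply: eq_bigr => j _; rewrite mnmE.
by rewrite (_ : widen_ord _ j = lift ord_max j) ?liftK //; apply/val_inj; rewrite /= /bump leqNgt ltn_ord.
Qed.

Section Homogeneous.
Variables (R : nzRingType) (n : nat) (w : 'I_n -> nat).

Lemma whomogM d d' (P Q : {mpoly R[n]}) :
  whomog w d P -> whomog w d' Q -> whomog w (d + d') (P * Q).
Proof.
move=> hP hQ m /msuppM_le/allpairsP[[m1 m2] [/= /hP <- /hQ <- ->]].
by rewrite -big_split /=; apply: eq_bigr => i _; rewrite mnmDE mulnDr.
Qed.

Lemma whomogC c : whomog w 0 (c%:MP : {mpoly R[n]}).
Proof.
move=> m; rewrite msuppC; case: ifP => // _; rewrite inE => /eqP ->.
by rewrite big1 // => i _; rewrite mnm0E muln0.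
Qed.

Lemma whomog1 : whomog w 0 (1 : {mpoly R[n]}).
Proof. by rewrite -mpolyC1; exact: whomogC. Qed.

Lemma whomog_monomial (m : 'X_{1..n}) : whomog w (\sum_i w i * m i) ('X_[m] : {mpoly R[n]}).
Proof. by move=> m'; rewrite msuppX inE => /eqP ->. Qed.

Lemma whomogXU i : whomog w (w i) ('X_i : {mpoly R[n]}).
Proof.
move=> m; rewrite msuppX inE => /eqP ->.
rewrite (bigD1 i) //= mnm1E eqxx muln1 big1 ?addn0 // => j ij.
by rewrite mnm1E eq_sym (negPf ij) muln0.
Qed.

Lemma whomogX d k (P : {mpoly R[n]}) : whomog w d P -> whomog w (k * d) (P ^+ k).
Proof.
move=> hP; elim: k => [|k IHk]; first by rewrite expr0; exact: whomog1.
by rewrite exprS mulSn; exact: whomogM.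
Qed.

Lemma whomogD d (P Q : {mpoly R[n]}) : whomog w d P -> whomog w d Q -> whomog w d (P + Q).
Proof. by move=> hP hQ m /msuppD_le; rewrite mem_cat => /orP[/hP|/hQ]. Qed.

Lemma whomogN d (P : {mpoly R[n]}) : whomog w d P -> whomog w d (- P).
Proof. by move=> hP m; rewrite (perm_mem (msuppN _)); exact: hP. Qed.

Lemma whomog_sum d (J : eqType) (r : seq J) (P : J -> {mpoly R[n]}) :
  (forall j, j \in r -> whomog w d (P j)) -> whomog w d (\sum_(j <- r) P j).
Proof.
elim: r => [|j r IHr] H; first by rewrite big_nil => m; rewrite msupp0.
rewrite big_cons; apply: whomogD; first by apply: H; rewrite mem_head.
by apply: IHr => i ir; apply: H; rewrite inE ir orbT.
Qed.

End Homogeneous.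

Lemma whomog_prod (R : nzRingType) n (w : 'I_n -> nat) (J : Type) (r : seq J) (A : pred J)
    (d : J -> nat) (P : J -> {mpoly R[n]}) : (forall j, whomog w (d j) (P j)) ->
  whomog w (\sum_(j <- r | A j) d j) (\prod_(j <- r | A j) P j).
Proof.
move=> H; elim/big_rec2: _ => [|j x P' _ IH]; first exact: whomog1.
exact: whomogM.
Qed.

Lemma whomog_meval (R : comNzRingType) n (w : 'I_n -> nat) d (P : {mpoly R[n]}) mu v :
  whomog w d P -> P.@[fun i => mu ^+ w i * v i] = mu ^+ d * P.@[v].
Proof.
move=> hP; rewrite !mevalE big_distrr; apply: eq_big_seq => m mP /=.
rewrite mulrCA; congr (_ * _); rewrite -(hP m mP) -prodrXr -big_split.
by apply: eq_bigr => i _; rewrite exprMn exprM.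
Qed.

Lemma mevalXn (R : comNzRingType) n (v : 'I_n -> R) (P : {mpoly R[n]}) k :
  (P ^+ k).@[v] = P.@[v] ^+ k.
Proof. exact: (rmorphXn (meval v)). Qed.

Lemma meval_mmap (R : comNzRingType) m n (v : 'I_n -> R) (y : 'I_m -> {mpoly R[n]})
    (P : {mpoly R[m]}) :
  (mmap (@mpolyC n R) y P).@[v] = P.@[fun i => (y i).@[v]].
Proof.
rewrite -[LHS]/(meval v _) mmap_comp_rmorph.
by apply: eq_mmap => // c; exact: mevalC.
Qed.

(** * Open sets and regular functions in homogeneous coordinates *)

Section Opens.
Variables (K : closedFieldType) (P : Defs.space).
Local Notation vec := ('I_(nv P) -> K).
Local Notation form := {mpoly K[nv P]}.

(** Weights that count a single block: multihomogeneity becomes weighted homogeneity for each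
    block. *)
Let bw (j : 'I_(nb P)) i := if blk i == j then wt i else 0%N.

Lemma mhomogP D (p : form) : mhomog D p <-> forall j, whomog (bw j) (D j) p.
Proof.
have E (m : 'X_{1..nv P}) j : (\sum_(i | blk i == j) wt i * m i = \sum_i bw j i * m i)%N.
  by rewrite big_mkcond; apply: eq_bigr => i _; rewrite /bw; case: ifP.
by split=> [H j m mp|H m mp j]; [rewrite -E | rewrite E]; apply: H.
Qed.

Lemma mhomogM D D' (p q : form) :
  mhomog D p -> mhomog D' q -> mhomog (fun j => D j + D' j)%N (p * q).
Proof. by move=> /mhomogP Hp /mhomogP Hq; apply/mhomogP => j; apply: whomogM. Qed.

Lemma mhomog_prod (J : Type) (r : seq J) (A : pred J) D (p : J -> form) :
  (forall j, mhomog (D j) (p j)) ->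
  mhomog (fun b => \sum_(j <- r | A j) D j b)%N (\prod_(j <- r | A j) p j).
Proof.
move=> H; apply/mhomogP => b; apply: (whomog_prod (d := D^~ b)) => j.
by have /mhomogP := H j.
Qed.

Lemma mhomogXU i : mhomog (bw^~ i) ('X_i : form).
Proof. by apply/mhomogP => j; exact: whomogXU. Qed.

Lemma mhomogXUX i k : mhomog (fun j => k * bw j i)%N ('X_i ^+ k : form).
Proof. by apply/mhomogP => j; exact/whomogX/whomogXU. Qed.

Lemma zopen_basic (X W : vec -> Prop) x : zopen X W -> W x -> ispt x ->
  exists D s, [/\ mhomog D s, s.@[x] != 0 & forall v, X v -> s.@[v] != 0 -> W v].
Proof.
move=> [Z [S Shom ZE] WE] /WE[Xx nZx] ptx.
have [s [Ss sx]] : exists s, S s /\ s.@[x] != 0.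
  apply: boolp.contrapT => H; apply/nZx/ZE; split=> // s Ss.
  by apply: boolp.contrapT => /eqP sx; apply: H; exists s.
have [D Ds] := Shom s Ss; exists D, s; split=> // v Xv sv.
by apply/WE; split=> // /ZE[_ /(_ s Ss)/eqP]; apply/negP.
Qed.

Lemma zopen_nonzero (X U : vec -> Prop) D h : zopen X U -> (forall v, X v -> ispt v) ->
  mhomog D h -> zopen X (fun v => U v /\ h.@[v] != 0).
Proof.
move=> [Z [S Shom ZE] UE] Xpt hh.
exists (fun v => ispt v /\ forall q, S q -> (h * q).@[v] = 0).
  exists (fun p => exists2 q, S q & p = h * q).
    by move=> _ [q /Shom[D' hq] ->]; exists (fun j => D j + D' j)%N; exact: mhomogM.
  move=> v; split=> -[ptv H]; split=> //; first by move=> _ [q Sq ->]; exact: H.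
  by move=> q Sq; apply: H; exists q.
move=> v; split=> [[/UE[Xv nZ] hv]|[Xv nZ]].
  split=> // -[ptv H]; apply/nZ/ZE; split=> // q /H/eqP.
  by rewrite mevalM mulf_eq0 (negPf hv) => /eqP.
have ptv := Xpt v Xv; split.
  apply/UE; split=> // /ZE[_ H]; apply: nZ; split=> // q /H q0.
  by rewrite mevalM q0 mulr0.
by apply/eqP => h0; apply: nZ; split=> // q _; rewrite mevalM h0 mul0r.
Qed.

Lemma regular_ratio (X U : vec -> Prop) D G H : zopen X U -> mhomog D G -> mhomog D H ->
  (forall v, U v -> H.@[v] != 0) -> regular_fun X U (fun v => G.@[v] / H.@[v]).
Proof. by move=> oU hG hH H0 x Ux; exists U, D, G, H; split=> // y /H0. Qed.

(** The local fractions are brought to a common denominator and their neighbourhoods shrunk to the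
    nonvanishing of one form [s], so that the coordinates of a morphism become polynomials. *)
Lemma regular_common n (X U : vec -> Prop) (f : 'I_n -> vec -> K) x :
  (forall j, regular_fun X U (f j)) -> (forall v, U v -> X v) -> U x -> ispt x ->
  exists D G H D' s, [/\ forall j, mhomog D (G j), mhomog D H, mhomog D' s, s.@[x] != 0 &
    forall y, U y -> s.@[y] != 0 ->
      H.@[y] != 0 /\ forall j, f j y = (G j).@[y] / H.@[y]].
Proof.
move=> fr UX Ux ptx.
have /boolp.choice[t tP] j : exists t : ('I_(nb P) -> nat) * form * form * (('I_(nb P) -> nat) * form),
    [/\ mhomog t.1.1.1 t.1.1.2, mhomog t.1.1.1 t.1.2, mhomog t.2.1 t.2.2, t.2.2.@[x] != 0 &
      forall y, U y -> t.2.2.@[y] != 0 ->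
        t.1.2.@[y] != 0 /\ f j y = t.1.1.2.@[y] / t.1.2.@[y]].
  have [W [D [G [H [oW Wx hG hH fE]]]]] := fr j x Ux.
  have [D' [s [hs sx sW]]] := zopen_basic oW Wx ptx.
  exists (D, G, H, (D', s)); split=> //= y Uy sy.
  by apply: fE => //; apply: sW => //; exact: UX.
pose D b := (\sum_j (t j).1.1.1 b)%N.
pose H := \prod_j (t j).1.2; pose s := \prod_j (t j).2.2.
pose G j := (t j).1.1.2 * \prod_(i | i != j) (t i).1.2.
exists D, G, H, (fun b => \sum_j (t j).2.1 b)%N, s; split.
- move=> j; have -> : D = (fun b => (t j).1.1.1 b + \sum_(i | i != j) (t i).1.1.1 b)%N.
    by apply: boolp.funext => b; rewrite /D (bigD1 j).
  by apply: mhomogM; [have [] := tP j | apply: mhomog_prod => i; have [] := tP i].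
- by apply: mhomog_prod => i; have [] := tP i.
- by apply: mhomog_prod => i; have [] := tP i.
- by rewrite rmorph_prod; apply/prodf_neq0 => j _; have [] := tP j.
move=> y Uy; rewrite rmorph_prod => /prodf_neq0 sy.
have H0 j : (t j).1.2.@[y] != 0 by have [_ _ _ _ /(_ y Uy (sy j isT))[]] := tP j.
split=> [|j]; first by rewrite rmorph_prod; apply/prodf_neq0 => i _; exact: H0.
have [_ _ _ _ /(_ y Uy (sy j isT))[_ ->]] := tP j.
have R0 : (\prod_(i | i != j) (t i).1.2).@[y] != 0.
  by rewrite rmorph_prod; apply/prodf_neq0 => i _; exact: H0.
have -> : H = (t j).1.2 * \prod_(i | i != j) (t i).1.2 by rewrite /H (bigD1 j).
by rewrite /G !mevalM -mulf_div divff // mulr1.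
Qed.

End Opens.

Arguments mhomogXU {K P} i.
Arguments mhomogXUX {K P} i k.

Lemma split_lshift m n (i : 'I_m) : split (lshift n i) = inl i.
Proof. exact: (unsplitK (inl i)). Qed.

Lemma split_rshift m n (i : 'I_n) : split (rshift m i) = inr i.
Proof. exact: (unsplitK (inr i)). Qed.

Lemma ispt_prod (K : closedFieldType) (P Q : Defs.space) (v : 'I_(nv (prod_space P Q)) -> K) :
  ispt (fun i : 'I_(nv P) => v (lshift (nv Q) i)) ->
  ispt (fun i : 'I_(nv Q) => v (rshift (nv P) i)) -> ispt v.
Proof.
move=> vP vQ j; rewrite -(splitK j); case: (split j) => [jP|jQ].
  by have [i <- vi] := vP jP; exists (lshift (nv Q) i); rewrite //= split_lshift.
by have [i <- vi] := vQ jQ; exists (rshift (nv P) i); rewrite //= split_rshift.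
Qed.

(** * Retractions from a projective space *)

Section Retract.
Variables (K : closedFieldType) (N : nat) (a : 'I_N -> nat) (i0 : 'I_N) (d : nat).
Variable F : {mpoly K[N]}.
Hypothesis a_gt0 : forall i, (0 < a i)%N.
Hypothesis a_i0 : a i0 = 1%N.
Hypothesis F_homog : whomog a d F.

Definition vanishes (E : {mpoly K[N]}) := forall v, F.@[v] = 0 -> E.@[v] = 0.

Hypothesis cone_irr : forall E1 E2, vanishes (E1 * E2) -> vanishes E1 \/ vanishes E2.
Hypothesis cone_X : ~ vanishes 'X_i0.

Definition cone : ('I_(nv (wproj a)) -> K) -> Prop := fun v => ispt v /\ F.@[v] = 0.

Let nonvanishing E : ~ vanishes E -> exists2 v, F.@[v] = 0 & E.@[v] != 0.
Proof.
move=> nE; apply: boolp.contrapT => H; apply: nE => v Fv.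
by apply: boolp.contrapT => /eqP Ev; apply: H; exists v.
Qed.

Let generic E1 E2 x : vanishes (E1 * E2) -> F.@[x] = 0 -> E2.@[x] != 0 -> vanishes E1.
Proof. by move=> /cone_irr[//|V2] Fx; rewrite (V2 x Fx) eqxx. Qed.

Variable k : nat.

Let pair (x : 'I_N -> K) (q : 'I_k.+1 -> K) : 'I_(nv (prod_space (wproj a) (proj k))) -> K :=
  fun i => match split i with inl j => x j | inr l => q l end.

Let fiber (q : 'I_k.+1 -> K) (s : {mpoly K[nv (prod_space (wproj a) (proj k))]}) : {mpoly K[N]} :=
  mmap (@mpolyC N K)
    (fun i => match split i with inl j => 'X_j | inr l => (q l)%:MP end) s.

Let fiberE q s x : (fiber q s).@[x] = s.@[pair x q].
Proof.
rewrite meval_mmap; apply: meval_eq => i; rewrite /pair.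
by case: (split i) => [j|l]; rewrite ?mevalXU ?mevalC.
Qed.

Let pairl x q i : pair x q (lshift k.+1 i) = x i.
Proof. by rewrite /pair split_lshift. Qed.

Let X := prod_set cone (@ispt K (proj k)).

Let X_pair x q : F.@[x] = 0 -> x i0 != 0 -> @ispt K (proj k) q -> X (pair x q).
Proof.
move=> Fx x0 qpt; split.
  rewrite (_ : (fun i => _) = x); last by apply: boolp.funext => i; exact: pairl.
  by split=> // j; exists i0; rewrite // [j]ord1.
rewrite (_ : (fun i => _) = q) //; apply: boolp.funext => i.
by rewrite /pair split_rshift.
Qed.

Let X_ispt v : X v -> ispt v.
Proof. by case=> -[? _] ?; exact: ispt_prod. Qed.

(** [Y] comes from the inverse birational map, and [A] from the direct one restricted to the slice
    over one point of the second factor. The form [beta] appears because coordinates are recovered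
    only up to the weighted action. *)
Lemma rational_parametrization : is_rational X ->
  exists n Delta (A : 'I_n -> {mpoly K[N]}) (Y : 'I_N -> {mpoly K[n]}) v0 beta,
  [/\ forall i, whomog (fun=> 1%N) (Delta * a i) (Y i),
      mmap (@mpolyC n K) Y F = 0,
      (Y i0).@[v0] != 0,
      forall i, vanishes (mmap (@mpolyC N K) A (Y i) - beta ^+ a i * 'X_i)
    & ~ vanishes beta].
Proof.
move=> [n [U [V [phi [psi [[oU [u0 Uu0]] [oV _] [mphi mpsi] psiK _]]]]]].
have [Z _ UE] := oU; have UX u : U u -> X u by move=> /UE[].
have [Z' _ VE] := oV; have Vpt v : V v -> ispt v by move=> /VE[].
have [_ [s [_ su0 sU]]] := zopen_basic oU Uu0 (X_ispt (UX _ Uu0)).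
pose x0 i := u0 (lshift k.+1 i); pose q0 l := u0 (rshift N l).
have [[_ Fx0] q0pt] := UX _ Uu0.
have u0E : pair x0 q0 = u0.
  apply: boolp.funext => i; rewrite /pair -[in RHS](splitK i).
  by case: (split i).
(* The given point may have [x i0 = 0]; irreducibility of the cone provides another one in the slice
   over [q0]. *)
have [x1 Fx1] : exists2 x, F.@[x] = 0 & (fiber q0 s * 'X_i0).@[x] != 0.
  apply: nonvanishing => /cone_irr[/(_ _ Fx0)/eqP|//].
  by rewrite fiberE u0E (negPf su0).
rewrite mevalM mevalXU mulf_eq0 negb_or fiberE => /andP[sx1 x10].
pose u1 := pair x1 q0.
have Xu1 : X u1 by exact: X_pair.
have Uu1 : U u1 by exact: sU.
have [phiV _ _ _] := mphi; have [psiU _ _ _] := mpsi.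
have Vv1 := phiV _ Uu1; set v1 := phi u1 in Vv1.
have [l0 _ v10] := Vpt _ Vv1 ord0.
have Uu1psi : samept (psi v1) u1 by exact: psiK.
pose L i : 'I_(nv (prod_space (wproj a) (proj k))) := lshift k.+1 i.
have wtL i : wt (L i) = a i by rewrite /= split_lshift.
have blkL i : blk (L i) = blk (L i0) by rewrite /= !split_lshift.
(* Affine coordinates on the chart [x i0 != 0]: these quotients have weight 0 because [i0] has
   weight 1. *)
pose f i (u : 'I_(nv (prod_space (wproj a) (proj k))) -> K) := u (L i) / u (L i0) ^+ a i.
have f_inv u u' i : samept u u' -> f i u' = f i u.
  move=> [t t0 u'E]; rewrite /f !u'E !wtL blkL a_i0 expr1 exprMn -mulf_div divff ?mul1r //.
  by rewrite expf_neq0.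
have L0_inv (u u' : 'I_(nv (prod_space (wproj a) (proj k))) -> K) : samept u u' -> u' (L i0) != 0 -> u (L i0) != 0.
  by move=> [t t0 ->]; rewrite mulf_eq0 negb_or => /andP[].
pose U' u := U u /\ ('X_(L i0) : {mpoly K[_]}).@[u] != 0.
have oU' : zopen X U' by exact: zopen_nonzero oU X_ispt (mhomogXU (L i0)).
have U'E u : U u -> u (L i0) != 0 -> U' u by move=> Uu u0i; split; rewrite ?mevalXU.
have fr i : regular_fun X U' (f i).
  rewrite (_ : f i = fun u => ('X_(L i) : {mpoly K[_]}).@[u] / ('X_(L i0) ^+ a i : {mpoly K[_]}).@[u]); last first.
    by apply: boolp.funext => u; rewrite mevalXn !mevalXU.
  apply: (regular_ratio oU' (mhomogXU _) _) => [|u [_ u0i]].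
    rewrite (_ : (fun j => _) = fun j => (a i * (if blk (L i0) == j then wt (L i0) else 0))%N).
      exact: mhomogXUX.
    by apply: boolp.funext => j; rewrite blkL !wtL a_i0; case: ifP; rewrite ?muln1 ?muln0.
  by rewrite mevalXn expf_neq0.
have [_ _ mpsi3 mpsi4] := mpsi; have [_ _ mphi3 mphi4] := mphi.
have U'U u : U' u -> U u by case.
have oV' := mpsi3 _ oU' U'U; have fV i := mpsi4 _ _ oU' U'U (fr i).
have V'v1 : V v1 /\ U' (psi v1).
  split=> //; apply: U'E; first exact: psiU.
  by apply: (L0_inv _ _ Uu1psi); rewrite /u1 /L pairl.
have [D1 [G1 [H1 [D1' [s1 [hG1 hH1 hs1 s1v E1]]]]]] :=
  regular_common fV (fun v => fun Vv : V v /\ U' (psi v) => Vpt v Vv.1) V'v1 (Vpt _ Vv1).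
have [D3 [s3 [_ s3v V'3]]] := zopen_basic oV' V'v1 (Vpt _ Vv1).
have hom_proj D (P : {mpoly K[n.+1]}) : @mhomog K (proj n) D P -> whomog (fun=> 1%N) (D ord0) P.
  by move=> /mhomogP/(_ ord0).
(* The additional factor ['X_l0] makes the degree positive. The power [Delta * a i] of [x i0], which
   the factor ['X_i0] of [A] contributes, then clears the denominator [x i0 ^+ a i] and leaves the
   exponent [D1 ord0] in [beta]. *)
pose Delta := (D1 ord0).+1.
pose Hh : {mpoly K[n.+1]} := 'X_l0 * H1; pose Gh i : {mpoly K[n.+1]} := 'X_l0 * G1 i.
have hHh : whomog (fun=> 1%N) Delta Hh.
  exact: whomogM (@whomogXU K _ (fun=> 1%N) l0) (hom_proj _ _ hH1).
have hGh i : whomog (fun=> 1%N) Delta (Gh i).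
  exact: whomogM (@whomogXU K _ (fun=> 1%N) l0) (hom_proj _ _ (hG1 i)).
pose Y i := Gh i * Hh ^+ (a i).-1.
have hY i : whomog (fun=> 1%N) (Delta * a i) (Y i).
  by rewrite -(prednK (a_gt0 i)) mulnS mulnC; apply/whomogM/whomogX.
have YE v i : V v /\ U' (psi v) -> s1.@[v] != 0 -> v l0 != 0 ->
    Hh.@[v] != 0 /\ (Y i).@[v] = Hh.@[v] ^+ a i * f i (psi v).
  move=> V'v sv vl; have [H10 ->] := E1 v V'v sv.
  have Hh0 : Hh.@[v] != 0 by rewrite mevalM mevalXU mulf_neq0.
  split=> //; rewrite -(prednK (a_gt0 i)) exprS mevalM mevalXn mulrAC; congr (_ * _).
  by rewrite !mevalM !mevalXU -mulrA [H1.@[v] * _]mulrC mulfVK.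
have FY : mmap (@mpolyC n.+1 K) Y F = 0.
  set P := mmap _ _ _.
  (* Multiplied by forms that vanish where the inverse map is not under control, [F(Y)] is zero at
     every point; these forms are not zero, so [F(Y)] is the zero polynomial. *)
  have H v : (P * (s3 * s1 * 'X_l0)).@[v] = 0.
    rewrite !mevalM mevalXU; have [->|vl] := eqVneq (v l0) 0; first by rewrite !mulr0.
    have [->|s30] := eqVneq s3.@[v] 0; first by rewrite !mul0r mulr0.
    have [->|s10] := eqVneq s1.@[v] 0; first by rewrite mulr0 mul0r mulr0.
    have V'v : V v /\ U' (psi v).
      by apply: V'3 => // j; exists l0; rewrite // [j]ord1.
    have [Vv [Upv]] := V'v; rewrite mevalXU => pv0.
    rewrite meval_mmap (meval_eq (v2 := fun i => (Hh.@[v] / psi v (L i0)) ^+ a i * psi v (L i))).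
      rewrite (whomog_meval _ _ F_homog).
      have [[_ /= ->] _] := UX _ Upv.
      by rewrite mulr0 mul0r.
    by move=> i; have [_ ->] := YE v i V'v s10 vl; rewrite expr_div_n /f; ring.
  have [Q0|/mpoly_nonroot[v]] := eqVneq (P * (s3 * s1 * 'X_l0)) 0; last by rewrite H eqxx.
  move/eqP: Q0; rewrite mulf_eq0 => /orP[/eqP //|/eqP Q0].
  have : (s3 * s1 * 'X_l0).@[v1] != 0 by rewrite !mevalM mevalXU !mulf_neq0.
  by rewrite Q0 meval0 eqxx.
pose V2 v := V v /\ ('X_l0 * s1 : {mpoly K[nv (proj n)]}).@[v] != 0.
have oV2 : zopen (@ispt K (proj n)) V2.
  apply: (zopen_nonzero oV) => //; exact: mhomogM (mhomogXU _) hs1.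
have V2V v : V2 v -> V v by case.
have V2E v : V2 v <-> [/\ V v, v l0 != 0 & s1.@[v] != 0].
  rewrite /V2 mevalM mevalXU mulf_eq0 negb_or; split=> [[? /andP[]] //|[? ? ?]].
  by split=> //; apply/andP.
pose g l (v : 'I_(nv (proj n)) -> K) := v l / v l0.
have gr l : regular_fun (@ispt K (proj n)) V2 (g l).
  rewrite (_ : g l = fun v => ('X_l : {mpoly K[nv (proj n)]}).@[v] / ('X_l0 : {mpoly K[nv (proj n)]}).@[v]); last first.
    by apply: boolp.funext => v; rewrite !mevalXU.
  apply: (regular_ratio oV2 (mhomogXU l)) => [|v /V2E[]]; last by rewrite mevalXU.
  exact: mhomogXU.
have gU l := mphi4 _ _ oV2 V2V (gr l).
have W1 : U u1 /\ V2 (phi u1) by split=> //; apply/V2E.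
have [D4 [s4 [_ s4u U4]]] := zopen_basic (mphi3 _ oV2 V2V) W1 (X_ispt Xu1).
have [D2 [G2 [H2 [D2' [s2 [_ _ _ s2u E2]]]]]] :=
  regular_common gU (fun u => fun Wu : U u /\ V2 (phi u) => UX u Wu.1) W1 (X_ispt Xu1).
pose A' l := fiber q0 (G2 l); pose A l := 'X_i0 * A' l.
pose B := mmap (@mpolyC N K) A' Hh; pose beta := 'X_i0 ^+ D1 ord0 * B.
have phiE x : F.@[x] = 0 -> x i0 != 0 -> s4.@[pair x q0] != 0 -> s2.@[pair x q0] != 0 ->
   B.@[x] != 0 /\ forall i, (Y i).@[fun l => (A' l).@[x]] = B.@[x] ^+ a i * (x i / x i0 ^+ a i).
  move=> Fx xi s4x s2x; have Xu := X_pair Fx xi q0pt.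
  have Wu : U (pair x q0) /\ V2 (phi (pair x q0)) by exact: U4.
  have [Uu /V2E[Vv vl sv]] := Wu.
  have [H20 phiG] := E2 _ Wu s2x; set v := phi (pair x q0) in Vv vl sv phiG.
  have same : samept (psi v) (pair x q0) by exact: psiK.
  have V'v : V v /\ U' (psi v).
    split=> //; apply: U'E; first exact: psiU.
    by apply: (L0_inv _ _ same); rewrite /L pairl.
  (* The representative chosen by [phi] differs from the polynomial one by this scalar. *)
  pose la := v l0 / H2.@[pair x q0].
  have la0 : la != 0 by rewrite mulf_neq0 ?invr_neq0.
  have vE : v =1 fun l => la ^+ 1 * (A' l).@[x].
    move=> l; rewrite fiberE expr1 /la mulrAC -mulrA -phiG mulrC mulfVK //.
  have evE P Dp : whomog (fun=> 1%N) Dp P -> P.@[v] = la ^+ Dp * P.@[fun l => (A' l).@[x]].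
    by move=> hP; rewrite (meval_eq _ vE) (whomog_meval _ _ hP).
  have BE : B.@[x] = Hh.@[fun l => (A' l).@[x]] by rewrite meval_mmap.
  have Hh0 : Hh.@[v] != 0 by have [] := YE v i0 V'v sv vl.
  split=> [|i]; first by move: Hh0; rewrite (evE _ _ hHh) -BE mulf_eq0 negb_or => /andP[].
  have laD : la ^+ (Delta * a i) != 0 by rewrite expf_neq0.
  apply: (mulfI laD); rewrite -(evE _ _ (hY i)); have [_ ->] := YE v i V'v sv vl.
  rewrite (evE _ _ hHh) -BE exprMn -exprM -mulrA; congr (_ * (_ * _)).
  by rewrite -(f_inv _ _ _ same) /f /L !pairl.
exists n.+1, Delta, A, Y, v1, beta; split=> //.
- have [Hh0 ->] := YE v1 i0 V'v1 s1v v10; rewrite mulf_neq0 ?expf_neq0 //.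
  rewrite -(f_inv _ _ _ Uu1psi) /f /u1 /L !pairl a_i0 expr1 divff ?oner_neq0 //.
- move=> i; apply: (@generic _ (fiber q0 s4 * fiber q0 s2 * 'X_i0) x1) => //; last first.
    by rewrite !mevalM mevalXU !fiberE !mulf_neq0.
  move=> x Fx; rewrite mevalM.
  have [->|nz] := eqVneq (fiber q0 s4 * fiber q0 s2 * 'X_i0).@[x] 0; first by rewrite mulr0.
  move: nz; rewrite !mevalM mevalXU !fiberE !mulf_eq0 !negb_or => /andP[/andP[s4x s2x] xi].
  have [_ YA] := phiE x Fx xi s4x s2x.
  rewrite [X in X * _](_ : _ = 0) ?mul0r // mevalB meval_mmap.
  rewrite (meval_eq (v2 := fun l => x i0 ^+ 1 * (A' l).@[x])); last first.
    by move=> l; rewrite mevalM mevalXU expr1.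
  rewrite (whomog_meval _ _ (hY i)) YA mevalM !mevalXn mevalM mevalXn !mevalXU.
  rewrite exprMn -exprM /Delta mulSn exprD; apply/eqP; rewrite subr_eq0; apply/eqP.
  have xa0 : x i0 ^+ a i != 0 by rewrite expf_neq0.
  by rewrite -!mulrA [_ * (_ / _)]mulrA; move: xa0; move: (_ ^+ _) => z z0; field.
move=> vb; have [] := phiE x1 Fx1 x10 s4u s2u; move=> /eqP B0 _; apply: B0.
have := vb x1 Fx1; rewrite mevalM mevalXn mevalXU => /eqP.
by rewrite mulf_eq0 expf_eq0 (negPf x10) andbF => /eqP.
Qed.

End Retract.

(** * Density of the points of a hypersurface *)

Section Density.
Variables (K : closedFieldType) (n p : nat) (F : {poly {mpoly K[n]}}).
Hypothesis F_monic : F \is monic.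
Hypothesis size_F : size F = p.+1.
Hypothesis p_gt0 : (0 < p)%N.

Let inF (Q : {poly {mpoly K[n]}}) := exists S, Q = S * F.

Hypothesis F_prime : forall P Q, inF (P * Q) -> inF P \/ inF Q.

Definition point_eval (x : 'I_n -> K) (t : K) : {rmorphism {poly {mpoly K[n]}} -> K} :=
  horner_eval t \o map_poly (meval x).

Let inF_size Q : inF Q -> Q != 0 -> (p < size Q)%N.
Proof.
move=> [S ->]; have [->|S0 _] := eqVneq S 0; first by rewrite mul0r eqxx.
rewrite size_Mmonic // size_F addnS /=.
by rewrite -[X in (X < _)%N]add0n ltn_add2r size_poly_gt0.
Qed.

(** A common factor [g] of [F] and [r] splits a multiple of [F]; by primality [F] divides [g] or its
    cofactor, both of degree less than [p]. *)
Let coprime_mod (r : {poly {mpoly K[n]}}) : r != 0 -> (size r <= p)%N -> (1 < size r)%N -> resultant F r != 0.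
Proof.
move=> r0 sr sr1; rewrite resultant_eq0 -leqNgt; set g := gcdp F r.
have F0 : F != 0 by rewrite monic_neq0.
have g0 : g != 0 by rewrite gcdp_eq0 negb_and F0.
have fact Q : Q != 0 -> g %| Q -> exists h c, [/\ c != 0, c%:P * Q = h * g & h != 0].
  move=> Q0; rewrite Pdiv.Idomain.dvdp_eq => /eqP E.
  have c0 : lead_coef g ^+ scalp Q g != 0 by rewrite expf_neq0 // lead_coef_eq0.
  exists (Q %/ g), (lead_coef g ^+ scalp Q g); split=> //; first by rewrite mul_polyC.
  by apply: contraNneq Q0 => h0; move: E; rewrite h0 mul0r -mul_polyC => /eqP; rewrite mulf_eq0 polyC_eq0 (negPf c0).
have [h [c [c0 FE h0]]] := fact _ F0 (dvdp_gcdl _ _).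
have [h' [c' [c'0 rE h'0]]] := fact _ r0 (dvdp_gcdr _ _).
have hg : inF (h * g) by exists c%:P; rewrite FE.
have sE : (size h + size g).-1 = p.+1.
  by rewrite -size_mul // -FE mul_polyC size_scale.
case: (F_prime hg) => /inF_size.
  by move=> /(_ h0) => sh; move: sE; move: (size h) (size g) sh => a b; lia.
move=> /(_ g0) sg; have : (size g <= size r)%N.
  rewrite -(size_scale r c'0) -mul_polyC rE size_mul //.
  by move: h'0; rewrite -size_poly_gt0; move: (size _) (size _) => a b; lia.
by move/leq_trans=> /(_ _ sr); rewrite leqNgt sg.
Qed.

(** Elimination: the ideal of [F] and the remainder of [Q] contains a nonzero polynomial [R] in the
    base variables. Over a base point with [R] nonzero, the monic [F] has a root, and there [Q]
    cannot vanish. *)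
Lemma hypersurface_nonroot Q : ~ inF Q ->
  exists x t, point_eval x t F = 0 /\ point_eval x t Q != 0.
Proof.
move=> nQ; have QE := Pdiv.RingMonic.rdivp_eq F_monic Q.
set q := Pdiv.Ring.rdivp Q F in QE; set r := Pdiv.Ring.rmodp Q F in QE.
have sr : (size r <= p)%N by rewrite -ltnS -size_F Pdiv.CommonRing.ltn_rmodp monic_neq0.
have r0 : r != 0.
  by apply/eqP => r0; apply: nQ; exists q; rewrite QE r0 addr0.
have [R [u [v [R0 RE]]]] : exists R u v, R != 0 /\ R%:P = u * F + v * r.
  have [sr1|sr1] := leqP (size r) 1.
    exists r`_0, 0, 1; rewrite mul0r add0r mul1r -size1_polyC //; split=> //.
    by apply: contraNneq r0 => r00; rewrite (size1_polyC sr1) r00.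
  have [|[u v] /= _ RE] := @resultant_in_ideal _ F r _ sr1; first by rewrite size_F.
  by exists (resultant F r), u, v; split=> //; exact: coprime_mod.
have [x Rx] := mpoly_nonroot R0.
have [t /rootP Ft] : exists t, root (map_poly (meval x) F) t.
  apply/closed_rootP; rewrite size_map_poly_id0 ?size_F ?eqSS -?lt0n //.
  by rewrite (monicP F_monic) meval1 oner_neq0.
exists x, t; split=> //; apply: contraNneq Rx => Q0.
have FE : point_eval x t F = 0 by [].
have rx : point_eval x t r = 0.
  by move: Q0; rewrite QE rmorphD rmorphM FE mulr0 add0r.
have : point_eval x t R%:P = 0 by rewrite RE rmorphD !rmorphM FE rx !mulr0 addr0.
by rewrite /point_eval /= map_polyC /horner_eval hornerC => ->.
Qed.

End Density.

(** * The specialization argument *)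

Section Core.
Variables (K : closedFieldType) (O : comNzRingType) (k : fieldType).
Variables (inc : {rmorphism O -> K}) (res : {rmorphism O -> k}).
Hypothesis inc_inj : injective inc.
Hypothesis place_val :
  forall x, (exists a, inc a = x) \/ exists2 a, res a = 0 & x * inc a = 1.

Variables (w : 'I_5 -> nat) (e d kappa p : nat) (f : {mpoly int[5]}).
Hypothesis w_gt0 : forall j, (0 < w j)%N.
Hypothesis w_o0 : w o0 = 1%N.
Hypothesis w_dvd2 : forall j, (w j %| 2)%N.
Hypothesis dE : (kappa + \sum_i w i = d)%N.
Hypothesis d_ep : d = (e * p)%N.
Hypothesis p_prime : prime p.
Hypothesis chk : p%:R = 0 :> k.
Hypothesis f_homog : whomog w d f.
Hypothesis f_local : local_condition w kappa p f.
Hypothesis f4_neq0 : (map_mpoly (intmul 1) f : {mpoly k[5]})^`M(o4) != 0.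

Variable G : {mpoly O[6]}.
Let w6 := split6 w e.
Definition liftf (R : comNzRingType) : {mpoly R[6]} :=
  mmap (intmul 1) (fun j => 'X_(low j)) f.
Hypothesis G_res : map_mpoly res G = 'X_hi6 ^+ p - liftf k.
Hypothesis G_homog : whomog w6 d G.
Hypothesis G_lead : G@_(U_(hi6) *+ p)%MM = 1.
Hypothesis G_low : forall m, m \in msupp G -> m != (U_(hi6) *+ p)%MM -> (m hi6 < p)%N.

Let p_gt0 : (0 < p)%N := prime_gt0 p_prime.
Let p_dvd_d : (p %| d)%N. Proof. by rewrite d_ep dvdn_mull. Qed.

Let F : {poly {mpoly O[5]}} := toT G.
Local Notation FK := (mapT inc F).

Lemma toT_map (R S : comNzRingType) (psi : {rmorphism R -> S}) P :
  mapT psi (toT P) = toT (map_mpoly psi P).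
Proof.
rewrite /toT (@mmap_comp_rmorph _ _ _ (polyC \o @mpolyC 5 R) (mapT psi)).
rewrite (@mmap_map_mpoly _ _ _ psi (polyC \o @mpolyC 5 S)).
apply: eq_bigr => m _ /=; congr (_ * _).
  by rewrite /cst map_polyC /= map_mpolyC.
apply: eq_bigr => i _; congr (_ ^+ _); move: i; apply: split6_ind => [j|] /=.
  by rewrite /xw !split6_low map_polyC /= map_mpolyX.
by rewrite /xw !split6_hi map_polyX.
Qed.

Let FE : exists2 R : {poly {mpoly O[5]}}, F = 'X^p + R & (size R <= p)%N.
Proof.
exists (\sum_(m <- msupp G | m != (U_(hi6) *+ p)%MM) cst G@_m * \prod_i xw O i ^+ m i).
  rewrite /F /toT /mmap (bigD1_seq (U_(hi6) *+ p)%MM) ?msupp_uniq //=; last first.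
    by rewrite mcoeff_msupp G_lead oner_neq0.
  congr (_ + _); rewrite G_lead cst1 mul1r /mmap1 (bigD1 hi6) //= big1.
    by rewrite mulr1 /xw split6_hi mulmnE mnm1E eqxx mul1n.
  by move=> i ni; rewrite mulmnE mnm1E eq_sym (negPf ni) mul0n expr0.
apply: (leq_trans (size_sum _ _ _)); apply/bigmax_leqP_seq => m mG nm.
rewrite /cst mul_polyC (leq_trans (size_scale_leq _ _)) //.
rewrite big_ord_recr /= -/hi6 {2}/xw split6_hi.
have -> : \prod_(i < 5) xw O (widen_ord (leqnSn 5) i) ^+ m (widen_ord (leqnSn 5) i)
   = (\prod_(i < 5) 'X_i ^+ m (low i))%:P.
  rewrite rmorph_prod; apply: eq_bigr => j _ /=.
  by rewrite rmorphXn /= /xw (split6_low _ _ j).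
rewrite mul_polyC (leq_trans (size_scale_leq _ _)) // size_polyXn.
exact: G_low.
Qed.

Lemma F_monic : F \is monic.
Proof.
have [R -> sR] := FE.
rewrite monicE lead_coefDl ?lead_coefXn // size_polyXn ltnS //.
Qed.

Lemma size_F : size F = p.+1.
Proof. by have [R -> sR] := FE; rewrite size_polyDl size_polyXn // ltnS. Qed.

Local Notation inF := (inF inc F).

Lemma toT_X (R : comNzRingType) i : toT ('X_i : {mpoly R[6]}) = xw R i.
Proof. by rewrite /toT mmapX mmap1U. Qed.

Let resF : mapT res F = 'X^p - (map_mpoly (intmul 1) f)%:P.
Proof.
rewrite /F toT_map G_res rmorphB rmorphXn /= toT_X /xw split6_hi; congr (_ - _).
rewrite -[RHS](@ev_map k _ polyC) /liftf rmorph_mmap_int; apply: eq_bigr => m _.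
congr (_ * _); apply: eq_bigr => i _ /=.
by rewrite toT_X /xw split6_low.
Qed.

Section Place.
Variables (L : fieldType) (E : {rmorphism {poly {mpoly k[5]}} -> L}) (D : nat -> L -> L).
Hypothesis chL : p%:R = 0 :> L.
Hypothesis derD : forall i, derivation (D i).
Hypothesis E_F : E ('X^p - (map_mpoly (intmul 1) f)%:P) = 0.
Hypothesis E_ker : forall P : {poly {mpoly k[5]}}, (size P <= p)%N -> E P = 0 -> P = 0.
Hypothesis D_cst : forall i c, D i (E (c%:MP)%:P) = 0.

Let EF : E (mapT res F) = 0. Proof. by rewrite resF. Qed.

Local Notation redto := (redto inc res F E).
Local Notation bar := (bar res E).

Let uniq := @redto_uniq _ _ _ _ _ inc_inj _ _ _ _ F_monic size_F EF.
Let red_ex := @redto_ex _ _ _ _ _ inc_inj place_val _ _ _ _ F_monic size_F E_ker.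

Lemma redto_not_inF Q l : redto Q l -> l != 0 -> ~ inF Q.
Proof.
move=> HQ l0 /(inF_redto res E) HQ0; move: l0.
by rewrite (uniq HQ HQ0) eqxx.
Qed.

(** After scaling, both factors have nonzero reductions in the field [L], hence so has the product:
    the irreducibility of the cover lifts to the original equation. *)
Lemma inF_prime P Q : ~ inF P -> ~ inF Q -> ~ inF (P * Q).
Proof.
move=> /red_ex[a [l [a0 l0 HP]]] /red_ex[b [l' [b0 l'0 HQ]]] inPQ.
apply: (redto_not_inF (redtoM HP HQ) (mulf_neq0 l0 l'0)).
have -> : cst a * P * (cst b * Q) = cst a * cst b * (P * Q) by rewrite mulrACA.
exact: inFM inPQ.
Qed.

Lemma redto_xw j : redto ('X_j)%:P (E ('X_j)%:P).
Proof.
have XE (R S : comNzRingType) (psi : {rmorphism R -> S}) : mapT psi ('X_j)%:P = ('X_j)%:P.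
  by rewrite /mapT /= map_polyC /= map_mpolyX.
have := redto_mapT inc res F E ('X_j)%:P; rewrite XE.
by rewrite -[X in redto _ X]/(E (mapT res ('X_j)%:P)) XE.
Qed.

Lemma E_X_neq0 j : E ('X_j)%:P != 0.
Proof.
apply/eqP => /E_ker H; have /H/polyC_inj X0 : (size (('X_j)%:P : {poly {mpoly k[5]}}) <= p)%N.
  by rewrite (leq_trans (size_polyC_leq1 _)).
have := mderivXU k j j; rewrite X0 mderiv0 eqxx => /eqP.
by rewrite eq_sym oner_eq0.
Qed.

Lemma redto_cst_bar x l : redto (cst x) l -> exists o, l = bar o.
Proof.
move=> Hx; have [[o oE]|[o ro oE]] := place_val x.
  by exists o; apply: uniq Hx _; rewrite -oE; exact: redto_cst.
have H1 := redtoM (redto_cst inc res F E o) Hx.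
have := uniq H1 _; rewrite -cstM mulrC oE cst1 => /(_ _ (redto1 _ _ _ _))/eqP.
by rewrite /bar ro /cst mpolyC0 polyC0 rmorph0 mul0r eq_sym oner_eq0.
Qed.

Lemma formL_E (y : 'I_5 -> {poly L}) om : formL res E G y om = om ^+ p - ev y f.
Proof.
pose phi : {rmorphism k -> {poly L}} := polyC \o (E \o (polyC \o @mpolyC 5 k)).
have -> : formL res E G y om = mmap phi (split6 y om) (map_mpoly res G).
  rewrite mmap_map_mpoly; apply: eq_bigr => m _; congr (_ * _).
  rewrite [in RHS]big_ord_recr /= -/hi6 split6_hi; congr (_ * _).
  by apply: eq_bigr => j _; rewrite (split6_low _ _ j).
rewrite G_res rmorphB rmorphXn /= mmapX mmap1U split6_hi; congr (_ - _).
rewrite /liftf rmorph_mmap_int; apply: eq_bigr => m _; congr (_ * _).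
by apply: eq_bigr => j _ /=; rewrite mmapX mmap1U split6_low.
Qed.

Lemma det4_row0 (R : comNzRingType) (a1 a2 a3 a4 : nat -> R) :
  (forall i, a1 i.+1 = 0) -> (forall i, a2 i.+1 = 0) -> (forall i, a3 i.+1 = 0) ->
  (forall i, a4 i.+1 = 0) -> det4 a1 a2 a3 a4 = 0.
Proof. by move=> H1 H2 H3 H4; rewrite /det4 !H1 !H2 !H3 !H4; ring. Qed.

Lemma null_form_cst (b : 'I_5 -> L) : (forall i j, D i (b j) = 0) -> null_form w kappa f D b.
Proof.
move=> Db _ j; rewrite /tminor [minor _ _ _ _](_ : _ = 0) ?mulr0 //.
by move: j; elim/ord5_ind; apply: det4_row0 => i; exact: Db.
Qed.

End Place.

Theorem no_parametrization n Delta (A : 'I_n -> {mpoly K[6]}) (Yv : 'I_6 -> {mpoly K[n]})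
    (v0 : 'I_n -> K) (beta : {mpoly K[6]}) :
  (forall i, whomog (fun=> 1%N) (Delta * w6 i) (Yv i)) ->
  mmap (@mpolyC n K) Yv (map_mpoly inc G) = 0 ->
  (Yv (low o0)).@[v0] != 0 ->
  (forall j, inF (mmap (@cst K) (fun l => toT (A l)) (Yv (low j))
     - toT beta ^+ w j * ('X_j)%:P)) ->
  ~ inF (toT beta) -> False.
Proof.
move=> Yh YG Yv0 YA nbeta.
have [L [E [D [[chL derD] E_F E_ker D_cst]]]] :=
  exists_cover_field kappa w_o0 p_prime chk f4_neq0.
apply; have EF : E (mapT res F) = 0 by rewrite resF.
pose uniq := @redto_uniq _ _ _ _ _ inc_inj _ _ _ _ F_monic size_F EF.
(* The line through [v0] in the direction [A]: its image under [Yv] starts at a constant point and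
   reaches the generic point, up to [beta], at infinity. *)
pose vt l : {poly {poly {mpoly K[5]}}} := (cst (v0 l))%:P + 'X * (toT (A l))%:P.
pose Yt i : {poly {poly {mpoly K[5]}}} := mmap (polyC \o @cst K) vt (Yv i).
(* Squaring the parameter makes every exponent a multiple of all weights, as each [w j] divides 2;
   hence the factor 2 in [N]. *)
pose Y i := Yt i \Po 'X^2.
have vt_top l : top 1 (vt l) (toT (A l)).
  rewrite /vt; split; last by rewrite coefD coefC add0r mulrC coefMX coefC eqxx.
  apply: leq_trans (size_polyD _ _) _; rewrite geq_max.
  rewrite (leq_trans (size_polyC_leq1 _)) //=.
  by rewrite (leq_trans (size_polyMleq _ _)) // size_polyX addSn /= add1n ltnS size_polyC_leq1.
have Yt_top i : top (Delta * w6 i) (Yt i) (mmap (@cst K) (fun l => toT (A l)) (Yv i)).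
  exact: (@top_mmap _ _ (polyC \o @mpolyC 5 K) _ _ _ _ _ (Yh i) vt_top).
have Yt_0 i : (Yt i)`_0 = cst (Yv i).@[v0].
  rewrite -horner_coef0 -[LHS]/(horner_eval 0 _) /Yt.
  rewrite (mmap_comp_rmorph (polyC \o (polyC \o @mpolyC 5 K))).
  rewrite /meval -[RHS]/((polyC \o @mpolyC 5 K) _) mmap_comp_rmorph.
  apply: eq_mmap => l /=; rewrite /horner_eval ?hornerC //.
  by rewrite /vt !hornerE.
pose N := (2 * Delta)%N.
have coefY i n' : (Y i)`_n' = if (2 %| n')%N then (Yt i)`_(n' %/ 2) else 0.
  by rewrite /Y coef_comp_poly_Xn.
have sl0 j : slice w Y 0 j = cst (Yv (low j)).@[v0].
  by rewrite /slice mul0n coefY dvdn0 div0n Yt_0.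
have slN j : slice w Y N j = mmap (@cst K) (fun l => toT (A l)) (Yv (low j)).
  rewrite /slice coefY -mulnA dvdn_mulr // mulKn //.
  by have [_] := Yt_top (low j); rewrite /w6 split6_low.
have Y_form : formK inc G Y = 0.
  pose phi : {rmorphism K -> {poly {poly {mpoly K[5]}}}} := polyC \o (polyC \o @mpolyC 5 K).
  pose Psi : {rmorphism {mpoly K[n]} -> {poly {poly {mpoly K[5]}}}} :=
    comp_poly 'X^2 \o mmap phi vt.
  have -> : formK inc G Y = mmap phi Y (map_mpoly inc G).
    by rewrite mmap_map_mpoly.
  have -> : mmap phi Y (map_mpoly inc G) = Psi (mmap (@mpolyC n K) Yv (map_mpoly inc G)).
    rewrite [RHS]mmap_comp_rmorph; apply: eq_mmap => // c.
    by rewrite /= mmapC comp_polyC.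
  by rewrite YG rmorph0.
have Y_supp j n' : (Y (low j))`_n' != 0 -> (w j %| n')%N /\ (n' <= N * w j)%N.
  rewrite coefY; case: ifP => [d2|_]; last by rewrite eqxx.
  move=> nz; split; first exact: dvdn_trans (w_dvd2 j) d2.
  have [sY _] := Yt_top (low j).
  have : (n' %/ 2 < size (Yt (low j)))%N.
    by rewrite ltnNge; apply: contra nz => ?; rewrite nth_default.
  move/leq_trans => /(_ _ sY); rewrite ltnS /w6 split6_low => le.
  by rewrite -(divnK d2) mulnC /N -mulnA leq_mul2l le orbT.
have act0 : active inc F w Y 0.
  exists o0; rewrite sl0 => /(inF_small inc_inj F_monic size_F) H.
  have /polyC_inj/eqP : cst (Yv (low o0)).@[v0] = 0.
    by apply: H; rewrite (leq_trans (size_polyC_leq1 _)).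
  by rewrite mpolyC_eq0 (negPf Yv0).
have xj_red j : redto inc res F E ('X_j)%:P (E ('X_j)%:P) by exact: redto_xw.
(* [m] normalizes [beta]; it will be compared with the scalar [al'] that normalizes the last
   slice. *)
have [m [mb [m0 mb0 Hm]]] := @redto_ex _ _ _ _ _ inc_inj place_val _ _ _ _ F_monic size_F E_ker _ nbeta.
have Hmx j : redto inc res F E (cst m ^+ w j * (toT beta ^+ w j * ('X_j)%:P)) (mb ^+ w j * E ('X_j)%:P).
  by rewrite mulrA -exprMn; apply: redtoM => //; apply: redtoX.
have x0 j : E ('X_j)%:P != 0 by exact: E_X_neq0.
have actN : active inc F w Y N.
  exists o0; rewrite slN => H.
  have H2 : inF (toT beta ^+ w o0 * ('X_o0)%:P).
    have -> : toT beta ^+ w o0 * ('X_o0)%:P = mmap (@cst K) (fun l => toT (A l)) (Yv (low o0)) -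
      (mmap (@cst K) (fun l => toT (A l)) (Yv (low o0)) - toT beta ^+ w o0 * ('X_o0)%:P).
      by rewrite subKr.
    by apply: inFD => //; apply: inFN; exact: YA.
  have nz : mb ^+ w o0 * E ('X_o0)%:P != 0 by rewrite mulf_neq0 ?expf_neq0.
  exact: (redto_not_inF E_F (Hmx o0) nz (inFM _ H2)).
have rootK n' (x : K) : (0 < n')%N -> exists y, y ^+ n' = x.
  move=> n0; have [y yE] := solve_monicpoly (fun i => if i == 0%N then x else 0) n0.
  exists y; rewrite yE; case: n' n0 {yE} => // n' _.
  by rewrite big_ord_recl big1 ?addr0 /= ?expr0 ?mulr1 // => i _; rewrite mul0r.
have [||b [al' [al0 Hb [j bj0] nullb]]] := @newton_null _ _ _ _ _ inc_inj place_val _ _ _ _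
  F_monic size_F EF E_ker p_gt0 rootK _ G_lead G_low _ w6 e d _ w_gt0 (split6_low _ _) d_ep
  f_homog G_homog (formL_E E) (null_form w kappa f D)
  (null_form_scale w_gt0 w_o0 dE f_homog p_prime p_dvd_d derD) _ _ _ Y_form Y_supp act0 actN.
- move=> M y b om ytop yE j0 yj0.
  exact: (edge_null_form w_gt0 w_o0 dE f_homog p_prime p_dvd_d f_local chL derD ytop yE yj0).
- move=> b al' al0 Hb; apply: null_form_cst => i j.
  have := Hb j; rewrite sl0 -cstM => /(redto_cst_bar E_F)[o ->].
  exact: D_cst.
have Hb' j' : redto inc res F E (cst (al' ^+ w j') * (toT beta ^+ w j' * ('X_j')%:P)) (b j').
  have H : inF (cst (al' ^+ w j') * slice w Y N j' - cst (al' ^+ w j') * (toT beta ^+ w j' * ('X_j')%:P)).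
    by rewrite -mulrBr slN; apply/inFM/YA.
  exact: redto_inF H (Hb j').
(* If [al' / m] is integral, the vector reached is a weighted multiple of the generic point, on
   which the form would vanish. Otherwise [m] is [al'] times an element of the maximal ideal, and
   the nonzero reduction of the last slice scaled by [m] would be 0. *)
have [[o oE]|[o ro oE]] := place_val (al' / m).
  have bE j' : b j' = (bar res E o * mb) ^+ w j' * E ('X_j')%:P.
    apply: (redto_uniq inc_inj F_monic size_F EF (Hb' j')).
    have -> : cst (al' ^+ w j') * (toT beta ^+ w j' * ('X_j')%:P) =
       cst (inc o) ^+ w j' * (cst m ^+ w j' * (toT beta ^+ w j' * ('X_j')%:P)).
      by rewrite !mulrA -!cstX -cstM -exprMn oE mulfVK.
    rewrite exprMn -mulrA; apply: redtoM => //.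
    exact/redtoX/redto_cst.
  apply: (@null_form_scale _ _ _ _ _ w_gt0 w_o0 dE f_homog p_prime p_dvd_d _ _ derD (bar res E o * mb)).
    by apply: contraNneq bj0 => mu0; rewrite bE mu0 expr0n eqn0Ngt w_gt0 mul0r.
  rewrite (_ : (fun j => _) = b) //; apply: boolp.funext => j'; exact/esym/bE.
have nz : mb ^+ w o0 * E ('X_o0)%:P != 0 by rewrite mulf_neq0 ?expf_neq0.
suff H0 : mb ^+ w o0 * E ('X_o0)%:P = 0 by rewrite H0 eqxx in nz.
have mE : m = inc o * al'.
  by have := congr1 ( *%R^~ m) oE; rewrite mulrAC mulfVK // mul1r mulrC.
apply: (redto_uniq inc_inj F_monic size_F EF (Hmx o0)).
have -> n' (Q : {poly {mpoly K[5]}}) : cst m ^+ n' * Q = cst (inc o) ^+ n' * (cst (al' ^+ n') * Q).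
  by rewrite mE cstM exprMn cstX mulrA.
rewrite (_ : 0 = bar res E o ^+ w o0 * b o0); first exact: redtoM (redtoX _ (redto_cst _ _ _ _ _)) _.
by rewrite /bar ro /cst mpolyC0 polyC0 rmorph0 w_o0 expr1 mul0r.
Qed.

(** The Nullstellensatz for the cone, from the density of its points. *)
Lemma vanishesP E : vanishes (map_mpoly inc G) E <-> inF (toT E).
Proof.
have evE v (P : {mpoly K[6]}) : point_eval (fun j => v (low j)) (v hi6) (toT P) = P.@[v].
  rewrite /toT (mmap_comp_rmorph (polyC \o @mpolyC 5 K)); apply: eq_mmap => [c|].
    by rewrite /point_eval /= map_polyC /horner_eval hornerC /= mevalC.
  apply: split6_ind => [j|] /=.
    by rewrite /xw split6_low /point_eval /= map_polyC /horner_eval hornerC /= mevalXU.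
  by rewrite /xw split6_hi /point_eval /= map_polyX /horner_eval hornerX.
have FKE : FK = toT (map_mpoly inc G) by rewrite /F toT_map.
split=> [V|[S SE] v Gv]; last first.
  by rewrite -evE SE rmorphM FKE evE Gv mulr0.
have [L [E' [D [[chL derD] E_F E_ker D_cst]]]] :=
  exists_cover_field kappa w_o0 p_prime chk f4_neq0.
move=> _; apply: boolp.contrapT => nE.
have [|||x [t [Fx]]] := @hypersurface_nonroot _ _ p FK _ _ p_gt0 _ _ nE.
- exact/monic_map/F_monic.
- by have := size_FK inc_inj size_F.
- move=> P Q; apply: boolp.contraPP => /boolp.not_orP[nP nQ].
  exact: (inF_prime E_F E_ker nP nQ).
have := evE (split6 x t).
rewrite split6_hi (_ : (fun j => _) = x); last by apply: boolp.funext => j; rewrite split6_low.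
move=> evE'; have /V E0 : (map_mpoly inc G).@[split6 x t] = 0 by rewrite -evE' -FKE.
by rewrite evE' E0 eqxx.
Qed.

Theorem not_stably_rational : ~ stably_rational (@cone K 6 w6 (map_mpoly inc G)).
Proof.
have e_gt0 : (0 < e)%N.
  have : (0 < d)%N by rewrite -dE (bigD1 o0) //= w_o0 addnA addn1.
  by rewrite d_ep; case: e.
have [L [E' [D [[chL derD] E_F E_ker D_cst]]]] :=
  exists_cover_field kappa w_o0 p_prime chk f4_neq0.
move=> _ [k0 rat].
have Gk_homog : whomog w6 d (map_mpoly inc G).
  move=> m; rewrite mcoeff_msupp mcoeff_map_mpoly => nz; apply: G_homog.
  rewrite mcoeff_msupp; apply: contraNneq nz => G0; rewrite /= G0.
  exact/eqP/(rmorph0 inc).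
have w6_gt0 i : (0 < w6 i)%N.
  by move: i; apply: split6_ind => [j|]; rewrite /w6 ?split6_low ?split6_hi.
have w6_0 : w6 (low o0) = 1%N by rewrite /w6 split6_low.
have irr E1 E2 : vanishes (map_mpoly inc G) (E1 * E2) ->
    vanishes (map_mpoly inc G) E1 \/ vanishes (map_mpoly inc G) E2.
  move=> /vanishesP; rewrite rmorphM => H; apply: boolp.contrapT => /boolp.not_orP[n1 n2].
  by apply: (inF_prime E_F E_ker) H => /vanishesP.
have nX : ~ vanishes (map_mpoly inc G) 'X_(low o0).
  move=> /vanishesP; rewrite toT_X /xw split6_low.
  have red_X : redto inc res F E' ('X_o0)%:P (E' ('X_o0)%:P) by exact: redto_xw.
  have X0 := E_X_neq0 E_ker o0; exact: (redto_not_inF E_F red_X X0).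
have [n [Delta [A [Y [v0 [beta [hY GY Yv0 YA nbeta]]]]]]] :=
  rational_parametrization w6_gt0 w6_0 Gk_homog irr nX rat.
apply: (@no_parametrization n Delta A Y v0 beta) => // [j|/vanishesP//].
have /vanishesP := YA (low j).
rewrite rmorphB rmorphM rmorphXn /= toT_X /xw /w6 !split6_low.
rewrite [toT (mmap _ _ _)](_ : _ = mmap (@cst K) (fun l => toT (A l)) (Y (low j))) //.
rewrite /toT (mmap_comp_rmorph (@mpolyC 6 K)); apply: eq_mmap => // c /=.
exact: mmapC.
Qed.

End Core.

(** * Regular local rings *)

(** The cofactors [Q] are not asked to be unique, so the property passes to sums and products by
    Leibniz' rule. *)
Lemma taylor (K : comNzRingType) n (xi : 'I_n -> K) (P : {mpoly K[n]}) :
  exists Q : 'I_n -> {mpoly K[n]},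
    P = (P.@[xi])%:MP + \sum_i ('X_i - (xi i)%:MP) * Q i /\
    forall i, (Q i).@[xi] = P^`M(i).@[xi].
Proof.
pose ok (P : {mpoly K[n]}) := exists Q : 'I_n -> {mpoly K[n]},
    P = (P.@[xi])%:MP + \sum_i ('X_i - (xi i)%:MP) * Q i /\
    forall i, (Q i).@[xi] = P^`M(i).@[xi].
have okC c : ok c%:MP.
  exists (fun=> 0); split=> [|i]; last by rewrite mderivC !meval0.
  by rewrite mevalC big1 ?addr0 // => i _; rewrite mulr0.
have okX i : ok 'X_i.
  exists (fun j => (j == i)%:R%:MP); split=> [|j]; last first.
    by rewrite mderivXU mevalC eq_sym; case: eqP => _; rewrite ?mevalC ?mpolyC0 ?meval0.
  rewrite mevalXU (bigD1 i) //= eqxx mpolyC1 mulr1 big1 ?addr0 => [|j /negPf ->].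
    by rewrite addrC subrK.
  by rewrite mpolyC0 mulr0.
have okD P1 P2 : ok P1 -> ok P2 -> ok (P1 + P2).
  move=> [Q1 [E1 H1]] [Q2 [E2 H2]]; exists (fun i => Q1 i + Q2 i); split=> [|i].
    rewrite {1}E1 {1}E2 mevalD mpolyCD addrACA; congr (_ + _).
    by rewrite -big_split; apply: eq_bigr => i _; rewrite mulrDr.
  by rewrite mevalD H1 H2 mderivD mevalD.
have okM P1 P2 : ok P1 -> ok P2 -> ok (P1 * P2).
  move=> [Q1 [E1 H1]] [Q2 [E2 H2]].
  exists (fun i => Q1 i * P2 + (P1.@[xi])%:MP * Q2 i); split=> [|i].
    have -> : \sum_i ('X_i - (xi i)%:MP) * (Q1 i * P2 + (P1.@[xi])%:MP * Q2 i) =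
       (\sum_i ('X_i - (xi i)%:MP) * Q1 i) * P2 + (P1.@[xi])%:MP * \sum_i ('X_i - (xi i)%:MP) * Q2 i.
      rewrite big_distrl big_distrr -big_split; apply: eq_bigr => i _ /=.
      by rewrite mulrDr mulrA; congr (_ + _); rewrite mulrCA.
    rewrite mevalM mpolyCM; move: E1 E2; set A := \sum_i _; set B := \sum_i _.
    by move: (_%:MP) (_%:MP) A B => p1 p2 A B -> ->; ring.
  by rewrite mevalD !mevalM mevalC H1 H2 mderivM mevalD !mevalM.
have ok1 : ok 1 by rewrite -mpolyC1.
rewrite -/(ok P) [P]mpolyE; elim/big_rec: _ => [|m P' _ okP']; first by rewrite -mpolyC0.
apply: (okD) => //; rewrite -mul_mpolyC; apply: (okM) => //; rewrite mpolyXE_id.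
elim/big_rec: _ => // i P'' _ okP''; apply: (okM) => //.
by elim: (m i) => [|k IHk]; rewrite ?expr0 // exprS; apply: (okM).
Qed.

Section LocalRing.
Variables (K : closedFieldType) (n : nat) (a : 'I_n -> nat) (x : 'I_n -> K).
Local Notation frac := {fraction {mpoly K[n]}}.
Local Notation "G // H" := (tofrac G / tofrac H : frac) (at level 40).

(** Membership in the local ring at [x] together with the value there, so that units are recognized
    by [z != 0]. *)
Definition loc (phi : frac) (z : K) := exists d (G H : {mpoly K[n]}),
  [/\ whomog a d G, whomog a d H, H.@[x] != 0, phi = G // H & z = G.@[x] / H.@[x]].

Let nz H : H.@[x] != 0 -> tofrac H != 0 :> frac.
Proof. by rewrite tofrac_eq0; apply: contraNneq => ->; rewrite meval0. Qed.

Lemma locD p q y z : loc p y -> loc q z -> loc (p + q) (y + z).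
Proof.
move=> [d [G [H [hG hH H0 -> ->]]]] [d' [G' [H' [hG' hH' H'0 -> ->]]]].
exists (d + d')%N, (G * H' + G' * H), (H * H'); split.
- by apply: whomogD; [apply: whomogM | rewrite addnC; apply: whomogM].
- exact: whomogM.
- by rewrite mevalM mulf_neq0.
- by rewrite rmorphD !rmorphM addf_div ?nz.
by rewrite mevalD !mevalM addf_div.
Qed.

Lemma locM p q y z : loc p y -> loc q z -> loc (p * q) (y * z).
Proof.
move=> [d [G [H [hG hH H0 -> ->]]]] [d' [G' [H' [hG' hH' H'0 -> ->]]]].
exists (d + d')%N, (G * G'), (H * H'); split; try exact: whomogM.
- by rewrite mevalM mulf_neq0.
- by rewrite !rmorphM mulf_div.
by rewrite !mevalM mulf_div.
Qed.

Lemma locC c : loc (tofrac c%:MP) c.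
Proof.
exists 0%N, c%:MP, 1; split; [exact: whomogC | exact: whomog1 | | |].
- by rewrite meval1 oner_neq0.
- by rewrite rmorph1 divr1.
by rewrite mevalC meval1 divr1.
Qed.

Lemma loc0 : loc 0 0. Proof. by have := locC 0; rewrite mpolyC0 rmorph0. Qed.
Lemma loc1 : loc 1 1. Proof. by have := locC 1; rewrite mpolyC1 rmorph1. Qed.

Lemma locN p y : loc p y -> loc (- p) (- y).
Proof.
move=> H; rewrite -mulN1r -[- y]mulN1r; apply: locM => //.
by have := locC (-1); rewrite mpolyCN mpolyC1 rmorphN rmorph1.
Qed.

Lemma locV p y : y != 0 -> loc p y -> loc p^-1 y^-1.
Proof.
move=> + [d [G [H [hG hH H0 -> yE]]]]; rewrite yE mulf_eq0 negb_or => /andP[G0 _].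
by exists d, H, G; split; rewrite // invf_div.
Qed.

Lemma loc_neq0 p y : y != 0 -> loc p y -> p != 0.
Proof.
move=> + [d [G [H [hG hH H0 -> yE]]]]; rewrite yE mulf_eq0 negb_or => /andP[G0 _].
by rewrite mulf_neq0 ?invr_neq0 ?nz.
Qed.

Lemma locX p y k : loc p y -> loc (p ^+ k) (y ^+ k).
Proof.
move=> H; elim: k => [|k IHk]; first by rewrite !expr0; exact: loc1.
by rewrite !exprS; exact: locM.
Qed.

Definition subst (tau : 'I_n -> frac) (P : {mpoly K[n]}) : frac :=
  mmap (@tofrac _ \o @mpolyC n K) tau P.
HB.instance Definition _ tau :=
  GRing.RMorphism.copy (subst tau) (mmap (@tofrac _ \o @mpolyC n K) tau).

Lemma substC tau c : subst tau c%:MP = tofrac c%:MP.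
Proof. by rewrite /subst mmapC. Qed.

Lemma substXU tau i : subst tau 'X_i = tau i.
Proof. by rewrite /subst mmapX mmap1U. Qed.

Lemma loc_subst tau xi P : (forall i, loc (tau i) (xi i)) -> loc (subst tau P) P.@[xi].
Proof.
move=> H; rewrite mevalE /subst /mmap.
elim/big_rec2: _ => [|m y z _ IH]; first exact: loc0.
apply: locD => //; apply: locM; first exact: locC.
rewrite /mmap1; elim/big_rec2: _ => [|i y' z' _ IH']; first exact: loc1.
by apply: locM => //; exact: locX.
Qed.

Lemma subst_homog T d P : T != 0 -> whomog a d P ->
  tofrac P = T ^+ d * subst (fun i => tofrac 'X_i / T ^+ a i) P.
Proof.
move=> T0 hP; rewrite {1}[P]mpolyE rmorph_sum /subst /mmap big_distrr /=.
apply: eq_big_seq => m mP; rewrite -mul_mpolyC rmorphM mulrCA; congr (_ * _).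
rewrite mpolyXE_id rmorph_prod /= -(hP m mP) -prodrXr -big_split.
have scale (L : fieldType) (u z : L) k m' : u != 0 -> z ^+ m' = u ^+ (k * m') * (z / u ^+ k) ^+ m'.
  by move=> u0; rewrite exprM -exprMn mulrC divfK // expf_neq0.
by apply: eq_bigr => i _ /=; rewrite rmorphXn; exact: scale.
Qed.

Lemma loc_ringP phi : @loc_ring K (wproj a) x phi <-> exists z, loc phi z.
Proof.
split=> [[D [G [H [/mhomogP/(_ ord0) hG /mhomogP/(_ ord0) hH H0 ->]]]]|].
  by exists (G.@[x] / H.@[x]), (D ord0), G, H.
move=> [z [d [G [H [hG hH H0 -> _]]]]].
by exists (fun=> d), G, H; split=> //; apply/mhomogP => j; rewrite [j]ord1.
Qed.

Lemma loc_maxP phi : @loc_max K (wproj a) x phi <-> loc phi 0.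
Proof.
split=> [[D [G [H [/mhomogP/(_ ord0) hG /mhomogP/(_ ord0) hH H0 G0 ->]]]]|].
  by exists (D ord0), G, H; rewrite G0 mul0r.
move=> [d [G [H [hG hH H0 -> /esym/eqP]]]].
rewrite mulf_eq0 invr_eq0 (negPf H0) orbF => /eqP G0.
by exists (fun=> d), G, H; split=> //; apply/mhomogP => j; rewrite [j]ord1.
Qed.

Variables (F : {mpoly K[n]}) (d : nat).
Hypothesis F_homog : whomog a d F.
Hypothesis Fx : F.@[x] = 0.

Local Notation ideal := (@loc_ideal K (wproj a) F x).

Lemma loc_ideal0 : ideal 0.
Proof.
exists (fun=> 0%N), 0, 1; rewrite mulr0 rmorph0 mul0r meval1 oner_neq0.
split=> //; apply/mhomogP => j; [by move=> m; rewrite msupp0 | exact: whomog1].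
Qed.

Lemma loc_idealD p q : ideal p -> ideal q -> ideal (p + q).
Proof.
move=> [D [A [H [hA hH H0 ->]]]] [D' [A' [H' [hA' hH' H'0 ->]]]].
exists (fun j => D j + D' j)%N, (A * H' + A' * H), (H * H'); split.
- apply/mhomogP => j; rewrite mulrDr !mulrA; apply: whomogD.
    by move: j; apply/mhomogP; exact: mhomogM.
  by rewrite addnC; move: j; apply/mhomogP; exact: mhomogM.
- exact: mhomogM.
- by rewrite mevalM mulf_neq0.
by rewrite mulrDr !mulrA rmorphD !(rmorphM, mulrA) addf_div ?nz // !rmorphM.
Qed.

Lemma loc_idealM p q y : loc p y -> ideal q -> ideal (p * q).
Proof.
move=> [k [G [H [hG hH H0 -> _]]]] [D' [A' [H' [hA' hH' H'0 ->]]]].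
exists (fun j => k + D' j)%N, (G * A'), (H * H'); split.
- by apply/mhomogP => j; rewrite mulrCA; apply: whomogM; [rewrite [j]ord1 | move/mhomogP: hA'].
- by apply/mhomogP => j; apply: whomogM; [rewrite [j]ord1 | move/mhomogP: hH'].
- by rewrite mevalM mulf_neq0.
by rewrite mulf_div [F * (_ * _)]mulrCA !rmorphM.
Qed.

Variables (r : nat) (g : 'I_r -> frac).

Definition generated phi := exists2 u : 'I_r -> frac,
  (forall i, @loc_ring K (wproj a) x (u i)) & ideal (phi - \sum_i u i * g i).

Lemma generatedD p q : generated p -> generated q -> generated (p + q).
Proof.
move=> [u Hu up] [v Hv vq]; exists (fun i => u i + v i).
  move=> i; have /loc_ringP[y uy] := Hu i; have /loc_ringP[z vz] := Hv i.
  by apply/loc_ringP; exists (y + z); exact: locD.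
under eq_bigr do rewrite mulrDl.
by rewrite big_split opprD addrACA; exact: loc_idealD.
Qed.

Lemma generatedM p y q : loc p y -> generated q -> generated (p * q).
Proof.
move=> py [v Hv vq]; exists (fun i => p * v i).
  move=> i; have /loc_ringP[z vz] := Hv i.
  by apply/loc_ringP; exists (y * z); exact: locM.
under eq_bigr do rewrite -mulrA.
by rewrite -big_distrr -mulrBr; exact: loc_idealM py vq.
Qed.

Lemma generated_ideal p : ideal p -> generated p.
Proof.
move=> ip; exists (fun=> 0) => [i|]; first by apply/loc_ringP; exists 0; exact: loc0.
by rewrite big1 ?subr0 // => i _; rewrite mul0r.
Qed.

Lemma generated_gen i : generated (g i).
Proof.
exists (fun j => (j == i)%:R) => [j|].
  by apply/loc_ringP; case: eqP => _; [exists 1; exact: loc1 | exists 0; exact: loc0].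
rewrite (bigD1 i) //= eqxx mul1r big1 ?addr0 ?subrr; first exact: loc_ideal0.
by move=> j /negPf ->; rewrite mul0r.
Qed.

Lemma generated_sum (J : Type) (s : seq J) (A : pred J) (p : J -> frac) :
  (forall j, A j -> generated (p j)) -> generated (\sum_(j <- s | A j) p j).
Proof.
move=> H; elim/big_rec: _ => [|j q Aj IH]; first exact/generated_ideal/loc_ideal0.
by apply: generatedD => //; exact: H.
Qed.

Variables (T1 T2 : {mpoly K[n]}) (e : nat).
Hypothesis T1_homog : whomog a e.+1 T1.
Hypothesis T2_homog : whomog a e T2.
Hypothesis T1x : T1.@[x] != 0.
Hypothesis T2x : T2.@[x] != 0.
Let T : frac := T1 // T2.
Let t := T1.@[x] / T2.@[x].
(** The quotient of forms of degrees [e + 1] and [e] replaces a coordinate of weight 1, since all of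
    these may vanish at a point of a weighted space. *)
Definition chart i : frac := tofrac 'X_i / (T1 // T2) ^+ a i.
Definition chart_val i : K := (T1.@[x] / T2.@[x])^-1 ^+ a i * x i.
Local Notation tau := chart.
Local Notation xi := chart_val.

Let T_neq0 : T != 0.
Proof. by rewrite mulf_neq0 ?invr_neq0 ?nz. Qed.

Let t_neq0 : t != 0.
Proof. by rewrite mulf_neq0 ?invr_neq0. Qed.

Lemma chart_loc i : loc (tau i) (xi i).
Proof.
exists (a i * e.+1)%N, ('X_i * T2 ^+ a i), (T1 ^+ a i); split.
- by rewrite mulnS; apply: whomogM; [exact: whomogXU | exact: whomogX].
- exact: whomogX.
- by rewrite mevalXn expf_neq0.
- by rewrite /chart rmorphM !rmorphXn expr_div_n invf_div mulrA.
by rewrite /chart_val mevalM !mevalXn mevalXU exprVn expr_div_n invf_div mulrC mulrA.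
Qed.

Let subst_taylor P : exists2 Q : 'I_n -> {mpoly K[n]},
  subst tau P = tofrac (P.@[xi])%:MP + \sum_i (tau i - tofrac (xi i)%:MP) * subst tau (Q i)
  & forall i, (Q i).@[xi] = P^`M(i).@[xi].
Proof.
have [Q [PE QE]] := taylor xi P; exists Q => //.
rewrite {1}PE rmorphD; congr (_ + _); first exact: substC.
rewrite rmorph_sum; apply: eq_bigr => i _; rewrite rmorphM rmorphB.
by congr ((_ - _) * _); [exact: substXU | exact: substC].
Qed.

Lemma chart_ideal : ideal (subst tau F).
Proof.
exists (fun=> (d * e.+1)%N), (T2 ^+ d), (T1 ^+ d); split.
- by apply/mhomogP => j; rewrite [j]ord1 mulnS; apply: whomogM => //; exact: whomogX.
- by apply/mhomogP => j; rewrite [j]ord1; exact: whomogX.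
- by rewrite mevalXn expf_neq0.
have Td : T ^+ d != 0 by rewrite expf_neq0.
apply: (mulfI Td); rewrite -(subst_homog T_neq0 F_homog) rmorphM !rmorphXn.
have cancel (L : fieldType) (X u v : L) : u != 0 -> v != 0 -> X = u / v * (X * v / u).
  by move=> u0 v0; field; rewrite u0.
by rewrite /T expr_div_n; apply: cancel; rewrite expf_neq0 ?nz.
Qed.

Lemma chart_gen_loc i : loc (tau i - tofrac (xi i)%:MP) 0.
Proof. by rewrite -(subrr (xi i)); apply: locD (chart_loc i) (locN (locC _)). Qed.

(** A fraction that vanishes at [x] is a quotient of polynomials in the chart coordinates, and
    Taylor's formula writes its numerator through the differences [tau i - xi i]. *)
Lemma regular_of_generated : (forall i, loc (g i) 0) ->
  (forall i, generated (tau i - tofrac (xi i)%:MP)) -> @regular_local K (wproj a) r F x.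
Proof.
move=> gm gen; exists g => [i|phi]; first exact/loc_maxP.
move=> [D [G [H [/mhomogP/(_ ord0) hG /mhomogP/(_ ord0) hH H0 G0 ->]]]].
suff : generated (G // H) by [].
rewrite (subst_homog T_neq0 hG) (subst_homog T_neq0 hH) -/chart -mulf_div divff ?expf_neq0 // mul1r.
have [Q -> _] := subst_taylor G; rewrite (whomog_meval _ _ hG) G0 mulr0 mpolyC0 rmorph0 add0r mulrC.
have Hxi : H.@[xi] != 0.
  by rewrite (whomog_meval _ _ hH) mulf_neq0 // expf_neq0 // invr_neq0.
apply: (generatedM (locV Hxi (loc_subst H chart_loc))).
apply: generated_sum => i _; rewrite mulrC.
exact: generatedM (loc_subst (Q i) chart_loc) (gen i).
Qed.

(* The equation [F = 0] eliminates a coordinate along which [F] has nonzero derivative. *)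
Lemma generated_elim i0 : F^`M(i0).@[xi] != 0 ->
  (forall i, i != i0 -> generated (tau i - tofrac (xi i)%:MP)) ->
  generated (tau i0 - tofrac (xi i0)%:MP).
Proof.
move=> dF gen; have [Q FE QE] := subst_taylor F.
have ideal_F := chart_ideal.
have Qi : (Q i0).@[xi] != 0 by rewrite QE.
have QL := loc_subst (Q i0) chart_loc.
move: FE; rewrite (whomog_meval _ _ F_homog) Fx mulr0 mpolyC0 rmorph0 add0r (bigD1 i0) //=.
set S := \sum_(i | _) _ => FE.
have Q0 : subst tau (Q i0) != 0 := loc_neq0 Qi QL.
have -> : tau i0 - tofrac (xi i0)%:MP = (subst tau (Q i0))^-1 * (subst tau F - S).
  by rewrite FE addrK mulrC mulfK.
apply: generatedM (locV Qi QL) _; apply: generatedD; first exact: generated_ideal.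
rewrite -mulN1r; apply: (generatedM (locN loc1)).
apply: generated_sum => i /gen gi; rewrite mulrC.
exact: generatedM (loc_subst (Q i) chart_loc) gi.
Qed.

End LocalRing.

(** * Smoothness of the cyclic cover in characteristic zero *)

Section SmoothCover.
Variables (K : closedFieldType) (w : 'I_5 -> nat) (e d p : nat) (f : {mpoly int[5]}).
Hypothesis charK : forall n, n.+1%:R != 0 :> K.
Hypothesis w_gt0 : forall j, (0 < w j)%N.
Hypothesis e_gt0 : (0 < e)%N.
Hypothesis p_gt1 : (1 < p)%N.
Hypothesis d_ep : d = (e * p)%N.
Hypothesis f_homog : whomog w d f.

Let w6 := split6 w e.
Let F : {mpoly K[6]} := 'X_hi6 ^+ p - liftf f K.

Lemma liftf_homog (R : comNzRingType) : whomog w6 d (liftf f R).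
Proof.
rewrite /liftf /mmap; apply: whomog_sum => m mf; rewrite -[d]add0n.
apply: whomogM; first by rewrite -(rmorph_int (@mpolyC 6 R)); exact: whomogC.
rewrite -(f_homog mf) /mmap1; apply: whomog_prod => j; rewrite mulnC.
by apply: whomogX; rewrite -(split6_low w e j); exact: whomogXU.
Qed.

Lemma cover_homog (R : comNzRingType) : whomog w6 d ('X_hi6 ^+ p - liftf f R).
Proof.
apply: whomogD; last exact/whomogN/liftf_homog.
by rewrite d_ep mulnC; apply: whomogX; rewrite -[X in whomog _ X](split6_hi w e); exact: whomogXU.
Qed.

Let low_neq_hi j : (low j == hi6) = false.
Proof. by apply/eqP => /(congr1 val) /= jE; have := ltn_ord j; rewrite jE. Qed.

Let low_inj j j' : (low j == low j') = (j == j').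
Proof. by []. Qed.

Lemma meval_liftf v : (liftf f K).@[v] = ev (fun j => v (low j)) f.
Proof.
rewrite -[LHS]/(meval v _) /liftf rmorph_mmap_int; apply: eq_mmap => // j /=.
exact: mevalXU.
Qed.

Lemma meval_cover v : F.@[v] = v hi6 ^+ p - ev (fun j => v (low j)) f.
Proof. by rewrite /F mevalB mevalXn mevalXU meval_liftf. Qed.

Let dF i : F^`M(i) = 'X_hi6 ^+ p.-1 * (hi6 == i)%:R *+ p
  - \sum_j ev (fun j => 'X_(low j)) f^`M(j) * (low j == i)%:R.
Proof.
have derM := mderiv_derivation K i.
rewrite /F mderivB (derivationX derM) mderivXU; congr (_ - _).
rewrite -[liftf f K]/(ev _ f) (derivation_ev derM).
by apply: eq_bigr => j _; rewrite mderivXU.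
Qed.

Lemma deriv_cover_hi v : F^`M(hi6).@[v] = v hi6 ^+ p.-1 *+ p.
Proof.
rewrite dF eqxx big1 => [|j _]; last by rewrite low_neq_hi mulr0.
by rewrite subr0 mulr1 mevalMn mevalXn mevalXU.
Qed.

Lemma deriv_cover_low v j : F^`M(low j).@[v] = - grad f (fun j => v (low j)) j.
Proof.
rewrite dF eq_sym low_neq_hi mulr0 mul0rn sub0r (bigD1 j) //= eqxx mulr1 big1 => [|i ij].
  rewrite addr0 mevalN; congr (- _); rewrite -[LHS]/(meval v _) rmorph_mmap_int.
  by apply: eq_mmap => // i /=; exact: mevalXU.
by rewrite low_inj (negPf ij) mulr0.
Qed.

(* Euler's relation handles the derivative along the nonvanishing coordinate. *)
Lemma smooth_deriv v j : F.@[v] = 0 -> v (low j) != 0 ->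
  ((forall i, grad f (fun j => v (low j)) i = 0) -> forall i, v (low i) = 0) ->
  exists2 i, i != low j & F^`M(i).@[v] != 0.
Proof.
move=> Fv vj crit; apply: boolp.contrapT => H.
have D0 i : i != low j -> F^`M(i).@[v] = 0.
  by move=> ij; apply: boolp.contrapT => /eqP Di; apply: H; exists i.
have vh : v hi6 = 0.
  have : F^`M(hi6).@[v] = 0 by apply: D0; rewrite eq_sym low_neq_hi.
  rewrite deriv_cover_hi -mulr_natr => /eqP; rewrite mulf_eq0.
  case: (p) p_gt1 => // p' _; rewrite (negPf (charK p')) orbF expf_eq0 => /andP[_ /eqP //].
have g0 i : i != j -> grad f (fun j => v (low j)) i = 0.
  by move=> ij; apply/eqP; rewrite -oppr_eq0 -deriv_cover_low D0.
have fv : ev (fun j => v (low j)) f = 0.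
  move: Fv; rewrite meval_cover vh expr0n eqn0Ngt (ltnW p_gt1) sub0r.
  by move/eqP; rewrite oppr_eq0 => /eqP.
have := euler_ev (fun j => v (low j)) f_homog; rewrite fv mul0rn (bigD1 j) //= big1 => [|i ij].
  rewrite addr0 mulrnAr -[_ *+ w j]mulr_natr => /eqP; rewrite mulf_eq0.
  case: (w j) (w_gt0 j) => // n _; rewrite (negPf (charK n)) orbF mulf_eq0 (negPf vj) orbF.
  move/eqP => gj; have : v (low j) = 0.
    by apply: crit => i; have [->|/g0] := eqVneq i j.
  by move/eqP; rewrite (negPf vj).
by rewrite [ev _ _]g0 // mul0r.
Qed.

Lemma smooth_chart v j : w j = 1%N -> F.@[v] = 0 -> v (low j) != 0 ->
  ((forall i, grad f (fun j => v (low j)) i = 0) -> forall i, v (low i) = 0) ->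
  @regular_local K (wproj w6) 4 F v.
Proof.
move=> wj Fv vj crit; have [i1 i1j di1] := smooth_deriv Fv vj crit.
have hT1 : whomog w6 1 ('X_(low j) : {mpoly K[6]}).
  have w6j : w6 (low j) = 1%N by rewrite /w6 split6_low.
  by rewrite -[X in whomog _ X _]w6j; exact: whomogXU.
have hT2 : whomog w6 0 (1 : {mpoly K[6]}) by exact: whomog1.
have T1v : ('X_(low j) : {mpoly K[6]}).@[v] != 0 by rewrite mevalXU.
have T2v : (1 : {mpoly K[6]}).@[v] != 0 by rewrite meval1 oner_neq0.
pose tau := chart w6 ('X_(low j) : {mpoly K[6]}) 1.
pose xi := chart_val w6 v 'X_(low j) 1.
(* Of the six chart coordinates one is constantly 1 and another is eliminated by the equation, which
   leaves four generators. *)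
pose s := enum (~: [set low j; i1]).
have sizes : size s = 4%N.
  by rewrite -cardE cardsCs setCK card_ord cards2 eq_sym i1j.
pose g (l : 'I_4) := tau (nth i1 s l) - tofrac (xi (nth i1 s l))%:MP.
have Fxi : F^`M(i1).@[xi] != 0.
  rewrite (whomog_meval _ _ (whomog_deriv (j := i1) (@cover_homog K))) mulf_neq0 //.
  by rewrite expf_neq0 // invr_neq0 // mulf_neq0 ?invr_neq0.
have gen i : i != i1 -> generated w6 v F g (tau i - tofrac (xi i)%:MP).
  move=> ii1; have [->|ij] := eqVneq i (low j).
    have -> : tau (low j) - tofrac (xi (low j))%:MP = 0.
      rewrite /tau /xi /chart /chart_val mevalXU meval1 rmorph1 !divr1 /w6 split6_low wj !expr1.
      by rewrite mulVf // mpolyC1 rmorph1 divff ?subrr // tofrac_eq0; apply: contraNneq T1v => ->; rewrite meval0.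
    exact/generated_ideal/loc_ideal0.
  have is_ : i \in s by rewrite mem_enum !inE (negPf ij) (negPf ii1).
  have il : (index i s < 4)%N by have := is_; rewrite -index_mem sizes.
  have := @generated_gen K _ w6 v F _ g (Ordinal il).
  by rewrite /g /= nth_index.
apply: (regular_of_generated (g := g) hT1 hT2 T1v T2v) => [l|i].
  exact: (chart_gen_loc hT1 hT2 T1v).
have [->|/gen //] := eqVneq i i1.
exact: (generated_elim (@cover_homog K) Fv hT1 hT2 T1v T2v Fxi gen).
Qed.

End SmoothCover.

Section SmoothLoops.
Variable K : closedFieldType.
Hypothesis charK : forall n, n.+1%:R != 0 :> K.

Lemma loop5_homog r : whomog (fun=> 1%N) r.+1 (loop5 r).
Proof.
have H i j : whomog (fun=> 1%N) r.+1 ('X_i ^+ r * 'X_j : {mpoly int[5]}).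
  have -> : r.+1 = (r * 1 + 1)%N by rewrite muln1 addn1.
  by apply: whomogM; [apply: whomogX|]; exact: (@whomogXU _ _ (fun=> 1%N)).
by rewrite /loop5; do 4!apply: whomogD => //.
Qed.

Lemma loop4_homog : whomog wt4 10 loop4.
Proof.
have H i j : wt4 i = 1%N -> wt4 j = 1%N -> whomog wt4 10 ('X_i ^+ 9 * 'X_j : {mpoly int[5]}).
  move=> wi wj; rewrite (_ : 10 = 9 * wt4 i + wt4 j)%N; last by rewrite wi wj.
  by apply: whomogM; [apply: whomogX|]; exact: whomogXU.
apply: whomogD; last by rewrite (_ : 10 = 5 * wt4 o4)%N //; apply: whomogX; exact: whomogXU.
by do 3!(apply: whomogD; last exact: H); exact: H.
Qed.

Lemma natr_neq0 n : (0 < n)%N -> n%:R != 0 :> K. Proof. by case: n. Qed.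

(* Around the cycle, the monomials [y_i ^ r y_{i+1}] are multiplied by [- r]. *)
Lemma cycle_vanish n r m : (1 < r)%N -> (0 < n)%N -> m = (- r%:R) ^+ n * m :> K -> m = 0.
Proof.
move=> r1 n0 mE; apply/eqP; apply: contraTT isT => m0; apply/negP => _.
have E : (- r%:R) ^+ n = 1 :> K by apply: (mulIf m0); rewrite -mE mul1r.
have r2 : (1 < r ^ (2 * n))%N.
  by rewrite -[X in (X < _)%N](exp1n (2 * n)) ltn_exp2r // muln_gt0.
have : (r ^ (2 * n) - 1)%:R = 0 :> K.
  rewrite natrB ?(ltnW r2) // natrX mulr1n; apply/eqP; rewrite subr_eq0; apply/eqP.
  by rewrite exprM -sqrrN -exprM mulnC exprM E expr1n.
by apply/eqP/natr_neq0; rewrite subn_gt0.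
Qed.

Lemma loop5_crit r (y : 'I_5 -> K) : (1 < r)%N -> (forall i, grad (loop5 r) y i = 0) ->
  forall i, y i = 0.
Proof.
move=> r1 gy; pose m i := y i ^+ r * y (succ5 i).
have r0 : (0 < r)%N by apply: ltnW.
(* [y i] times the partial derivative along [i] is [r * m i + m (pred5 i)]. *)
have step i : m (pred5 i) = - r%:R * m i.
  have E : y i * (y i ^+ r.-1 * y (succ5 i) *+ r + y (pred5 i) ^+ r) = 0.
    by rewrite -grad_loop5 gy mulr0.
  have pi : succ5 (pred5 i) = i by move: i {E}; elim/ord5_ind.
  rewrite /m pi mulNr; apply/eqP; rewrite -addr_eq0; apply/eqP; rewrite -[RHS]E.
  rewrite mulrDr mulrnAr mulrA -exprS prednK // addrC [y i * _]mulrC.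
  by rewrite mulr_natl.
have m0 i : m i = 0.
  apply: (@cycle_vanish 5 r) => //.
  have -> : (- r%:R) ^+ 5 * m i = m (pred5 (pred5 (pred5 (pred5 (pred5 i))))).
    by rewrite !step !mulrA -!expr2 -!exprSr !exprS expr0 mulr1 !mulrA.
  by move: i; elim/ord5_ind.
move=> i; have := gy (succ5 i); rewrite grad_loop5.
have -> : pred5 (succ5 i) = i by move: i; elim/ord5_ind.
have /eqP : m (succ5 i) = 0 by [].
rewrite mulf_eq0 expf_eq0 r0 => /orP[/eqP ->|/eqP ->]; last first.
  by rewrite mulr0 mul0rn add0r => /eqP; rewrite expf_eq0 r0 => /eqP.
rewrite expr0n; case: (r) r1 => [|[|r']] // _; rewrite mul0r mul0rn add0r => /eqP.
by rewrite expf_eq0 => /eqP.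
Qed.

Lemma loop4_crit (y : 'I_5 -> K) : (forall i, grad loop4 y i = 0) -> forall i, y i = 0.
Proof.
move=> gy.
have g4 i : (val i < 4)%N -> y i ^+ 8 * y (succ4 i) *+ 9 + y (pred4 i) ^+ 9 = 0.
  by move=> i4; rewrite -(gy i) grad_loop4; move: i i4; elim/ord5_ind.
have ps i : (val i < 4)%N -> [/\ succ4 (pred4 i) = i, pred4 (succ4 i) = i & (val (pred4 i) < 4)%N && (val (succ4 i) < 4)%N].
  by move: i; elim/ord5_ind.
pose m i := y i ^+ 9 * y (succ4 i).
have step i : (val i < 4)%N -> m (pred4 i) = - 9%:R * m i.
  move=> i4; have [pi _ _] := ps i i4.
  have E : y i * (y i ^+ 8 * y (succ4 i) *+ 9 + y (pred4 i) ^+ 9) = 0 by rewrite g4 ?mulr0.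
  rewrite /m pi mulNr; apply/eqP; rewrite -addr_eq0; apply/eqP; rewrite -[RHS]E.
  by rewrite mulrDr mulrnAr mulrA -exprS addrC [y i * _]mulrC mulr_natl.
have m0 i : (val i < 4)%N -> m i = 0.
  move=> i4; apply: (@cycle_vanish 4 9) => //.
  have -> : (- 9%:R) ^+ 4 * m i = m (pred4 (pred4 (pred4 (pred4 i)))).
    by rewrite !step //; [rewrite !mulrA -!expr2 -!exprSr !exprS expr0 mulr1 !mulrA | | |]; move: i i4; elim/ord5_ind.
  by move: i i4; elim/ord5_ind.
have y4 i : (val i < 4)%N -> y i = 0.
  move=> i4; have [_ si /andP[_ s4]] := ps i i4; have := g4 _ s4; rewrite si.
  have /eqP := m0 _ s4; rewrite mulf_eq0 expf_eq0 /= => /orP[/eqP ->|/eqP ->].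
    by rewrite expr0n mul0r mul0rn add0r => /eqP; rewrite expf_eq0 => /eqP.
  by rewrite mulr0 mul0rn add0r => /eqP; rewrite expf_eq0 => /eqP.
elim/ord5_ind; try exact: y4.
have := gy o4; rewrite grad_loop4 /= -mulr_natr => /eqP.
by rewrite mulf_eq0 (negPf (charK 4)) orbF expf_eq0 => /eqP.
Qed.

End SmoothLoops.

Lemma ev_loop4 (R : comNzRingType) (y : 'I_5 -> R) :
  ev y loop4 = y o0 ^+ 9 * y o1 + y o1 ^+ 9 * y o2 + y o2 ^+ 9 * y o3
    + y o3 ^+ 9 * y o0 + y o4 ^+ 5.
Proof.
have evD (P Q : {mpoly int[5]}) : ev y (P + Q) = ev y P + ev y Q by exact: rmorphD.
have evM (P Q : {mpoly int[5]}) : ev y (P * Q) = ev y P * ev y Q by exact: rmorphM.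
have evX i k : ev y ('X_i ^+ k) = y i ^+ k.
  by elim: k => [|k IHk]; [exact: rmorph1 | rewrite !exprS evM IHk evXU].
have evXM i j : ev y ('X_i ^+ 9 * 'X_j) = y i ^+ 9 * y j by rewrite evM evX evXU.
by rewrite /loop4 evD (evX o4 5) 3!evD !evXM.
Qed.

Section SmoothPoints.
Variable K : closedFieldType.
Hypothesis charK : forall n, n.+1%:R != 0 :> K.

Lemma ev_zero (w : 'I_5 -> nat) d (f : {mpoly int[5]}) (y : 'I_5 -> K) :
  (0 < d)%N -> (forall i, 0 < w i)%N -> whomog w d f -> (forall i, y i = 0) -> ev y f = 0.
Proof.
move=> d0 w0 hf y0; rewrite (_ : y = fun i => 0 ^+ w i * y i).
  by rewrite (ev_scale _ _ hf) expr0n eqn0Ngt d0 mul0r.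
by apply: boolp.funext => i; rewrite y0 mulr0.
Qed.

Lemma smooth_loop5 r e p (v : 'I_6 -> K) : (1 < r)%N -> (1 < p)%N -> r.+1 = (e * p)%N ->
  @ispt K (wproj (split6 (fun=> 1%N) e)) v ->
  ('X_hi6 ^+ p - liftf (loop5 r) K).@[v] = 0 ->
  @regular_local K (wproj (split6 (fun=> 1%N) e)) 4 ('X_hi6 ^+ p - liftf (loop5 r) K) v.
Proof.
move=> r1 p1 dE ptv Fv.
have [[j vj]|v0] := boolp.pselect (exists j, v (low j) != 0).
  apply: (smooth_chart charK _ p1 dE (@loop5_homog r) _ Fv vj) => //.
  exact: (loop5_crit charK r1).
have {}v0 j : v (low j) = 0.
  by apply: boolp.contrapT => /eqP vj; apply: v0; exists j.
have [i _] := ptv ord0; move: i; apply: split6_ind => [j|]; first by rewrite v0 eqxx.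
have ev0 : ev (fun j => v (low j)) (loop5 r) = 0.
  exact: (@ev_zero (fun=> 1%N) r.+1 _ _ _ _ (@loop5_homog r)).
by move/eqP: Fv; rewrite meval_cover ev0 subr0 expf_eq0 => /andP[_ ->].
Qed.

(* At the two points of the line of singular points of the ambient space, a generator of the
   sheaf of degree one forms is given by [w / z ^ 2]. *)
Lemma smooth_loop4 (v : 'I_6 -> K) :
  @ispt K (wproj (split6 wt4 5)) v ->
  ('X_hi6 ^+ 2 - liftf loop4 K).@[v] = 0 ->
  @regular_local K (wproj (split6 wt4 5)) 4 ('X_hi6 ^+ 2 - liftf loop4 K) v.
Proof.
move=> ptv Fv.
have w_gt0 j : (0 < wt4 j)%N by move: j; elim/ord5_ind.
have [[j [wj vj]]|v0] := boolp.pselect (exists j, wt4 j = 1%N /\ v (low j) != 0).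
  apply: (@smooth_chart K wt4 5 10 2 loop4 charK w_gt0 _ _ loop4_homog _ _ wj Fv vj) => //.
  exact: (loop4_crit charK).
have {}v0 j : wt4 j = 1%N -> v (low j) = 0.
  by move=> wj; apply: boolp.contrapT => /eqP vj; apply: v0; exists j.
have vwz : v hi6 ^+ 2 = v (low o4) ^+ 5.
  apply/eqP; rewrite -subr_eq0; apply/eqP; rewrite -[RHS]Fv meval_cover; congr (_ - _).
  by rewrite ev_loop4 (v0 o0) ?(v0 o1) ?(v0 o2) ?(v0 o3) // !mulr0 !add0r.
have vz : v (low o4) != 0.
  apply/eqP => vz; have [i _] := ptv ord0; move: i; apply: split6_ind => [|].
    by elim/ord5_ind; rewrite ?vz ?(v0 o0) ?(v0 o1) ?(v0 o2) ?(v0 o3) // eqxx.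
  by move/eqP: vwz; rewrite vz expr0n expf_eq0 /= => ->.
have vw : v hi6 != 0.
  by apply: contraNneq vz => vw; move/eqP: vwz; rewrite vw expr0n /= eq_sym expf_eq0.
pose w6 := split6 wt4 5.
pose F : {mpoly K[6]} := 'X_hi6 ^+ 2 - liftf loop4 K.
have w6z : w6 (low o4) = 2%N by rewrite /w6 split6_low.
have w6w : w6 hi6 = 5%N by rewrite /w6 split6_hi.
pose T1 : {mpoly K[6]} := 'X_hi6; pose T2 : {mpoly K[6]} := 'X_(low o4) ^+ 2.
have hT1 : whomog w6 5 T1 by rewrite -[X in whomog _ X _]w6w; exact: whomogXU.
have hT2 : whomog w6 4 T2.
  rewrite [X in whomog _ X _](_ : _ = 2 * w6 (low o4))%N ?w6z //; apply: whomogX.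
  by rewrite -[X in whomog _ X _]w6z; exact: whomogXU.
have T1v : T1.@[v] != 0 by rewrite mevalXU.
have T2v : T2.@[v] != 0 by rewrite mevalXn mevalXU expf_neq0.
have hF : whomog w6 10 F by exact: (@cover_homog wt4 5 10 2 loop4 _ loop4_homog).
pose tau := chart w6 T1 T2; pose xi := chart_val w6 v T1 T2.
have xi0 j : wt4 j = 1%N -> xi (low j) = 0.
  by move=> wj; rewrite /xi /chart_val v0 // mulr0.
pose g (l : 'I_4) := tau (low (widen_ord (leqnSn 4) l)).
have gen0 j : wt4 j = 1%N -> generated w6 v F g (tau (low j)).
  move=> wj; have j4 : (val j < 4)%N by move: j wj; elim/ord5_ind.
  have := @generated_gen K _ w6 v F _ g (Ordinal j4).
  by rewrite /g (_ : widen_ord _ _ = j) //; apply: val_inj.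
have g_loc l : loc w6 v (g l) 0.
  have := chart_loc hT1 hT2 T1v (low (widen_ord (leqnSn 4) l)).
  by rewrite -/xi xi0 //; move: l; case=> [[|[|[|[|]]]]].
pose s := tau (low o4).
have zn (P : {mpoly K[6]}) : P.@[v] != 0 -> tofrac P != 0.
  by rewrite tofrac_eq0; apply: contraNneq => ->; rewrite meval0.
have Z0 : tofrac ('X_(low o4) : {mpoly K[6]}) != 0 by rewrite zn ?mevalXU.
have W0 : tofrac ('X_hi6 : {mpoly K[6]}) != 0 by rewrite zn ?mevalXU.
(* Both sides are [z ^ 10 / w ^ 4], with [w] the last coordinate and [z] the one of weight 2. *)
have tau_w : tau hi6 = s ^+ 2.
  rewrite /s /tau /chart w6w w6z /T1 /T2 rmorphXn.
  have key (L : fieldType) (W Z : L) : W != 0 -> Z != 0 ->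
      W / (W / Z ^+ 2) ^+ 5 = (Z / (W / Z ^+ 2) ^+ 2) ^+ 2.
    by move=> ? ?; field; apply/andP.
  exact: (key _ _ _ W0 Z0).
have xi_z : xi (low o4) = 1.
  rewrite /xi /chart_val w6z mevalXU mevalXn mevalXU invf_div expr_div_n mulrAC -exprM -exprSr.
  by rewrite -vwz divff // expf_neq0.
have xi_w : xi hi6 = 1.
  rewrite /xi /chart_val w6w mevalXU mevalXn mevalXU invf_div expr_div_n.
  rewrite -exprM (_ : (2 * 5 = 5 * 2)%N) // exprM -vwz -exprM mulrAC -exprSr divff //.
  by rewrite expf_neq0.
have s_loc : loc w6 v s 1 by rewrite -xi_z; exact: (chart_loc hT1 hT2 T1v).
have s_neq0 : s != 0 := loc_neq0 (oner_neq0 _) s_loc.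
pose N := tau (low o0) ^+ 9 * tau (low o1) + tau (low o1) ^+ 9 * tau (low o2)
  + tau (low o2) ^+ 9 * tau (low o3) + tau (low o3) ^+ 9 * tau (low o0).
have F_tau : subst tau F = s ^+ 4 - s ^+ 5 - N.
  have -> : subst tau F = tau hi6 ^+ 2 - ev (fun j => tau (low j)) loop4.
    rewrite /F rmorphB rmorphXn; congr (_ ^+ _ - _); first exact: substXU.
    rewrite /liftf rmorph_mmap_int; apply: eq_mmap => // j; exact: substXU.
  by rewrite ev_loop4 -/N tau_w -exprM -/s; ring.
have gen_N : generated w6 v F g N.
  have gm i j : wt4 j = 1%N -> generated w6 v F g (tau i ^+ 9 * tau (low j)).
    by move=> wj; apply: generatedM (locX 9 (chart_loc hT1 hT2 T1v _)) (gen0 _ wj).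
  by do 3!(apply: generatedD; last exact: gm); exact: gm.
have gen_s : generated w6 v F g (s - 1).
  (* In the chart the equation reads [s ^ 4 * (1 - s) = N] with [s] invertible at the point, so it
     eliminates [s - 1], and the coordinates of weight 1 generate. *)
  have -> : s - 1 = - (s ^- 4) * (subst tau F + N).
    have key (L : fieldType) (x : L) : x != 0 -> x - 1 = - (x ^- 4) * (x ^+ 4 - x ^+ 5).
      by move=> ?; field.
    by rewrite F_tau subrK; exact: (key _ s s_neq0).
  have loc4 : loc w6 v (- (s ^- 4)) (- (1 ^+ 4)^-1).
    by apply/locN/locV; [rewrite expr1n oner_neq0 | exact: locX].
  apply: (generatedM loc4); apply: generatedD => //.
  exact/generated_ideal/(chart_ideal hF hT1 hT2 T1v T2v).
apply: (regular_of_generated (g := g) hT1 hT2 T1v T2v) => //.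
apply: split6_ind => [j|]; last first.
  rewrite -/tau -/xi tau_w xi_w mpolyC1 rmorph1 (_ : s ^+ 2 - 1 = (s + 1) * (s - 1)); last by ring.
  exact: generatedM (locD s_loc (loc1 _ _)) gen_s.
rewrite -/tau -/xi; have [wj|] := eqVneq (wt4 j) 1%N.
  by rewrite xi0 // mpolyC0 rmorph0 subr0; exact: gen0.
by move: j; elim/ord5_ind => // _; rewrite xi_z mpolyC1 rmorph1.
Qed.

End SmoothPoints.

(** * Very general members *)

Section Monomials.
Variables (a : 6.-tuple nat) (d : nat).
Hypothesis a_gt0 : forall i, (0 < tnth a i)%N.

Lemma mem_wmonomials (m : 'X_{1..6}) :
  (m \in wmonomials a d) = (\sum_i tnth a i * m i == d)%N.
Proof.
apply/mapP/eqP => [[bm]|mE].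
  by rewrite mem_filter => /andP[/eqP + _] ->.
have md : (mdeg m < d.+1)%N.
  by rewrite ltnS -mE mdegE; apply: leq_sum => i _; rewrite leq_pmull.
by exists (BMultinom md) => //; rewrite mem_filter mem_enum andbT /= mE.
Qed.

Lemma wmonomials_uniq : uniq (wmonomials a d).
Proof.
rewrite map_inj_uniq ?filter_uniq ?enum_uniq //; last exact: val_inj.
by rewrite -enumT enum_uniq.
Qed.

Local Notation mon := (tnth (in_tuple (wmonomials a d))).

Lemma sum_wmonomials (S : nzRingType) (P : {mpoly S[6]}) : whomog (tnth a) d P ->
  \sum_(i < size (wmonomials a d)) P@_(mon i) *: 'X_[mon i] = P.
Proof.
move=> hP; rewrite -(big_tnth _ _ _ xpredT (fun m => P@_m *: 'X_[m])) /=.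
apply/mpolyP => m; rewrite raddf_sum /=.
rewrite (eq_bigr (fun m' => if m' == m then P@_m else 0)) => [|m' _]; last first.
  by rewrite mcoeffZ mcoeffX; case: eqP => [->|_]; rewrite ?mulr1 ?mulr0.
have [mw|mw] := boolP (m \in wmonomials a d).
  rewrite (bigD1_seq m) ?wmonomials_uniq //= eqxx big1 ?addr0 // => m' /negPf -> //.
rewrite big_seq big1 => [|m' m'w]; last first.
  by case: eqP => // m'E; rewrite -m'E m'w in mw.
apply/esym/eqP; rewrite mcoeff_eq0; apply: contra mw => /hP mE.
by rewrite mem_wmonomials mE.
Qed.

Lemma mcoeff_wmonomials (S : nzRingType) (g : 'I_(size (wmonomials a d)) -> S) i :
  (\sum_i g i *: 'X_[mon i])@_(mon i) = g i.
Proof.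
rewrite raddf_sum /= (bigD1 i) //= mcoeffZ mcoeffX eqxx mulr1 big1 ?addr0 // => j ji.
rewrite mcoeffZ mcoeffX; case: eqP => [E|_]; last by rewrite mulr0.
case/eqP: ji; apply/val_inj/eqP; move: E => /eqP.
rewrite !(tnth_nth 0%MM) /= nth_uniq ?wmonomials_uniq //.
Qed.

Lemma wmonomials_homog (S : nzRingType) (g : 'I_(size (wmonomials a d)) -> S) :
  whomog (tnth a) d (\sum_i g i *: 'X_[mon i]).
Proof.
apply: whomog_sum => i _; rewrite -mul_mpolyC -[X in whomog _ X _]add0n.
apply: whomogM; first exact: whomogC.
have mE : (\sum_j tnth a j * mon i j)%N = d.
  by apply/eqP; rewrite -mem_wmonomials mem_tnth.
by rewrite -[X in whomog _ X _]mE; exact: whomog_monomial.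
Qed.

End Monomials.

(** Relations between the coefficients are found in the chart where coordinate [i1] is 1, while
    closed sets are cut out by forms; powers of that coordinate make up the missing degree. *)
Lemma homogenize n (i1 : 'I_n) (P : {mpoly int[n]}) :
  exists D Q, whomog (fun=> 1%N) D Q /\
    forall (S : comNzRingType) (y : 'I_n -> S) c, y i1 = 1 ->
      mmap (intmul 1) (fun i => c * y i) Q = c ^+ D * mmap (intmul 1) y P.
Proof.
pose D := msize P; pose h m : 'X_{1..n} := (m + U_(i1) *+ (D - mdeg m))%MM.
have hE m : m \in msupp P -> (\sum_i h m i)%N = D.
  move=> mP; rewrite -mdegE mdegD mdegMn mdeg1 mul1n subnKC //.
  by rewrite ltnW // msize_mdeg_lt.
exists D, (\sum_(m <- msupp P) P@_m *: 'X_[h m]); split.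
  apply: whomog_sum => m mP; rewrite -mul_mpolyC -[D]add0n; apply: whomogM; first exact: whomogC.
  rewrite -(hE m mP) (eq_bigr (fun i => 1 * h m i)%N) => [|i _]; last by rewrite mul1n.
  exact: whomog_monomial.
move=> S y c y1; rewrite raddf_sum /= [in RHS]/mmap big_distrr; apply: eq_big_seq => m mP /=.
rewrite mmapZ mmapX mulrCA; congr (_ * _); rewrite /mmap1.
rewrite (eq_bigr (fun i => c ^+ h m i * y i ^+ h m i)) => [|i _]; last by rewrite exprMn.
rewrite big_split prodrXr hE //=; congr (_ * _).
apply: eq_bigr => i _; rewrite mnmDE mulmnE mnm1E.
by case: eqP => [<-|_]; rewrite ?mul0n ?addn0 // y1 !expr1n.
Qed.

Lemma meval_map_int (R : comNzRingType) n (v : 'I_n -> R) (P : {mpoly int[n]}) :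
  (map_mpoly (intmul 1) P).@[v] = mmap (intmul 1) v P.
Proof.
rewrite -[LHS]/(meval v _) /map_mpoly mmap_comp_rmorph.
by apply: eq_mmap => i /=; [exact: mevalC | exact: mevalXU].
Qed.

Lemma liftf_hi (R : comNzRingType) f m : m \in msupp (liftf f R) -> m hi6 = 0%N.
Proof.
have hf : whomog (fun=> 0%N) 0 f by move=> m' _; apply: big1 => i _; rewrite mul0n.
move=> /(liftf_homog 1 hf)/eqP; rewrite sum_nat_eq0 => /forallP/(_ hi6).
by rewrite split6_hi mul1n => /eqP.
Qed.

Section Assembly.
Variable K : closedFieldType.
Hypothesis charK : forall n, n.+1%:R != 0 :> K.
Variables (a : 6.-tuple nat) (w : 'I_5 -> nat) (e d kappa p : nat) (f : {mpoly int[5]}).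
Hypothesis aE : forall i, tnth a i = split6 w e i.
Hypothesis w_gt0 : forall j, (0 < w j)%N.
Hypothesis w_o0 : w o0 = 1%N.
Hypothesis w_dvd2 : forall j, (w j %| 2)%N.
Hypothesis e_gt0 : (0 < e)%N.
Hypothesis dE : (kappa + \sum_i w i)%N = d.
Hypothesis d_ep : d = (e * p)%N.
Hypothesis p_prime : prime p.
Hypothesis f_homog : whomog w d f.
Hypothesis f_local : local_condition w kappa p f.
Hypothesis f4_neq0 : forall k : fieldType, p%:R = 0 :> k -> (map_mpoly (intmul 1) f : {mpoly k[5]})^`M(o4) != 0.
Hypothesis smooth : forall v, @ispt K (wproj (split6 w e)) v ->
  ('X_hi6 ^+ p - liftf f K).@[v] = 0 ->
  @regular_local K (wproj (split6 w e)) 4 ('X_hi6 ^+ p - liftf f K) v.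

Let aE' : tnth a = split6 w e. Proof. exact: boolp.funext. Qed.
Let a_gt0 i : (0 < tnth a i)%N.
Proof. by rewrite aE; move: i; apply: split6_ind => [j|]; rewrite ?split6_low ?split6_hi. Qed.

Let N := size (wmonomials a d).
Local Notation mon := (tnth (in_tuple (wmonomials a d))).

Let cover (R : comNzRingType) : {mpoly R[6]} := 'X_hi6 ^+ p - liftf f R.
Let cover_hom R : whomog (tnth a) d (cover R).
Proof. by rewrite aE'; exact: cover_homog. Qed.

Let cover_map (R : comNzRingType) : map_mpoly (intmul 1) (cover int) = cover R.
Proof.
rewrite /cover rmorphB rmorphXn /= map_mpolyX; congr (_ - _).
rewrite /liftf rmorph_mmap_int; apply: eq_mmap => // j; exact: map_mpolyX.
Qed.

Let cz (i : 'I_N) : int := (cover int)@_(mon i).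

Let cover_sum (R : comNzRingType) : \sum_i ((cz i)%:~R : R) *: 'X_[mon i] = cover R.
Proof.
rewrite -cover_map -[in RHS](sum_wmonomials a_gt0 (@cover_hom int)) raddf_sum.
by apply: eq_bigr => i _ /=; rewrite map_mpolyZ map_mpolyX.
Qed.

Let lead : 'X_{1..6} := (U_(hi6) *+ p)%MM.

Let lead_mem : lead \in wmonomials a d.
Proof.
rewrite mem_wmonomials // (bigD1 hi6) //= big1 => [|i ih].
  by rewrite addn0 aE split6_hi mulmnE mnm1E eqxx mul1n d_ep.
by rewrite mulmnE mnm1E eq_sym (negPf ih) mul0n muln0.
Qed.

Let i1 : 'I_N := sval (seq_tnthP lead_mem).
Let i1E : mon i1 = lead. Proof. by rewrite /i1; case: seq_tnthP. Qed.

Let cz1 : cz i1 = 1.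
Proof.
rewrite /cz i1E /cover mcoeffB mpolyXn mcoeffX eqxx.
suff /memN_msupp_eq0 -> : lead \notin msupp (liftf f int) by rewrite subr0.
apply/negP => /liftf_hi/eqP; rewrite mulmnE mnm1E eqxx mul1n.
by rewrite eqn0Ngt prime_gt0.
Qed.

Let evp (P : {mpoly int[N]}) : 'F_p := mmap (intmul 1) (fun i => (cz i)%:~R) P.
HB.instance Definition _ := GRing.RMorphism.copy evp (mmap (intmul 1) (fun i => ((cz i)%:~R : 'F_p))).

(** The integer forms that do not vanish modulo [p] at the degenerate equation; a very general
    member avoids the zeros of all of them. *)
Let good P := (exists D, whomog (fun=> 1%N) D P) /\ evp P != 0.

Let code (s : nat) : {mpoly int[N]} :=
  if (unpickle s : option (seq (int * 'X_{1..N}))) is Some l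
  then \sum_(x <- l) x.1 *: 'X_[x.2] else 0.

Let code_onto P : exists s, code s = P.
Proof.
exists (pickle [seq (P@_m, m) | m <- msupp P]).
by rewrite /code pickleK big_map [RHS]mpolyE.
Qed.

(** A number that codes no form of this kind gets the constant 1, whose zero set is empty, so that
    every index defines a proper closed set. *)
Let T s (q : {mpoly K[N]}) :=
  (good (code s) /\ q = map_mpoly (intmul 1) (code s)) \/ (~ good (code s) /\ q = 1).

Let Z s (v : 'I_(nv (param_space a d)) -> K) := ispt v /\ forall q, T s q -> q.@[v] = 0.

Let cK (i : 'I_N) : K := (cz i)%:~R.

Let wformE (c : 'I_(nv (param_space a d)) -> K) : wform c = \sum_i c i *: 'X_[mon i].
Proof. by []. Qed.

Let Z_closed s : zclosed (Z s).
Proof.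
exists (T s) => // q Tq.
have [D hq] : exists D, whomog (fun=> 1%N) D q.
  case: Tq => [[[[D hD] _] ->]|[_ ->]]; last by exists 0%N; exact: whomog1.
  exists D => m; rewrite mcoeff_msupp mcoeff_map_mpoly => nz; apply: hD.
  by rewrite mcoeff_msupp; apply: contraNneq nz => /= ->.
exists (fun=> D) => m mq j; rewrite -(hq m mq); apply: eq_bigl => i.
by rewrite [j]ord1.
Qed.

Let family_cK : nonsingular_family cK.
Proof.
split=> [j|v]; first by exists i1; rewrite /cK ?cz1 ?oner_neq0 // [j]ord1.
rewrite /hypersurface /nonsingular; have -> : wform cK = cover K by exact: cover_sum.
by rewrite aE' => -[]; exact: smooth.
Qed.

(** The value of the form at the integers [cz] is not zero modulo [p]; hence it is a nonzero
    integer, and stays nonzero in characteristic 0. *)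
Let Z_cK s : ~ Z s cK.
Proof.
move=> [_ H]; have [gs|ngs] := boolp.pselect (good (code s)); last first.
  have /eqP : (1 : {mpoly K[N]}).@[cK] = 0 by apply: H; right.
  by rewrite meval1 oner_eq0.
have : (map_mpoly (intmul 1) (code s)).@[cK] = 0 by apply: H; left.
have [_ /eqP gp] := gs; move=> Ps; apply: gp; move: Ps; rewrite meval_map_int /evp.
have E (R : comNzRingType) : mmap (intmul 1) (fun i => (cz i)%:~R : R) (code s)
    = (mmap (intmul 1) cz (code s))%:~R by rewrite (rmorph_mmap_int (intmul 1)).
rewrite !E; case: (mmap _ _ _) => n.
  by case: n => // n /eqP; rewrite (negPf (charK n)).
by rewrite NegzE mulrNz => /eqP; rewrite oppr_eq0 (negPf (charK n)).
Qed.

Let degenerate c : nonsingular_family c -> (forall s, ~ Z s c) ->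
  ~ stably_rational (hypersurface c).
Proof.
move=> [ptc _] nZ.
have avoid P : good P -> mmap (intmul 1) c P != 0.
  move=> gP; have [s sE] := code_onto P; apply/eqP => Pc; apply: (nZ s); split=> // q.
  by case=> [[_ ->]|[]]; rewrite sE // meval_map_int.
have evpX i : evp 'X_i = (cz i)%:~R by rewrite /evp mmapX mmap1U.
pose c1 := c i1; have c10 : c1 != 0.
  have /avoid : good 'X_i1.
    split; first by exists 1%N; exact: (@whomogXU _ _ (fun=> 1%N)).
    by rewrite evpX cz1 oner_neq0.
  by rewrite mmapX mmap1U.
pose y i := c i / c1.
have y1 : y i1 = 1 by rewrite /y divff.
pose val (P : {mpoly int[N]}) : K := mmap (intmul 1) y P.
have valB P Q : val (P - Q) = val P - val Q by exact: (raddfB (mmap (intmul 1) y)).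
have valM P Q : val (P * Q) = val P * val Q by exact: (rmorphM (mmap (intmul 1) y)).
have valC z : val z%:MP = z%:~R by exact: mmapC.
have valX i : val 'X_i = y i by rewrite /val mmapX mmap1U.
have evpC z : evp z%:MP = z%:~R by exact: mmapC.
have evpB P Q : evp (P - Q) = evp P - evp Q by exact: (raddfB evp).
have evpM P Q : evp (P * Q) = evp P * evp Q by exact: (rmorphM evp).
(* The ring generated by the affine coefficients [y], with the values of the polynomials that vanish
   modulo [p] at the degenerate equation. A place over this pair specializes [y] to the degenerate
   coefficients. *)
pose S0 (x : K * bool) := exists2 P, val P = x.1 & x.2 || (evp P == 0).
have pair_S0 : ring_ideal_pair S0.
  split.
  - split; first by exists 1%:MP; rewrite ?valC.
    by exists 0%:MP; rewrite ?valC // evpC eqxx.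
  - move=> x z b [P /= <- Pb] [Q /= <- Qb]; exists (P - Q); rewrite ?valB //=.
    move: Pb Qb; case: b => //= /eqP P0 /eqP Q0.
    by rewrite evpB P0 Q0 subrr.
  - move=> x z b [P /= <- _] [Q /= <- Qb]; exists (P * Q); rewrite ?valM //=.
    move: Qb; case: b => //= /eqP Q0.
    by rewrite evpM Q0 mulr0.
  - by move=> x [P /= <- _]; exists P.
  (* If 1 were in the ideal, the form obtained from [1 - P] would satisfy [good] and vanish at
     [c]. *)
  move=> [P /= P1 /eqP P0].
  have [D [Q [hQ QE]]] := homogenize i1 (1%:MP - P).
  have /avoid/eqP : good Q.
    split; first by exists D.
    have := QE _ (fun i => (cz i)%:~R : 'F_p) 1; rewrite cz1 => /(_ erefl).
    rewrite (eq_mmap (h' := intmul 1) (v' := fun i => (cz i)%:~R)) => // [|i]; last by rewrite mul1r.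
    by rewrite /evp => ->; rewrite expr1n mul1r -/(evp _) evpB P0 evpC subr0 oner_neq0.
  apply; have := QE _ y c1 y1; rewrite -/(val _) valB P1 valC subrr mulr0 => <-.
  by apply: eq_mmap => // i; rewrite /y mulrC divfK.
have [O [k [inc [res [inc_inj place_val OP]]]]] := exists_place pair_S0.
have lift P : evp P = 0 -> exists2 o, inc o = val P & res o = 0.
  move=> P0; have [|o oE ores] := OP (val P); first by exists P.
  by exists o => //; apply: ores; exists P; rewrite //= P0.
have chk : p%:R = 0 :> k.
  have [|o oE <-] := lift (p%:Z)%:MP; first by rewrite evpC; exact: pchar_Fp_0.
  rewrite -(rmorph_nat res); congr (res _); apply: inc_inj.
  by rewrite oE valC rmorph_nat.
have g_ex i : exists2 g, inc g = y i & res g = (cz i)%:~R.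
  have [|o oE ores] := lift ('X_i - (cz i)%:MP); first by rewrite evpB evpX evpC subrr.
  exists (o + (cz i)%:~R); rewrite rmorphD rmorph_int ?oE ?ores ?add0r //.
  by rewrite valB valX valC subrK.
pose g i := projT1 (boolp.cid2 (g_ex i)).
have gy i : inc (g i) = y i by rewrite /g; case: boolp.cid2.
have gz i : res (g i) = (cz i)%:~R by rewrite /g; case: boolp.cid2.
pose G : {mpoly O[6]} := \sum_i g i *: 'X_[mon i].
have G_res : map_mpoly res G = 'X_hi6 ^+ p - liftf f k.
  rewrite -[RHS]/(cover k) -cover_sum raddf_sum; apply: eq_bigr => i _ /=.
  by rewrite map_mpolyZ map_mpolyX gz.
have G_inc : map_mpoly inc G = c1^-1 *: wform c.
  rewrite wformE scaler_sumr raddf_sum; apply: eq_bigr => i _ /=.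
  by rewrite map_mpolyZ map_mpolyX gy /y mulrC scalerA.
have G_homog : whomog (split6 w e) d G by rewrite -aE'; exact: wmonomials_homog.
have G_lead : G@_lead = 1.
  rewrite -i1E /G mcoeff_wmonomials //; apply: inc_inj.
  by rewrite gy y1 rmorph1.
(* An exponent of the last variable that is at least [p] uses up the whole weight [d = e * p], so
   the monomial is the leading one. *)
have G_low m : m \in msupp G -> m != lead -> (m hi6 < p)%N.
  move=> /G_homog; rewrite (bigD1 hi6) //= split6_hi => mE; rewrite ltnNge.
  apply: contra => pm; apply/eqP/mnmP => i.
  have le : (e * m hi6 <= e * p)%N by rewrite -d_ep -mE leq_addr.
  have mp : m hi6 = p by apply/eqP; rewrite eqn_leq pm andbT -(leq_pmul2l e_gt0).
  move: mE; rewrite mp d_ep -[RHS]addn0 => /addnI/eqP; rewrite sum_nat_eq0 => /forallP H.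
  have [->|ih] := eqVneq i hi6; first by rewrite mulmnE mnm1E eqxx mul1n.
  have := H i; rewrite ih -aE /= muln_eq0 eqn0Ngt a_gt0 => /eqP ->.
  by rewrite mulmnE mnm1E eq_sym (negPf ih) mul0n.
have := @not_stably_rational K O k inc res inc_inj place_val w e d kappa p f w_gt0 w_o0
  w_dvd2 dE d_ep p_prime chk f_homog f_local (f4_neq0 chk) G G_res G_homog G_lead G_low.
rewrite -aE' => nsr sr; apply: nsr.
have <- // : hypersurface c = cone (map_mpoly inc G).
apply: boolp.funext => v; apply: boolp.propext; rewrite /hypersurface /cone G_inc mevalZ.
split=> -[ptv Fv]; split=> //; first by rewrite Fv mulr0.
by move/eqP: Fv; rewrite mulf_eq0 invr_eq0 (negPf c10) => /eqP.
Qed.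

Theorem not_stably_rational_family : @very_general_not_stably_rational K 6 a d.
Proof.
exists Z => [s|c Uc nZ]; last exact: degenerate.
by split; [exact: Z_closed | exists cK; [exact: family_cK | exact: Z_cK]].
Qed.

End Assembly.

Lemma deriv_map_neq0 (k : fieldType) f j (y : 'I_5 -> k) :
  grad f y j != 0 -> (map_mpoly (intmul 1) f : {mpoly k[5]})^`M(j) != 0.
Proof.
by apply: contraNneq => f0; rewrite /grad /ev -meval_map_int map_mpoly_deriv f0 meval0.
Qed.

Lemma loop5_family (K : closedFieldType) (a : 6.-tuple nat) e d kappa p r :
  (forall n, n.+1%:R != 0 :> K) -> prime p -> d = (e * p)%N -> d = r.+1 -> (1 < r)%N ->
  (kappa + 5 = d)%N -> (forall i, tnth a i = split6 (fun=> 1%N) e i) ->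
  @very_general_not_stably_rational K 6 a d.
Proof.
move=> charK p_prime d_ep dr r1 dE aE.
have e_gt0 : (0 < e)%N by move: d_ep; rewrite dr; case: (e).
have f_homog : whomog (fun=> 1%N) d (loop5 r) by rewrite dr; exact: loop5_homog.
have p_dvd_d : (p %| d)%N by rewrite d_ep dvdn_mull.
apply: (@not_stably_rational_family K charK a (fun=> 1%N) e d kappa p (loop5 r)) => //.
- by rewrite sum_nat_const card_ord.
- exact: (@local_condition_loop5 r p d kappa p_prime p_dvd_d dr r1).
- move=> k _; apply: (@deriv_map_neq0 _ _ _ (fun i => (i == o3)%:R)).
  by rewrite grad_loop5 /= mulr0 mul0rn add0r expr1n oner_neq0.
- by move=> v; apply: smooth_loop5 => //; [exact: prime_gt1 | rewrite -dr].
Qed.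

Lemma loop4_family (K : closedFieldType) :
  (forall n, n.+1%:R != 0 :> K) ->
  @very_general_not_stably_rational K 6 [tuple 1; 1; 1; 1; 2; 5]%N 10.
Proof.
move=> charK.
apply: (@not_stably_rational_family K charK _ wt4 5 10 4 2 loop4) => //.
- by apply: split6_ind => [|]; [elim/ord5_ind|]; rewrite ?split6_low ?split6_hi.
- by elim/ord5_ind.
- by elim/ord5_ind.
- by rewrite sum_ord5.
- exact: loop4_homog.
- exact: local_condition_loop4.
- move=> k k2; apply: (@deriv_map_neq0 _ _ _ (fun=> 1)).
  rewrite grad_loop4 /= expr1n (_ : 1 *+ 5 = 1 + 2%:R * 2%:R); last by ring.
  by rewrite k2 mul0r addr0 oner_neq0.
- exact: smooth_loop4.
Qed.

Theorem corollary1p4 (R : realType) :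
  [/\ (* X_5 in P^5 *)
      @very_general_not_stably_rational (complex R) 6 [tuple 1; 1; 1; 1; 1; 1] 5,
      (* X_6 in P(1^5, 2) *)
      @very_general_not_stably_rational (complex R) 6 [tuple 1; 1; 1; 1; 1; 2] 6,
      (* X_8 in P(1^5, 4) *)
      @very_general_not_stably_rational (complex R) 6 [tuple 1; 1; 1; 1; 1; 4] 8
    & (* X_10 in P(1^4, 2, 5) *)
      @very_general_not_stably_rational (complex R) 6 [tuple 1; 1; 1; 1; 2; 5] 10].

Proof.
have charC n : n.+1%:R != 0 :> complex R by rewrite Num.Theory.pnatr_eq0.
have tupleE e (t : 6.-tuple nat) : t = [tuple 1; 1; 1; 1; 1; e]%N ->
    forall i, tnth t i = split6 (fun=> 1%N) e i.
  move=> ->; apply: split6_ind => [|]; [elim/ord5_ind|]; by rewrite ?split6_low ?split6_hi.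
split.
(* The last coordinate has weight [e], and [d = e * p]: this gives [p = 5, 3, 2] in degrees 5, 6, 8,
   with [kappa = e - 1] and [r = d - 1]. *)
- by apply: (@loop5_family _ _ 1 5 0 5 4 charC) => //; exact: tupleE.
- by apply: (@loop5_family _ _ 2 6 1 3 5 charC) => //; exact: tupleE.
- by apply: (@loop5_family _ _ 4 8 3 2 7 charC) => //; exact: tupleE.
- exact: loop4_family charC.
Qed.
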